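(* Let $A$ be a commutative DG ring and let $\bar{A} := \mathrm{H}^0(A)$. The canonical group homomorphism $$\operatorname{DPic}(A) \to \operatorname{DPic}(\bar{A}),$$ induced by $P \mapsto \bar{A} \otimes^{\mathrm{L}}_A P$, is bijective.
   Context: A commutative DG ring is a graded associative unital ring $A=\bigoplus_{i\le 0}A^i$ with a differential $\mathrm{d}$ of degree $1$ satisfying the graded Leibniz rule, such that $b\cdot a=(-1)^{ij}a\cdot b$ for $a\in A^i$, $b\in A^j$, and $a\cdot a=0$ for $a\in A^i$ with $i$ odd. Commutative rings are DG rings concentrated in degree $0$. There is a canonical DG ring homomorphism $A\to\bar A=\mathrm{H}^0(A)$. $\mathsf{D}(A)$ is the derived category of DG $A$-modules (quasi-isomorphisms inverted). A DG $A$-module $P$ is tilting if there is a DG $A$-module $Q$ with $P\otimes^{\mathrm{L}}_A Q\cong A$ in $\mathsf{D}(A)$. The commutative derived Picard group $\operatorname{DPic}(A)$ is the abelian group whose elements are the isomorphism classes in $\mathsf{D}(A)$ of tilting DG $A$-modules, with product induced by $-\otimes^{\mathrm{L}}_A-$ and unit the class of $A$. For a DG ring homomorphism $A\to B$, the operation $P\mapsto B\otimes^{\mathrm{L}}_A P$ induces a group homomorphism $\operatorname{DPic}(A)\to\operatorname{DPic}(B)$. *)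

(* Defs.v *)
From HB Require Import structures.
From mathcomp Require Import all_boot all_order all_algebra.
From mathcomp Require Import zify boolp.

Set Implicit Arguments.
Unset Strict Implicit.
Unset Printing Implicit Defensive.

Import GRing.Theory.
Local Open Scope ring_scope.
Local Open Scope quotient_scope.

(* A DG abelian group, with an internal grading: M is the direct sum of the
   subgroups M^i := {x | gr i x = x}, where gr i is the projection onto M^i. *)
Record dgGroup (M : zmodType) := DGGroup {
  gr : int -> M -> M;
  diff : M -> M;
  grB : forall i, zmod_morphism (gr i);
  gr_gr : forall i j x, gr i (gr j x) = if i == j then gr j x else 0;
  gr_fin : forall x, exists2 s : seq int, uniq s & x = \sum_(i <- s) gr i x;
  diffB : zmod_morphism diff;
  diff_gr : forall i x, diff (gr i x) = gr (i + 1) (diff x);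
  diff_diff : forall x, diff (diff x) = 0 }.

Section GradedGroup.
Variables (M : zmodType) (D : dgGroup M).

Definition deg (i : int) (x : M) : Prop := gr D i x = x.

HB.instance Definition _ i := GRing.isZmodMorphism.Build M M (gr D i) (grB D i).
HB.instance Definition _ := GRing.isZmodMorphism.Build M M (diff D) (diffB D).

Definition supp (x : M) : seq int := projT1 (cid2 (gr_fin D x)).

Lemma supp_uniq x : uniq (supp x).
Proof. by rewrite /supp; case: cid2. Qed.

Lemma supp_sum x : x = \sum_(i <- supp x) gr D i x.
Proof. by rewrite /supp; case: cid2. Qed.

Lemma gr_out s x : uniq s -> x = \sum_(i <- s) gr D i x ->
  forall j, j \notin s -> gr D j x = 0.
Proof.
move=> us xs j js; rewrite {1}xs raddf_sum big_seq big1 //= => i is_.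
by rewrite gr_gr; case: eqP => // ji; rewrite ji is_ in js.
Qed.

Lemma gr_deg i x : deg i (gr D i x).
Proof. by rewrite /deg gr_gr eqxx. Qed.

Lemma deg_gr i j x : deg j x -> gr D i x = if i == j then x else 0.
Proof. by move=> <-; rewrite gr_gr. Qed.

Lemma deg_diff i x : deg i x -> deg (i + 1) (diff D x).
Proof. by move=> ix; rewrite /deg -diff_gr ix. Qed.

Lemma deg0 i : deg i 0. Proof. exact: raddf0. Qed.

Lemma degN i x : deg i x -> deg i (- x).
Proof. by rewrite /deg raddfN /= => ->. Qed.

Lemma degD i x y : deg i x -> deg i y -> deg i (x + y).
Proof. by rewrite /deg raddfD /= => -> ->. Qed.

Lemma degMz i x k : deg i x -> deg i (x *~ k).
Proof. by rewrite /deg raddfMz /= => ->. Qed.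

(* \sum_i F i (x_i), where x_i is the component of x in degree i *)
Definition gsum (G : zmodType) (F : int -> M -> G) (x : M) : G :=
  \sum_(i <- supp x) F i (gr D i x).

Section Gsum.
Variables (G : zmodType) (F : int -> M -> G).
Hypothesis FB : forall i, zmod_morphism (F i).

Let F0 i : F i 0 = 0. Proof. by rewrite -[X in F i X](subrr 0) FB subrr. Qed.

Lemma big_sub_seq (s t : seq int) (f : int -> G) : uniq s -> uniq t ->
  {subset s <= t} -> (forall i, i \notin s -> f i = 0) ->
  \sum_(i <- t) f i = \sum_(i <- s) f i.
Proof.
move=> us ut st fz; rewrite (bigID (mem s)) /= [X in _ + X]big1 => [|i]; last exact: fz.
rewrite addr0 -big_filter; apply: perm_big; apply: uniq_perm => //.
  exact: filter_uniq.
by move=> i; rewrite mem_filter /=; case: (boolP (i \in s)) => //= /st.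
Qed.

Lemma gsumE s x : uniq s -> (forall i, i \notin s -> gr D i x = 0) ->
  gsum F x = \sum_(i <- s) F i (gr D i x).
Proof.
move=> us sx; pose t := undup (s ++ supp x).
have ut : uniq t by exact: undup_uniq.
rewrite /gsum -(@big_sub_seq (supp x) t (fun i => F i (gr D i x))) //.
- rewrite (@big_sub_seq s t (fun i => F i (gr D i x))) //.
    by move=> i is_; rewrite mem_undup mem_cat is_.
  by move=> i /sx ->.
- exact: supp_uniq.
- by move=> i is_; rewrite mem_undup mem_cat is_ orbT.
- by move=> i /(gr_out (supp_uniq x) (supp_sum x)) ->.
Qed.

Lemma gsum_additive : zmod_morphism (gsum F).
Proof.
move=> x y; pose t := undup (supp x ++ supp y).
have out z : {subset supp z <= t} -> forall i, i \notin t -> gr D i z = 0.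
  move=> zt i it; apply: (gr_out (supp_uniq z) (supp_sum z)).
  by apply: contra it; exact: zt.
have ox : forall i, i \notin t -> gr D i x = 0.
  by apply: out => i ix; rewrite mem_undup mem_cat ix.
have oy : forall i, i \notin t -> gr D i y = 0.
  by apply: out => i ix; rewrite mem_undup mem_cat ix orbT.
rewrite !(@gsumE t) ?undup_uniq //; last first.
  by move=> i it; rewrite raddfB /= ox // oy // subrr.
by rewrite -sumrB; apply: eq_bigr => i _; rewrite raddfB /= FB.
Qed.

Lemma gsum_deg i x : deg i x -> gsum F x = F i x.
Proof.
move=> ix; rewrite (@gsumE [:: i]) // => [|j]; first by rewrite big_seq1 ix.
by rewrite inE (deg_gr j ix) => /negPf ->.
Qed.

End Gsum.

Lemma hom_ind (P : M -> Prop) : P 0 -> (forall x y, P x -> P y -> P (x + y)) ->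
  (forall i x, deg i x -> P x) -> forall x, P x.
Proof.
move=> P0 PD Ph x; rewrite (supp_sum x); elim/big_ind: _ => // i _.
exact: (Ph i _ (gr_deg i x)).
Qed.

Definition cocycle (i : int) : {pred M} :=
  fun x => `[< deg i x /\ diff D x = 0 >].

Lemma cocycle_zmod_closed i : zmod_closed (cocycle i).
Proof.
split=> [|x y /asboolP[dx zx] /asboolP[dy zy]]; apply/asboolP.
  by split; [exact: deg0 | rewrite raddf0].
by split; [apply: degD => //; exact: degN | rewrite raddfB /= zx zy subrr].
Qed.
HB.instance Definition _ i :=
  GRing.isZmodClosed.Build M (cocycle i) (cocycle_zmod_closed i).

Record Zgrp (i : int) := Zsub { zval :> M; zvalP : zval \in cocycle i }.
HB.instance Definition _ i := [isSub for @zval i].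
HB.instance Definition _ i := [Choice of Zgrp i by <:].
HB.instance Definition _ i := [SubChoice_isSubZmodule of Zgrp i by <:].

Definition coboundary (i : int) : {pred Zgrp i} :=
  fun z => `[< exists2 y : M, deg (i - 1) y & val z = diff D y >].

Lemma coboundary_zmod_closed i : zmod_closed (@coboundary i).
Proof.
split=> [|x y /asboolP[a da xa] /asboolP[b db yb]]; apply/asboolP.
  by exists 0; [exact: deg0 | rewrite raddf0 [RHS]raddf0].
exists (a - b); first by apply: degD => //; exact: degN.
by rewrite raddfB /= xa yb [RHS]raddfB.
Qed.
HB.instance Definition _ i :=
  GRing.isZmodClosed.Build (Zgrp i) (@coboundary i) (coboundary_zmod_closed i).

(* H^i(M) = Z^i(M) / B^i(M) *)
Definition coh (i : int) := Quotient.quot (@coboundary i).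
HB.instance Definition _ i := GRing.Zmodule.on (coh i).

End GradedGroup.

(* The sign (-1)^i; x *~ sg i is x with this sign. *)
Definition sg (i : int) : int := (-1) ^ i.

Lemma sgD i j : sg (i + j) = sg i * sg j.
Proof. by rewrite /sg exprzDr // unitrN1. Qed.

Lemma sg1 : sg 1 = -1. Proof. by []. Qed.

Lemma sgsq i : sg i * sg i = 1.
Proof. by rewrite -sgD /sg -{1 2}[i]mul1r -mulrDl -exprz_exp [X in X ^ i](_ : _ = 1) ?exp1rz. Qed.

Record cdgRing := CDGRing {
  cdg_ring :> pzRingType;
  cdg : dgGroup cdg_ring;
  cdg_deg1 : deg cdg 0 1;
  cdg_degM : forall i j (a b : cdg_ring),
    deg cdg i a -> deg cdg j b -> deg cdg (i + j) (a * b);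
  cdg_npos : forall i (a : cdg_ring), 0 < i -> deg cdg i a -> a = 0;
  cdg_leibniz : forall i (a b : cdg_ring), deg cdg i a ->
    diff cdg (a * b) = diff cdg a * b + (a * diff cdg b) *~ sg i;
  cdg_comm : forall i j (a b : cdg_ring), deg cdg i a -> deg cdg j b ->
    b * a = (a * b) *~ sg (i * j);
  cdg_odd : forall i (a : cdg_ring), odd `|i|%N -> deg cdg i a -> a * a = 0 }.

Record cdgHom (A B : cdgRing) := CDGHom {
  cdgh :> {rmorphism A -> B};
  cdgh_gr : forall i a, cdgh (gr (cdg A) i a) = gr (cdg B) i (cdgh a);
  cdgh_diff : forall a, cdgh (diff (cdg A) a) = diff (cdg B) (cdgh a) }.

Definition cdgId (A : cdgRing) : cdgHom A A :=
  @CDGHom A A idfun (fun i a => erefl) (fun a => erefl).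

Record dgMod (A : cdgRing) := DGMod {
  dgm_lmod :> lmodType A;
  dgm : dgGroup dgm_lmod;
  dgm_degZ : forall i j (a : A) (m : dgm_lmod),
    deg (cdg A) i a -> deg dgm j m -> deg dgm (i + j) (a *: m);
  dgm_leibniz : forall i (a : A) (m : dgm_lmod), deg (cdg A) i a ->
    diff dgm (a *: m) = diff (cdg A) a *: m + (a *: diff dgm m) *~ sg i }.

Record dgHom (A : cdgRing) (M N : dgMod A) := DGHom {
  dgh :> M -> N;
  dgh_linear : linear dgh;
  dgh_gr : forall i m, dgh (gr (dgm M) i m) = gr (dgm N) i (dgh m);
  dgh_diff : forall m, dgh (diff (dgm M) m) = diff (dgm N) (dgh m) }.

Lemma dgId_linear (A : cdgRing) (M : dgMod A) : linear (fun m : M => m).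
Proof. by []. Qed.

Definition dgId (A : cdgRing) (M : dgMod A) : dgHom M M :=
  @DGHom A M M (fun m => m) (@dgId_linear A M) (fun i m => erefl) (fun m => erefl).

Section DGComp.
Variables (A : cdgRing) (M N P : dgMod A) (f : dgHom M N) (g : dgHom N P).

Lemma dgComp_linear : linear (g \o f).
Proof. by move=> a x y /=; rewrite !dgh_linear. Qed.

Lemma dgComp_gr i m : (g \o f) (gr (dgm M) i m) = gr (dgm P) i ((g \o f) m).
Proof. by rewrite /= !dgh_gr. Qed.

Lemma dgComp_diff m : (g \o f) (diff (dgm M) m) = diff (dgm P) ((g \o f) m).
Proof. by rewrite /= !dgh_diff. Qed.

Definition dgComp : dgHom M P := DGHom dgComp_linear dgComp_gr dgComp_diff.

End DGComp.

Section Cohomology.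
Variables (A : cdgRing) (M N : dgMod A) (f : dgHom M N).

Lemma dgh_zmod : zmod_morphism f.
Proof. by move=> x y; rewrite addrC -scaleN1r dgh_linear scaleN1r addrC. Qed.

Lemma dgh_cocycle i (z : Zgrp (dgm M) i) : f (val z) \in cocycle (dgm N) i.
Proof.
have [dz zz] := asboolP _ (valP z); apply/asboolP; split.
  by rewrite /deg -dgh_gr dz.
by rewrite -dgh_diff zz -[X in f X](subrr 0) dgh_zmod subrr.
Qed.

Definition Zmap i (z : Zgrp (dgm M) i) : Zgrp (dgm N) i := Zsub (dgh_cocycle z).

Definition cohmap i (x : coh (dgm M) i) : coh (dgm N) i :=
  \pi_(coh (dgm N) i) (Zmap (repr x)).

Lemma cohmap_pi i (z : Zgrp (dgm M) i) :
  cohmap (\pi_(coh (dgm M) i) z) = \pi_(coh (dgm N) i) (Zmap z).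
Proof.
rewrite /cohmap; case: piP => z' /eqP; rewrite -Quotient.idealrBE => /asboolP[y dy e].
apply/eqP; rewrite eq_sym -Quotient.idealrBE; apply/asboolP; exists (f y).
  by rewrite /deg -dgh_gr dy.
by rewrite /= -dgh_diff -e !raddfB /= dgh_zmod.
Qed.

Definition qis : Prop := forall i, bijective (@cohmap i).

End Cohomology.

Definition acyclic (A : cdgRing) (M : dgMod A) : Prop :=
  forall i (x : coh (dgm M) i), x = 0.

Section Concentrated.
Variable R : comPzRingType.

Definition conc_gr (i : int) (x : R) : R := if i == 0 then x else 0.
Definition conc_diff (x : R) : R := 0.

Lemma conc_grB i : zmod_morphism (conc_gr i).
Proof. by move=> x y; rewrite /conc_gr; case: eqP => // _; rewrite subrr. Qed.

Lemma conc_gr_gr i j x :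
  conc_gr i (conc_gr j x) = if i == j then conc_gr j x else 0.
Proof.
rewrite /conc_gr; case: (i =P j) => [->|ij]; first by case: (j == 0).
case: (i =P 0) => // i0; case: (j =P 0) => // j0; by case: ij; rewrite i0 j0.
Qed.

Lemma conc_gr_fin x : exists2 s : seq int, uniq s & x = \sum_(i <- s) conc_gr i x.
Proof. by exists [:: 0] => //; rewrite big_seq1. Qed.

Lemma conc_diffB : zmod_morphism conc_diff.
Proof. by move=> x y; rewrite /conc_diff subrr. Qed.

Lemma conc_diff_gr i x : conc_diff (conc_gr i x) = conc_gr (i + 1) (conc_diff x).
Proof. by rewrite /conc_gr /conc_diff if_same. Qed.

Lemma conc_diff_diff x : conc_diff (conc_diff x) = 0. Proof. by []. Qed.

Definition conc_dg : dgGroup R := DGGroup conc_grB conc_gr_gr conc_gr_fin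
  conc_diffB conc_diff_gr conc_diff_diff.

Lemma conc_deg i x : deg conc_dg i x -> i = 0 \/ x = 0.
Proof. by rewrite /deg /= /conc_gr; case: eqP => [|_]; [left | right]. Qed.

Lemma conc_degM i j a b :
  deg conc_dg i a -> deg conc_dg j b -> deg conc_dg (i + j) (a * b).
Proof.
case/conc_deg=> [->|->]; last by rewrite mul0r /deg /= /conc_gr if_same.
by case/conc_deg=> [->|->]; rewrite ?mulr0 /deg /= /conc_gr ?if_same.
Qed.

Lemma conc_npos i a : 0 < i -> deg conc_dg i a -> a = 0.
Proof. by move=> i0 /conc_deg[i00|//]; rewrite i00 in i0. Qed.

Lemma conc_leibniz i (a b : R) : deg conc_dg i a ->
  conc_diff (a * b) = conc_diff a * b + (a * conc_diff b) *~ sg i.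
Proof. by rewrite /conc_diff mul0r mulr0 mul0rz addr0. Qed.

Lemma conc_comm i j (a b : R) : deg conc_dg i a -> deg conc_dg j b ->
  b * a = (a * b) *~ sg (i * j).
Proof.
case/conc_deg=> [->|->]; first by rewrite mul0r mulr1z mulrC.
by rewrite mulr0 mul0r mul0rz.
Qed.

Lemma conc_odd i (a : R) : odd `|i|%N -> deg conc_dg i a -> a * a = 0.
Proof. by move=> oi /conc_deg[i0|->]; [rewrite i0 in oi | rewrite mul0r]. Qed.

Definition concRing : cdgRing := @CDGRing R conc_dg (erefl : deg conc_dg 0 1)
  conc_degM conc_npos conc_leibniz conc_comm conc_odd.

End Concentrated.

Section H0.
Variable A : cdgRing.
Local Notation D := (cdg A).
Local Notation Z0 := (Zgrp D 0).

(* The ring H^0(A), and below the DG ring H0 concentrated in degree 0. *)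
Definition H0t := coh D 0.
HB.instance Definition _ := GRing.Zmodule.on H0t.
Local Notation pi0 := (\pi_(coh D 0)).

Lemma diff1 : diff D 1 = 0.
Proof.
have /eqP := cdg_leibniz 1 (cdg_deg1 A).
by rewrite !mulr1 mul1r mulr1z -subr_eq subrr => /eqP <-.
Qed.

Lemma one_cocycle : (1 : A) \in cocycle D 0.
Proof. by apply/asboolP; split; [exact: cdg_deg1 | exact: diff1]. Qed.

Lemma mul_cocycle (x y : Z0) : val x * val y \in cocycle D 0.
Proof.
have [dx zx] := asboolP _ (valP x); have [dy zy] := asboolP _ (valP y).
apply/asboolP; split; first exact: (cdg_degM dx dy).
by rewrite (cdg_leibniz _ dx) zx zy mul0r mulr0 mul0rz addr0.
Qed.

Definition Zone : Z0 := Zsub one_cocycle.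
Definition Zmul (x y : Z0) : Z0 := Zsub (mul_cocycle x y).

Lemma ZmulC : commutative Zmul.
Proof.
move=> x y; apply: val_inj => /=.
have [dx zx] := asboolP _ (valP x); have [dy zy] := asboolP _ (valP y).
exact: (etrans (cdg_comm dy dx) (mulr1z _)).
Qed.

Definition h0_one : H0t := pi0 Zone.
Definition h0_mul (x y : H0t) : H0t := pi0 (Zmul (repr x) (repr y)).

Lemma pi0_eq (x y : Z0) : pi0 x = pi0 y <-> x - y \in coboundary (D := D) (i := 0).
Proof. by rewrite Quotient.idealrBE; split=> /eqP. Qed.

Lemma h0_mul_pi x y : h0_mul (pi0 x) (pi0 y) = pi0 (Zmul x y).
Proof.
have key u v w : pi0 u = pi0 v -> pi0 (Zmul u w) = pi0 (Zmul v w).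
  move=> /pi0_eq/asboolP[a da e]; apply/pi0_eq/asboolP.
  have [dw zw] := asboolP _ (valP w).
  exists (a * val w); first by have := cdg_degM da dw; rewrite addr0.
  by rewrite (cdg_leibniz _ da) zw mulr0 mul0rz addr0 -e /= mulrBl.
rewrite /h0_mul (key _ x) ?reprK // ZmulC (key _ y) ?reprK //.
by rewrite ZmulC.
Qed.

Lemma h0_mulA : associative h0_mul.
Proof.
elim/quotW=> x; elim/quotW=> y; elim/quotW=> z.
rewrite (h0_mul_pi y z) (h0_mul_pi x (Zmul y z)) (h0_mul_pi x y).
rewrite (h0_mul_pi (Zmul x y) z).
by apply: (congr1 pi0); apply: val_inj => /=; rewrite mulrA.
Qed.

Lemma h0_mulC : commutative h0_mul.
Proof. by move=> x y; rewrite /h0_mul ZmulC. Qed.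

Lemma h0_mul1 : left_id h0_one h0_mul.
Proof.
elim/quotW=> x; rewrite (h0_mul_pi Zone x).
by apply: (congr1 pi0); apply: val_inj => /=; rewrite mul1r.
Qed.

Lemma pi0D x y : pi0 (x + y) = (pi0 x + pi0 y : H0t).
Proof. exact: Quotient.pi_add. Qed.

Lemma h0_mulDl : left_distributive h0_mul +%R.
Proof.
elim/quotW=> x; elim/quotW=> y; elim/quotW=> z.
rewrite -(pi0D x y) (h0_mul_pi x z) (h0_mul_pi y z) (h0_mul_pi (x + y) z) -pi0D.
by apply: (congr1 pi0); apply: val_inj => /=; rewrite mulrDl.
Qed.

HB.instance Definition _ := GRing.Zmodule_isComPzRing.Build H0t
  h0_mulA h0_mulC h0_mul1 h0_mulDl.

Definition H0 : cdgRing := concRing H0t.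

Lemma gr0_cocycle (a : A) : gr D 0 a \in cocycle D 0.
Proof.
apply/asboolP; split; first exact: gr_deg.
apply: (@cdg_npos A 1) => //.
by rewrite diff_gr; exact: gr_deg.
Qed.

Definition h0_map (a : A) : H0t := pi0 (Zsub (gr0_cocycle a)).

Lemma h0_mapB : zmod_morphism h0_map.
Proof.
move=> a b; rewrite /h0_map; transitivity (pi0 (Zsub (gr0_cocycle a) - Zsub (gr0_cocycle b))).
  by apply: (congr1 pi0); apply: val_inj; rewrite /= raddfB.
by rewrite raddfB.
Qed.
HB.instance Definition _ := GRing.isZmodMorphism.Build A H0t h0_map h0_mapB.

Lemma h0_map0 i a : i != 0 -> deg D i a -> h0_map a = 0.
Proof.
move=> i0 da; rewrite -(raddf0 h0_map) /h0_map.
apply: (congr1 pi0); apply: val_inj => /=.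
by rewrite (deg_gr 0 da) eq_sym (negPf i0) raddf0.
Qed.

Lemma h0_mapM : monoid_morphism h0_map.
Proof.
split; first by apply: (congr1 pi0); apply: val_inj; rewrite /= cdg_deg1.
move=> a b; move: a; apply: (@hom_ind _ D) => [|x y|i x dx].
- by rewrite mul0r raddf0 mul0r.
- by rewrite mulrDl !raddfD /= mulrDl => -> ->.
move: b; apply: (@hom_ind _ D) => [|y z|j y dy].
- by rewrite mulr0 raddf0 mulr0.
- by rewrite mulrDr !raddfD /= mulrDr => -> ->.
have dxy := cdg_degM dx dy.
have [i0|i0] := eqVneq i 0; last first.
  rewrite (h0_map0 i0 dx) mul0r.
  have [ij|ij] := eqVneq (i + j) 0; last exact: h0_map0 ij dxy.
  have [ip|] := boolP (0 < i); first by rewrite (cdg_npos ip dx) mul0r raddf0.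
  have [jp|jn] := boolP (0 < j); first by rewrite (cdg_npos jp dy) mulr0 raddf0.
  by lia.
have [j0|j0] := eqVneq j 0; last first.
  by rewrite (h0_map0 j0 dy) mulr0; apply: h0_map0 dxy; rewrite i0 add0r.
subst i j; rewrite [RHS]h0_mul_pi; apply: (congr1 pi0); apply: val_inj => /=.
by rewrite dx dy; rewrite addr0 in dxy.
Qed.
HB.instance Definition _ := GRing.isMonoidMorphism.Build A H0t h0_map h0_mapM.

Lemma h0_map_gr i a : h0_map (gr D i a) = gr (cdg H0) i (h0_map a).
Proof.
rewrite /= /conc_gr; have [->|i0] := eqVneq i 0; last exact: h0_map0 i0 (gr_deg D i a).
by apply: (congr1 pi0); apply: val_inj => /=; rewrite gr_gr eqxx.
Qed.

Lemma h0_map_diff a : h0_map (diff D a) = diff (cdg H0) (h0_map a).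
Proof.
rewrite /= /conc_diff -[RHS](_ : pi0 0 = 0); last exact: raddf0.
apply/pi0_eq/asboolP; exists (gr D (- 1) a); first by rewrite sub0r; exact: gr_deg.
by rewrite subr0 /= diff_gr addNr.
Qed.

Definition toH0 : cdgHom A H0 := @CDGHom A H0 h0_map h0_map_gr h0_map_diff.

End H0.

Section Tensor.
Variables (A B : cdgRing) (phi : cdgHom A B) (M : dgMod B) (N : dgMod A).

(* Bi-additive maps on M x N, balanced for the right action
   m . a = (-1)^(|a||m|) a m of A on M (through phi) and the left action on N. *)
Record balanced (G : zmodType) (b : M -> N -> G) : Prop := Balanced {
  balBl : forall n, zmod_morphism (b ^~ n);
  balBr : forall m, zmod_morphism (b m);
  balZ : forall i j (a : A) m n, deg (cdg A) i a -> deg (dgm M) j m ->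
    b (phi a *: m) n *~ sg (i * j) = b m (a *: n) }.

(* A sequence s stands for the formal sum of the m (x) n, for (m, n) in s. *)
Definition fsum (G : zmodType) (b : M -> N -> G) (s : seq (M * N)) : G :=
  \sum_(p <- s) b p.1 p.2.

(* M (x)_A N is the quotient of the group of formal sums by the relations of a
   balanced bi-additive map, so two formal sums agree in it if and only if every
   balanced map sends them to the same element; see tens_balanced, tens_lift_tens
   and tensor_ext for the universal property. *)
Definition tens_eq (s t : seq (M * N)) : bool :=
  `[< forall (G : zmodType) (b : M -> N -> G), balanced b -> fsum b s = fsum b t >].

Lemma tens_eq_equiv : equiv_class_of tens_eq.
Proof.
split=> [s|s t|t s u].
- exact/asboolP.
- by apply/idP/idP => /asboolP e; apply/asboolP => G b bb; rewrite e.
- by move=> /asboolP e /asboolP f; apply/asboolP => G b bb; rewrite e // f.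
Qed.
Canonical tens_eq_equivRel := EquivRelPack tens_eq_equiv.

Definition tensor := {eq_quot tens_eq}.
HB.instance Definition _ := EqQuotient.on tensor.
HB.instance Definition _ := Choice.on tensor.

Local Notation pit := (\pi_tensor).

Lemma pitP s t : pit s = pit t <->
  forall (G : zmodType) (b : M -> N -> G), balanced b -> fsum b s = fsum b t.
Proof. by split=> [/eqmodP/asboolP|h]; last by apply/eqmodP/asboolP. Qed.

Definition fopp (s : seq (M * N)) := [seq (- p.1, p.2) | p <- s].

Lemma fsum_cat (G : zmodType) (b : M -> N -> G) s t : fsum b (s ++ t) = fsum b s + fsum b t.
Proof. exact: big_cat. Qed.

Lemma bal0l (G : zmodType) (b : M -> N -> G) n : balanced b -> b 0 n = 0.
Proof. by move=> bb; have := balBl bb n 0 0; rewrite /= !subrr. Qed.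

Lemma balNl (G : zmodType) (b : M -> N -> G) m n : balanced b -> b (- m) n = - b m n.
Proof. by move=> bb; have := balBl bb n 0 m; rewrite /= bal0l // !sub0r. Qed.

Lemma fsum_opp (G : zmodType) (b : M -> N -> G) s : balanced b -> fsum b (fopp s) = - fsum b s.
Proof.
move=> bb; rewrite /fsum big_map -sumrN; apply: eq_bigr => p _ /=.
exact: balNl.
Qed.

Definition tens_zero : tensor := pit [::].
Definition tens_add (x y : tensor) : tensor := pit (repr x ++ repr y).
Definition tens_opp (x : tensor) : tensor := pit (fopp (repr x)).

Lemma fsum_repr (G : zmodType) (b : M -> N -> G) s : balanced b -> fsum b (repr (pit s)) = fsum b s.
Proof. by move=> bb; move: (reprK (pit s)) => /pitP; apply. Qed.

Lemma tens_add_pi s t : tens_add (pit s) (pit t) = pit (s ++ t).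
Proof. by apply/pitP => G b bb; rewrite !fsum_cat !fsum_repr. Qed.

Lemma tens_opp_pi s : tens_opp (pit s) = pit (fopp s).
Proof. by apply/pitP => G b bb; rewrite !fsum_opp ?fsum_repr. Qed.

Lemma tens_addA : associative tens_add.
Proof.
elim/quotW=> x; elim/quotW=> y; elim/quotW=> z.
by rewrite (tens_add_pi y z) (tens_add_pi x) (tens_add_pi x y) (tens_add_pi _ z) catA.
Qed.

Lemma tens_addC : commutative tens_add.
Proof. by move=> x y; apply/pitP => G b bb; rewrite !fsum_cat addrC. Qed.

Lemma tens_add0 : left_id tens_zero tens_add.
Proof. by elim/quotW=> x; rewrite tens_add_pi. Qed.

Lemma tens_addN : left_inverse tens_zero tens_opp tens_add.
Proof.
elim/quotW=> x; rewrite tens_opp_pi tens_add_pi; apply/pitP => G b bb.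
by rewrite fsum_cat fsum_opp // addNr /fsum big_nil.
Qed.

HB.instance Definition _ := GRing.isZmodule.Build tensor
  tens_addA tens_addC tens_add0 tens_addN.

Definition tens (m : M) (n : N) : tensor := pit [:: (m, n)].

Definition tens_lift (G : zmodType) (b : M -> N -> G) (x : tensor) : G :=
  fsum b (repr x).

Lemma pit_add s t : pit s + pit t = pit (s ++ t).
Proof. exact: tens_add_pi. Qed.

Lemma pit_opp s : - pit s = pit (fopp s).
Proof. exact: tens_opp_pi. Qed.

Lemma pit_sum s : pit s = \sum_(p <- s) tens p.1 p.2.
Proof.
elim: s => [|[m n] s IH]; first by rewrite big_nil.
by rewrite big_cons -IH /= pit_add.
Qed.

Section Lift.
Variables (G : zmodType) (b : M -> N -> G).
Hypothesis bb : balanced b.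

Lemma tens_lift_tens m n : tens_lift b (tens m n) = b m n.
Proof. by rewrite /tens_lift fsum_repr // /fsum big_seq1. Qed.

Lemma tens_liftB : zmod_morphism (tens_lift b).
Proof.
elim/quotW=> x; elim/quotW=> y; rewrite /tens_lift pit_opp pit_add.
by rewrite !fsum_repr // fsum_cat fsum_opp.
Qed.

End Lift.

Lemma tens_balanced : balanced tens.
Proof.
have pB (u v w : M * N) :
    (forall (G : zmodType) (b : M -> N -> G), balanced b ->
      b w.1 w.2 = b u.1 u.2 - b v.1 v.2) ->
    tens w.1 w.2 = tens u.1 u.2 - tens v.1 v.2.
  move=> h; rewrite /tens pit_opp pit_add; apply/pitP => G b bb.
  rewrite fsum_cat fsum_opp // /fsum !big_seq1; exact: h.
split=> [n x y|m x y|i j a m n da dm].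
- by apply: (pB (x, n) (y, n) (x - y, n)) => G b bb; exact: balBl.
- by apply: (pB (m, x) (m, y) (m, x - y)) => G b bb; exact: balBr.
have sgE : sg (i * j) = 1 \/ sg (i * j) = -1.
  have /eqP := sgsq (i * j); rewrite -expr2 sqrf_eq1.
  by case/orP => /eqP ->; [left | right].
case: sgE (fun G b bb => @balZ G b bb i j a m n da dm) => -> h.
  by rewrite mulr1z; apply/pitP => G b bb; rewrite /fsum !big_seq1 /= -(h G b bb) mulr1z.
rewrite mulrNz mulr1z pit_opp; apply/pitP => G b bb.
by rewrite fsum_opp // /fsum !big_seq1 /= -(h G b bb) mulrNz mulr1z.
Qed.

Lemma tensBl n : zmod_morphism (tens ^~ n).
Proof. exact: (balBl tens_balanced). Qed.
Lemma tensBr m : zmod_morphism (tens m).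
Proof. exact: (balBr tens_balanced). Qed.
HB.instance Definition _ m := GRing.isZmodMorphism.Build N tensor (tens m) (tensBr m).

Lemma tensBl' m m' n : tens (m - m') n = tens m n - tens m' n.
Proof. exact: tensBl. Qed.
Lemma tens0l n : tens 0 n = 0. Proof. exact: bal0l tens_balanced. Qed.
Lemma tensNl m n : tens (- m) n = - tens m n.
Proof. exact: balNl tens_balanced. Qed.
Lemma tensDl m m' n : tens (m + m') n = tens m n + tens m' n.
Proof. by rewrite -[m']opprK tensBl' tensNl !opprK. Qed.
Lemma tensMnl m n k : tens (m *+ k) n = tens m n *+ k.
Proof. by elim: k => [|k IH]; rewrite ?mulr0n ?tens0l // !mulrS tensDl IH. Qed.
Lemma tensMzl m n k : tens (m *~ k) n = tens m n *~ k.
Proof. by case: k => k; rewrite ?NegzE ?mulrNz ?tensNl -!pmulrn tensMnl. Qed.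
Lemma tensZ i j (a : A) m n : deg (cdg A) i a -> deg (dgm M) j m ->
  tens m (a *: n) = tens (phi a *: m) n *~ sg (i * j).
Proof. by move=> da dm; rewrite (balZ tens_balanced _ da dm). Qed.

Lemma tensor_ind (P : tensor -> Prop) : P 0 ->
  (forall x y, P x -> P y -> P (x + y)) ->
  (forall i j m n, deg (dgm M) i m -> deg (dgm N) j n -> P (tens m n)) ->
  forall x, P x.
Proof.
move=> P0 PD Pt; elim/quotW=> s; rewrite pit_sum; elim/big_ind: _ => // -[m n] _ /=.
move: m; apply: (@hom_ind _ (dgm M)) => [|x y Px Py|i x dx].
- by rewrite tens0l.
- by rewrite tensDl; exact: PD.
move: n; apply: (@hom_ind _ (dgm N)) => [|y z Py Pz|j y dy].
- by rewrite raddf0.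
- by rewrite raddfD; exact: PD.
exact: Pt dx dy.
Qed.

Lemma tensor_ext (G : zmodType) (f g : tensor -> G) :
  zmod_morphism f -> zmod_morphism g ->
  (forall i j m n, deg (dgm M) i m -> deg (dgm N) j n -> f (tens m n) = g (tens m n)) ->
  f =1 g.
Proof.
move=> fB gB e; have f0 : f 0 = 0 by rewrite -[X in f X](subrr 0) fB subrr.
have g0 : g 0 = 0 by rewrite -[X in g X](subrr 0) gB subrr.
apply: tensor_ind => [|x y ex ey|//]; first by rewrite f0 g0.
have -> : x + y = x - (0 - y) by rewrite opprB subr0.
by rewrite !fB !gB f0 g0 ex ey.
Qed.

Lemma deg_phi i a : deg (cdg A) i a -> deg (cdg B) i (phi a).
Proof. by move=> da; rewrite /deg -cdgh_gr da. Qed.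

Lemma grD (V : zmodType) (D : dgGroup V) k x y :
  gr D k (x + y) = gr D k x + gr D k y.
Proof. exact: raddfD. Qed.

(* b (m (x) n) = (b m) (x) n *)
Definition tens_scale (b : B) : tensor -> tensor :=
  tens_lift (fun m n => tens (b *: m) n).

Lemma tens_scale_balanced b : balanced (fun m n => tens (b *: m) n).
Proof.
split=> [n x y|m x y|i j a m n da dm].
- by rewrite scalerBr tensBl'.
- exact: tensBr.
move: b; apply: (@hom_ind _ (cdg B)) => [|x y ex ey|k b db].
- by rewrite !scale0r !tens0l mul0rz.
- by rewrite !scalerDl !tensDl mulrzDl ex ey.
rewrite (tensZ n da (dgm_degZ db dm)) scalerA (cdg_comm (deg_phi da) db).
rewrite -scalerMzl tensMzl -mulrzA; congr (_ *~ _).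
  by rewrite scalerA.
by rewrite mulrDr sgD.
Qed.

Lemma tens_scale_tens b m n : tens_scale b (tens m n) = tens (b *: m) n.
Proof. exact: tens_lift_tens (tens_scale_balanced b) m n. Qed.

Lemma tens_scaleB b : zmod_morphism (tens_scale b).
Proof. exact: tens_liftB (tens_scale_balanced b). Qed.

Lemma tens_scaleA (b c : B) x : tens_scale b (tens_scale c x) = tens_scale (b * c) x.
Proof.
move: x; apply: tensor_ext => [x y|x y|i j m n _ _]; rewrite ?tens_scaleB //.
by rewrite !tens_scale_tens scalerA.
Qed.

Lemma tens_scale1 : left_id 1 tens_scale.
Proof.
apply: tensor_ext => [x y|x y|i j m n _ _]; rewrite ?tens_scaleB //.
by rewrite tens_scale_tens scale1r.
Qed.

Lemma tens_scaleDr : right_distributive tens_scale +%R.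
Proof.
move=> b x y; rewrite -[y]opprK tens_scaleB; congr (_ + _).
have /= := tens_scaleB b 0 (- y); rewrite sub0r => ->.
by have /= := tens_scaleB b 0 0; rewrite !subrr => ->; rewrite sub0r.
Qed.

Lemma tens_scaleDl x : {morph tens_scale^~ x : b c / b + c}.
Proof.
move=> b c /=; move: x.
apply: (@tensor_ext _ (tens_scale (b + c)) (fun x => tens_scale b x + tens_scale c x)).
- exact: tens_scaleB.
- by move=> x y; rewrite !tens_scaleB opprD addrACA.
by move=> i j m n _ _; rewrite !tens_scale_tens scalerDl tensDl.
Qed.

HB.instance Definition _ := GRing.Zmodule_isLmodule.Build B tensor
  tens_scaleA tens_scale1 tens_scaleDr tens_scaleDl.

Lemma scale_tens b m n : b *: tens m n = tens (b *: m) n.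
Proof. exact: tens_scale_tens. Qed.

Definition tens_gr_fun (k : int) (m : M) (n : N) : tensor :=
  gsum (dgm M) (fun i m' => tens m' (gr (dgm N) (k - i) n)) m.

Lemma tens_gr_balanced k : balanced (tens_gr_fun k).
Proof.
have gB n i : zmod_morphism (fun m' => tens m' (gr (dgm N) (k - i) n)).
  by move=> x y; exact: tensBl'.
split=> [n|m x y|i j a m n da dm].
- by apply: gsum_additive; exact: gB.
- by rewrite -sumrB; apply: eq_bigr => i _; rewrite !raddfB.
have daM := dgm_degZ (deg_phi da) dm.
rewrite /tens_gr_fun (gsum_deg (gB n) daM) (gsum_deg (gB (a *: n)) dm) /=.
have -> : gr (dgm N) (k - j) (a *: n) = a *: gr (dgm N) (k - (i + j)) n.
  move: n; apply: (@hom_ind _ (dgm N)) => [|x y ex ey|l n dn].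
  - by rewrite scaler0 !raddf0.
  - by rewrite scalerDr !grD scalerDr ex ey.
  rewrite (deg_gr _ (dgm_degZ da dn)) (deg_gr _ dn).
  have -> : (k - j == i + l) = (k - (i + j) == l) by apply/eqP/eqP; lia.
  by case: ifP; rewrite ?scaler0.
by rewrite (tensZ _ da dm).
Qed.

Definition tens_gr (k : int) : tensor -> tensor := tens_lift (tens_gr_fun k).

Lemma tens_grB k : zmod_morphism (tens_gr k).
Proof. exact: tens_liftB (tens_gr_balanced k). Qed.
HB.instance Definition _ k :=
  GRing.isZmodMorphism.Build tensor tensor (tens_gr k) (tens_grB k).

Lemma tens_gr_tens k i j m n : deg (dgm M) i m -> deg (dgm N) j n ->
  tens_gr k (tens m n) = if k == i + j then tens m n else 0.
Proof.
move=> dm dn; rewrite /tens_gr tens_lift_tens; last exact: tens_gr_balanced.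
rewrite /tens_gr_fun (gsum_deg _ dm) => [|l x y]; last exact: tensBl'.
rewrite (deg_gr _ dn) subr_eq addrC.
by case: ifP => // _; rewrite raddf0.
Qed.

Lemma tens_gr_gr k l x : tens_gr k (tens_gr l x) = if k == l then tens_gr l x else 0.
Proof.
move: x; apply: (@tensor_ext _ (fun x => tens_gr k (tens_gr l x))
  (fun x => if k == l then tens_gr l x else 0)).
- by move=> x y; rewrite !raddfB.
- by move=> x y; case: ifP; rewrite ?raddfB ?subrr.
move=> i j m n dm dn; rewrite !(tens_gr_tens l dm dn).
case: ifP => [/eqP ->|_]; last by rewrite raddf0 if_same.
by rewrite (tens_gr_tens k dm dn).
Qed.

Lemma tens_gr_fin x :
  exists2 s : seq int, uniq s & x = \sum_(i <- s) tens_gr i x.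
Proof.
suff [s xs] : exists s : seq int, forall t, uniq t -> {subset s <= t} ->
    x = \sum_(i <- t) tens_gr i x.
  exists (undup s); first exact: undup_uniq.
  by apply: xs; [exact: undup_uniq | move=> i; rewrite mem_undup].
move: x; apply: tensor_ind => [|x y [s xs] [t yt]|i j m n dm dn].
- by exists [::] => t _ _; rewrite big1 // => i _; rewrite raddf0.
- exists (s ++ t) => u uu su; under eq_bigr do rewrite raddfD.
  rewrite big_split /= -xs // -?yt // => i ii; apply: su;
    by rewrite mem_cat ii ?orbT.
exists [:: i + j] => t ut st; rewrite (bigD1_seq (i + j)) ?st ?mem_head //=.
rewrite (tens_gr_tens _ dm dn) eqxx big1 ?addr0 // => k /negPf kij.
by rewrite (tens_gr_tens _ dm dn) kij.
Qed.

(* d (m (x) n) = d m (x) n + (-1)^i m (x) d n for m of degree i *)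
Definition tens_diff_fun (m : M) (n : N) : tensor :=
  tens (diff (dgm M) m) n
  + gsum (dgm M) (fun i m' => tens m' (diff (dgm N) n) *~ sg i) m.

Lemma tens_diff_fun_deg i m n : deg (dgm M) i m -> tens_diff_fun m n =
  tens (diff (dgm M) m) n + tens m (diff (dgm N) n) *~ sg i.
Proof.
move=> dm; rewrite /tens_diff_fun (gsum_deg _ dm) // => j x y.
by rewrite tensBl' mulrzBl.
Qed.

Lemma tens_diff_balanced : balanced tens_diff_fun.
Proof.
split=> [n x y|m x y|i j a m n da dm].
- rewrite /tens_diff_fun gsum_additive => [|i x' y']; last by rewrite tensBl' mulrzBl.
  by rewrite raddfB /= tensBl' opprD addrACA.
- rewrite /tens_diff_fun raddfB /= opprD addrACA; congr (_ + _).
  rewrite -sumrB; apply: eq_bigr => i _.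
  by rewrite !raddfB mulrzBl.
have dpa := deg_phi da.
rewrite (tens_diff_fun_deg _ (dgm_degZ dpa dm)) (tens_diff_fun_deg _ dm).
rewrite (dgm_leibniz _ dpa) (dgm_leibniz _ da) raddfD /= raddfMz /=.
rewrite -cdgh_diff tensDl tensMzl.
rewrite (tensZ n da (deg_diff dm)) (tensZ n (deg_diff da) dm) (tensZ _ da dm).
rewrite !mulrzDl -!mulrzA -!sgD.
rewrite [X in _ = X]addrCA addrA; congr (_ *~ _ + _ *~ sg _ + _ *~ sg _).
- by rewrite mulrDl mul1r -addrA sgD [sg (j + j)]sgD sgsq mulr1.
- by rewrite mulrDr mulr1 addrC.
- exact: addrC.
Qed.

Definition tens_diff : tensor -> tensor := tens_lift tens_diff_fun.

Lemma tens_diffB : zmod_morphism tens_diff.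
Proof. exact: tens_liftB tens_diff_balanced. Qed.
HB.instance Definition _ :=
  GRing.isZmodMorphism.Build tensor tensor tens_diff tens_diffB.

Lemma tens_diff_tens i m n : deg (dgm M) i m -> tens_diff (tens m n) =
  tens (diff (dgm M) m) n + tens m (diff (dgm N) n) *~ sg i.
Proof.
by move=> dm; rewrite /tens_diff tens_lift_tens ?(tens_diff_fun_deg _ dm) //;
  exact: tens_diff_balanced.
Qed.

Lemma tens_diff_gr k x : tens_diff (tens_gr k x) = tens_gr (k + 1) (tens_diff x).
Proof.
move: x; apply: (@tensor_ext _ (tens_diff \o tens_gr k) (tens_gr (k + 1) \o tens_diff)).
- by move=> x y /=; rewrite !raddfB.
- by move=> x y /=; rewrite !raddfB.
move=> i j m n dm dn /=.
rewrite (tens_diff_tens _ dm) (tens_gr_tens _ dm dn) raddfD raddfMz /=.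
rewrite (tens_gr_tens _ (deg_diff dm) dn) (tens_gr_tens _ dm (deg_diff dn)).
have -> : (k + 1 == i + 1 + j) = (k == i + j) by apply/eqP/eqP; lia.
have -> : (k + 1 == i + (j + 1)) = (k == i + j) by apply/eqP/eqP; lia.
case: ifP => _; first exact: tens_diff_tens.
by rewrite raddf0 mul0rz addr0.
Qed.

Lemma tens_diff_diff x : tens_diff (tens_diff x) = 0.
Proof.
move: x; apply: (@tensor_ext _ (tens_diff \o tens_diff) (fun=> 0)).
- by move=> x y /=; rewrite !raddfB.
- by move=> x y; rewrite subrr.
move=> i j m n dm dn /=.
rewrite (tens_diff_tens _ dm) raddfD raddfMz /=.
rewrite (tens_diff_tens _ (deg_diff dm)) (tens_diff_tens _ dm) !diff_diff.
rewrite tens0l raddf0 mul0rz addr0 add0r sgD sg1 mulrN1 mulrNz.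
by rewrite addNr.
Qed.

Definition tens_dg : dgGroup tensor := DGGroup tens_grB tens_gr_gr tens_gr_fin
  tens_diffB tens_diff_gr tens_diff_diff.

Lemma tens_degZ i j (b : B) (x : tensor) :
  deg (cdg B) i b -> deg tens_dg j x -> deg tens_dg (i + j) (b *: x).
Proof.
move=> db; rewrite /deg /= => {2}<-; move: x.
apply: (@tensor_ext _ (fun x => tens_gr (i + j) (b *: x)) (fun x => b *: tens_gr j x)).
- by move=> x y; rewrite !raddfB.
- by move=> x y; rewrite !raddfB.
move=> k l m n dm dn; rewrite scale_tens.
rewrite (tens_gr_tens _ (dgm_degZ db dm) dn) (tens_gr_tens _ dm dn).
have -> : (i + j == i + k + l) = (j == k + l) by apply/eqP/eqP; lia.
by case: ifP; rewrite ?scale_tens ?scaler0.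
Qed.

Lemma tens_leibniz i (b : B) (x : tensor) : deg (cdg B) i b ->
  tens_diff (b *: x) = diff (cdg B) b *: x + (b *: tens_diff x) *~ sg i.
Proof.
move=> db; move: x; apply: (@tensor_ext _ (fun x => tens_diff (b *: x))
  (fun x => diff (cdg B) b *: x + (b *: tens_diff x) *~ sg i)).
- by move=> x y; rewrite !raddfB.
- by move=> x y; rewrite !raddfB /= ?raddfB ?mulrzBl opprD addrACA.
move=> k l m n dm dn.
rewrite scale_tens (tens_diff_tens _ (dgm_degZ db dm)) (tens_diff_tens _ dm).
rewrite (dgm_leibniz _ db) tensDl tensMzl scalerDr !scale_tens mulrzDl -addrA.
by congr (_ + (_ + _)); rewrite -scalerMzr scale_tens -mulrzA sgD mulrC.
Qed.

Definition tensorMod : dgMod B := @DGMod B tensor tens_dg tens_degZ tens_leibniz.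

End Tensor.

Section Regular.
Variable A : cdgRing.

Definition reg_dg : dgGroup A^o := cdg A.

Lemma reg_degZ i j (a : A) (m : A^o) :
  deg (cdg A) i a -> deg reg_dg j m -> deg reg_dg (i + j) (a *: m).
Proof. exact: cdg_degM. Qed.

Lemma reg_leibniz i (a : A) (m : A^o) : deg (cdg A) i a ->
  diff reg_dg (a *: m) = diff (cdg A) a *: m + (a *: diff reg_dg m) *~ sg i.
Proof. exact: cdg_leibniz. Qed.

Definition regMod : dgMod A := @DGMod A A^o reg_dg reg_degZ reg_leibniz.

End Regular.

(* The derived category D(A) is the Gabriel-Zisman localization of the category
   of DG modules (with strict, i.e. degree 0 and d-compatible, A-linear maps) at
   the quasi-isomorphisms. Its morphisms are the terms of [dmor] up to the
   congruence [deq]. [dcomp u v] is u followed by v. *)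
Inductive dmor (A : cdgRing) : dgMod A -> dgMod A -> Type :=
| dmap M N (f : dgHom M N) : dmor M N
| dinv M N (s : dgHom M N) : qis s -> dmor N M
| dcomp M N P : dmor M N -> dmor N P -> dmor M P.

Inductive deq (A : cdgRing) : forall M N : dgMod A, dmor M N -> dmor M N -> Prop :=
| deq_refl M N (u : dmor M N) : deq u u
| deq_sym M N (u v : dmor M N) : deq u v -> deq v u
| deq_trans M N (u v w : dmor M N) : deq u v -> deq v w -> deq u w
| deq_comp M N P (u u' : dmor M N) (v v' : dmor N P) :
    deq u u' -> deq v v' -> deq (dcomp u v) (dcomp u' v')
| deq_assoc M N P Q (u : dmor M N) (v : dmor N P) (w : dmor P Q) :
    deq (dcomp u (dcomp v w)) (dcomp (dcomp u v) w)
| deq_idl M N (u : dmor M N) : deq (dcomp (dmap (dgId M)) u) u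
| deq_idr M N (u : dmor M N) : deq (dcomp u (dmap (dgId N))) u
| deq_map M N P (f : dgHom M N) (g : dgHom N P) :
    deq (dcomp (dmap f) (dmap g)) (dmap (dgComp f g))
| deq_invr M N (s : dgHom M N) (qs : qis s) :
    deq (dcomp (dmap s) (dinv qs)) (dmap (dgId M))
| deq_invl M N (s : dgHom M N) (qs : qis s) :
    deq (dcomp (dinv qs) (dmap s)) (dmap (dgId N)).

Definition isoD (A : cdgRing) (M N : dgMod A) : Prop :=
  exists (u : dmor M N) (v : dmor N M),
    deq (dcomp u v) (dmap (dgId M)) /\ deq (dcomp v u) (dmap (dgId N)).

Definition isoclass (A : cdgRing) (M : dgMod A) : dgMod A -> Prop :=
  fun N => isoD N M.

Definition Kflat (A : cdgRing) (P : dgMod A) : Prop :=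
  forall M : dgMod A, acyclic M -> acyclic (tensorMod (cdgId A) M P).

(* For phi : A -> B, a DG B-module M and a DG A-module N, the derived tensor
   product of M and N over A, as an isomorphism class of D(B): the class of
   M (x)_A P for a K-flat resolution P -> N over A. *)
Definition dtensor (A B : cdgRing) (phi : cdgHom A B)
    (M : dgMod B) (N : dgMod A) : dgMod B -> Prop :=
  fun T => exists (P : dgMod A) (f : dgHom P N),
    [/\ Kflat P, qis f & isoD T (tensorMod phi M P)].

Definition tilting (A : cdgRing) (P : dgMod A) : Prop :=
  exists Q : dgMod A, dtensor (cdgId A) P Q (regMod A).

Definition DPic (A : cdgRing) :=
  {C : dgMod A -> Prop | exists2 P, tilting P & C = isoclass P}.

(* z is the product of x and y in DPic A *)
Definition dpic_mul (A : cdgRing) (x y z : DPic A) : Prop :=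
  forall P Q, sval x P -> sval y Q -> dtensor (cdgId A) P Q = sval z.

(* y is the image of x under DPic A -> DPic B, P |-> B (x)^L_A P *)
Definition dpic_map (A B : cdgRing) (phi : cdgHom A B)
    (x : DPic A) (y : DPic B) : Prop :=
  forall P, sval x P -> dtensor phi (regMod B) P = sval y.

(* Main.v *)
(* Write H for the DG ring H^0(A).

   A tilting module has an inverse Q, and A -> P (x) Q is an honest
   quasi-isomorphism because A is free of rank one. This makes P bounded above,
   and links any two K-flat representatives of P by a zigzag of
   quasi-isomorphisms P' -> P (x) Q (x) P' <- P of K-flat modules, so that all
   derived tensor products with P are well defined.

   Injectivity: by multiplicativity it suffices that P is isomorphic to A when
   H (x) P is isomorphic to H. The fiber of A -> H is concentrated in negative
   degrees, so P -> H (x) P is an isomorphism on the top cohomology of P. This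
   Nakayama-type argument shows first that P vanishes in positive degrees, then
   lifts the generator of H^0(H (x) P) to a map A -> P, and finally kills the
   cohomology of the fiber of that map from the top down.

   Surjectivity: an invertible P over H has a semifree resolution F with
   generators of bounded above degrees. Lift the matrix of its differential to
   a matrix theta over A^0 and correct it in degrees 0, -1, -2, ...: the part of
   degree -k of the curvature of theta is a chain map F -> N (x) F with
   N = H^{-k}(A) placed in degree -(k+2). As F is invertible, its homotopy class
   lies in H^0(N) = 0, and a null-homotopy tells how to correct theta. The limit
   is a semifree A-module that reduces to F, and it is invertible by the
   criterion used for injectivity. *)
From HB Require Import structures.
From mathcomp Require Import all_boot all_order all_algebra.
From mathcomp Require Import zify ring boolp functions.
Require Import Defs.

Set Implicit Arguments.
Unset Strict Implicit.
Unset Printing Implicit Defensive.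

Import Order.TTheory GRing.Theory Num.Theory.
Local Open Scope ring_scope.
Local Open Scope quotient_scope.

(** * Cohomology and quasi-isomorphisms *)

(** Morphisms of D(A) are formal words in chain maps and inverted quasi-isomorphisms, with no
    calculus of fractions. Two tools extract information from an [isoD]: functors that preserve
    quasi-isomorphisms act on words, and each word induces a relation between cocycles. The relation
    makes cohomology an invariant and turns an isomorphism out of the free module A into an actual
    chain map.

    No dual, Hom complex or finiteness of generators is ever formed. What replaces them is the image
    z of 1 in P (x) Q: it is a finite sum, and this finiteness alone bounds P above; tensoring with
    z also stands in for a dual basis when the obstructions are shown to vanish.

    Lifting works for infinitely many generators because A has no positive degrees: a homogeneous
    matrix over A is triangular for the degrees of the generators, so only their upper bound
    matters. That is also why boundedness is proved over an arbitrary A and then used for both A and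
    H.

    Signs are carried by the twists [tw] and [twn], so that most identities can be stated without
    homogeneity and checked on homogeneous elements. *)

Notation df M := (diff (dgm M)).

Lemma zmor0 (V W : zmodType) (f : V -> W) : zmod_morphism f -> f 0 = 0.
Proof. by move=> fB; rewrite -[X in f X](subrr 0) fB subrr. Qed.

Lemma zmorN (V W : zmodType) (f : V -> W) : zmod_morphism f ->
  forall x, f (- x) = - f x.
Proof. by move=> fB x; rewrite -[X in f X]sub0r fB (zmor0 fB) sub0r. Qed.

Lemma zmorD (V W : zmodType) (f : V -> W) : zmod_morphism f ->
  forall x y, f (x + y) = f x + f y.
Proof. 
by move=> fB x y; have := fB x (- y); rewrite /= opprK => ->; rewrite (zmorN fB) opprK.
Qed.

Lemma zmorS (V W : zmodType) (f : V -> W) : zmod_morphism f ->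
  forall (I : Type) (s : seq I) (F : I -> V),
    f (\sum_(i <- s) F i) = \sum_(i <- s) f (F i).
Proof. by move=> fB I s F; exact: (big_morph f (zmorD fB) (zmor0 fB)). Qed.

Lemma zmorMz (V W : zmodType) (f : V -> W) : zmod_morphism f ->
  forall x k, f (x *~ k) = f x *~ k.
Proof.
have Mn (g : V -> W) : zmod_morphism g -> forall x n, g (x *+ n) = g x *+ n.
  move=> gB x; elim=> [|n IH]; first by rewrite !mulr0n zmor0.
  by rewrite !mulrS (zmorD gB) IH.
move=> fB x [] n; first exact: Mn.
by rewrite NegzE !mulrNz (zmorN fB) -!pmulrn Mn.
Qed.

Lemma mulz_sgsg (V : zmodType) (x : V) i : x *~ sg i *~ sg i = x.
Proof. by rewrite -mulrzA sgsq. Qed.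

Lemma sgN i : sg (- i) = sg i.
Proof. by rewrite -[RHS]mulr1 -(sgsq (- i)) mulrA -sgD subrr mul1r. Qed.

(** Signs are compared through a witness [k] for half the difference of the exponents, which leaves
    an identity for [ring]. *)
Lemma sg_eq k i j : i = j + (k + k) -> sg i = sg j.
Proof. by move=> ->; rewrite !sgD sgsq mulr1. Qed.

Section Graded.
Variables (M : zmodType) (D : dgGroup M).

Lemma dfB : zmod_morphism (diff D). Proof. exact: diffB. Qed.

Lemma hom_ext (G : zmodType) (f g : M -> G) : zmod_morphism f -> zmod_morphism g ->
  (forall i x, deg D i x -> f x = g x) -> f =1 g.
Proof.
move=> fB gB e x; move: x; apply: (@hom_ind _ D (fun x => f x = g x)) => [|x y ex ey|//].
  by rewrite (zmor0 fB) (zmor0 gB).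
by rewrite (zmorD fB) (zmorD gB) ex ey.
Qed.

Lemma gr_inj x y : (forall i, gr D i x = gr D i y) -> x = y.
Proof.
move=> e; apply/eqP; rewrite -subr_eq0; apply/eqP.
rewrite (supp_sum D (x - y)) big1 // => i _.
by rewrite raddfB /= e subrr.
Qed.

(** The sign (-1)^i on degree i, extended additively: with it the Leibniz rule, shifts and
    homotopies can be stated for inhomogeneous elements. *)
Definition tw (x : M) : M := gsum D (fun i y => y *~ sg i) x.

Lemma twB : zmod_morphism tw.
Proof. by apply: gsum_additive => i x y; exact: mulrzBl. Qed.
HB.instance Definition _ := GRing.isZmodMorphism.Build M M tw twB.

Lemma twE i x : deg D i x -> tw x = x *~ sg i.
Proof. by move=> dx; rewrite /tw (gsum_deg _ dx) // => j y z; exact: mulrzBl. Qed.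

Lemma deg_tw i x : deg D i x -> deg D i (tw x).
Proof. by move=> dx; rewrite (twE dx); exact: degMz. Qed.

Lemma tw_tw x : tw (tw x) = x.
Proof.
move: x; apply: hom_ext => [x y|x y|j x dx]; rewrite ?raddfB //.
by rewrite (twE (deg_tw dx)) (twE dx) mulz_sgsg.
Qed.

Lemma diff_tw x : diff D (tw x) = - tw (diff D x).
Proof.
move: x; apply: (hom_ext (f := diff D \o tw) (g := fun x => - tw (diff D x)))
  => [x y|x y|j x dx] /=; rewrite ?raddfB ?opprD //.
by rewrite (twE dx) (twE (deg_diff dx)) raddfMz /= sgD sg1 mulrN1 mulrNz opprK.
Qed.

Lemma diff_gr' i x : diff D (gr D (i - 1) x) = gr D i (diff D x).
Proof. by rewrite diff_gr subrK. Qed.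

Lemma deg_cobound i x y : deg D i x -> x = diff D y ->
  exists2 z, deg D (i - 1) z & x = diff D z.
Proof.
move=> dx e; exists (gr D (i - 1) y); first exact: gr_deg.
by rewrite diff_gr' -e dx.
Qed.

End Graded.

Section Modules.
Variable A : cdgRing.

HB.instance Definition _ (M N : dgMod A) (f : dgHom M N) :=
  GRing.isLinear.Build A M N *:%R f (dgh_linear f).

Lemma dgHom_eq (M N : dgMod A) (f g : dgHom M N) : f =1 g -> f = g.
Proof.
case: f g => f fl fg fd [g gl gg gd] /= /funext e; move: fl fg fd; rewrite e => *.
by congr DGHom; exact: Prop_irrelevance.
Qed.

Lemma twZ (M : dgMod A) (a : A) (m : M) :
  tw (dgm M) (a *: m) = tw (cdg A) a *: tw (dgm M) m.
Proof.
move: a; apply: (@hom_ext _ (cdg A) _ (fun a => tw (dgm M) (a *: m))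
  (fun a => tw (cdg A) a *: tw (dgm M) m)) => [x y|x y|i a da].
- by rewrite scalerBl raddfB.
- by rewrite raddfB /= scalerBl.
move: m; apply: (@hom_ext _ (dgm M) _ (fun m => tw (dgm M) (a *: m))
  (fun m => tw (cdg A) a *: tw (dgm M) m)) => [x y|x y|j m dm].
- by rewrite scalerBr raddfB.
- by rewrite raddfB /= scalerBr.
rewrite (twE (dgm_degZ da dm)) (twE da) (twE dm).
by rewrite -scalerMzl -scalerMzr -mulrzA sgD mulrC.
Qed.

Lemma twM (a b : A) : tw (cdg A) (a * b) = tw (cdg A) a * tw (cdg A) b.
Proof. exact: (@twZ (regMod A)). Qed.

Lemma tw1 : tw (cdg A) 1 = 1.
Proof. by rewrite (twE (cdg_deg1 A)). Qed.

Lemma leibniz (M : dgMod A) (a : A) (m : M) :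
  df M (a *: m) = diff (cdg A) a *: m + tw (cdg A) a *: df M m.
Proof.
move: a; apply: (@hom_ext _ (cdg A) _ (fun a => df M (a *: m))
  (fun a => diff (cdg A) a *: m + tw (cdg A) a *: df M m)) => [x y|x y|i a da].
- by rewrite scalerBl raddfB.
- by rewrite !raddfB /= !scalerBl opprD addrACA.
by rewrite (dgm_leibniz _ da) (twE da) scalerMzl.
Qed.

Lemma leibnizM (a b : A) :
  diff (cdg A) (a * b) = diff (cdg A) a * b + tw (cdg A) a * diff (cdg A) b.
Proof. exact: (@leibniz (regMod A)). Qed.

Lemma dghMz (M N : dgMod A) (f : dgHom M N) m k : f (m *~ k) = f m *~ k.
Proof. exact: raddfMz. Qed.

Lemma dghZ (M N : dgMod A) (f : dgHom M N) a m : f (a *: m) = a *: f m.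
Proof. exact: linearZ. Qed.

Lemma dgh_deg (M N : dgMod A) (f : dgHom M N) i m : deg (dgm M) i m -> deg (dgm N) i (f m).
Proof. by move=> dm; rewrite /deg -dgh_gr dm. Qed.

(** Vanishing of H^i on elements, which keeps quotients out of the diagram chases. The primitive may
    be inhomogeneous, since [deg_cobound] projects it to degree [i - 1]. *)
Definition exact_at (i : int) (M : dgMod A) : Prop :=
  forall z : M, deg (dgm M) i z -> df M z = 0 -> exists y, z = df M y.

Definition bnd (n : int) (M : dgMod A) : Prop := forall i, n < i -> exact_at i M.

Definition inj_at (i : int) (M N : dgMod A) (f : dgHom M N) : Prop :=
  forall z : M, deg (dgm M) i z -> df M z = 0 ->
    forall y, f z = df N y -> exists x, z = df M x.

Definition surj_at (i : int) (M N : dgMod A) (f : dgHom M N) : Prop :=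
  forall w : N, deg (dgm N) i w -> df N w = 0 ->
    exists z y, [/\ deg (dgm M) i z, df M z = 0 & w = f z + df N y].

Lemma acyclicP (M : dgMod A) : acyclic M <-> forall i, exact_at i M.
Proof.
split=> [ac i z dz zz|ex i].
  have zc : z \in cocycle (dgm M) i by apply/asboolP.
  have /eqP := ac i (\pi_(coh (dgm M) i) (Zsub zc)).
  rewrite -[X in _ == X](raddf0 (\pi_(coh (dgm M) i))) -Quotient.idealrBE subr0.
  by move=> /asboolP[y _ e]; exists y.
elim/quotW => z; have [dz zz] := asboolP _ (valP z).
have [y /(deg_cobound dz)[x dx e]] := ex i _ dz zz.
rewrite -[RHS](raddf0 (\pi_(coh (dgm M) i))); apply/eqP.
by rewrite -Quotient.idealrBE subr0; apply/asboolP; exists x.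
Qed.

Lemma qisP (M N : dgMod A) (f : dgHom M N) :
  qis f <-> forall i, inj_at i f /\ surj_at i f.
Proof.
split=> [qf i|h i].
  have [g fK gK] := qf i; split=> [z dz zz y e|w dw zw].
    have zc : z \in cocycle (dgm M) i by apply/asboolP.
    have wc : df N y \in cocycle (dgm N) i.
      by apply/asboolP; rewrite -e; split; [exact: dgh_deg | rewrite -dgh_diff zz raddf0].
    have /eqP : \pi_(coh (dgm M) i) (Zsub zc) = \pi_(coh (dgm M) i) 0.
      apply: (can_inj fK); rewrite !cohmap_pi; apply/eqP; rewrite -Quotient.idealrBE.
      have [x dx e'] := deg_cobound (dgh_deg f dz) e.
      by apply/asboolP; exists x; rewrite //= raddf0 subr0.
    by rewrite -Quotient.idealrBE subr0 => /asboolP[x _ e']; exists x.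
  have wc : w \in cocycle (dgm N) i by apply/asboolP.
  pose z := repr (g (\pi_(coh (dgm N) i) (Zsub wc))).
  have [dz zz] := asboolP _ (valP z).
  have : \pi_(coh (dgm N) i) (Zsub wc) = \pi_(coh (dgm N) i) (Zmap f z).
    by rewrite -cohmap_pi reprK gK.
  move=> /eqP; rewrite -Quotient.idealrBE => /asboolP[y dy e].
  by exists (val z), y; split=> //; rewrite -e /= addrC subrK.
have [fi fs] := h i.
have inj : injective (@cohmap _ _ _ f i).
  elim/quotW => x; elim/quotW => y; rewrite !cohmap_pi => /eqP.
  rewrite -Quotient.idealrBE => /asboolP[u _ e]; apply/eqP.
  rewrite -Quotient.idealrBE; apply/asboolP.
  have [dz zz] := asboolP _ (valP (x - y)).
  have [|v /(deg_cobound dz)[v' dv e']] := fi _ dz zz u; last by exists v'.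
  by rewrite -e; exact: (raddfB f).
have sur : forall w, exists z, @cohmap _ _ _ f i z = w.
  elim/quotW => w; have [dw zw] := asboolP _ (valP w).
  have [z [y [dz zz e]]] := fs _ dw zw.
  have zc : z \in cocycle (dgm M) i by apply/asboolP.
  exists (\pi_(coh (dgm M) i) (Zsub zc)); rewrite cohmap_pi.
  apply/eqP; rewrite eq_sym -Quotient.idealrBE; apply/asboolP.
  have e2 : val w - f z = df N y by rewrite e addrC addKr.
  have dwz : deg (dgm N) i (val w - f z) by apply: degD => //; apply: degN; exact: dgh_deg.
  by have [x dx e3] := deg_cobound dwz e2; exists x; [exact: dx | exact: e3].
exists (fun w => projT1 (cid (sur w))) => [x|w]; last by case: cid.
by case: cid => y /= /inj.
Qed.

Lemma cohmap_comp (M N P : dgMod A) (f : dgHom M N) (g : dgHom N P) i :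
  @cohmap _ _ _ (dgComp f g) i =1 @cohmap _ _ _ g i \o @cohmap _ _ _ f i.
Proof.
move=> x; rewrite -[x]reprK /= (cohmap_pi f) (cohmap_pi g) cohmap_pi.
by apply: (congr1 (\pi_(coh (dgm P) i))); apply: val_inj.
Qed.

Lemma qis_comp (M N P : dgMod A) (f : dgHom M N) (g : dgHom N P) :
  qis f -> qis g -> qis (dgComp f g).
Proof.
move=> qf qg i; apply: (eq_bij (bij_comp (qg i) (qf i))) => x.
by rewrite cohmap_comp.
Qed.

Lemma qis_compl (M N P : dgMod A) (f : dgHom M N) (g : dgHom N P) :
  qis (dgComp f g) -> qis g -> qis f.
Proof.
move=> qfg qg i; have [h gK hK] := qg i.
have hb : bijective h by exists (@cohmap _ _ _ g i).
apply: (eq_bij (bij_comp hb (qfg i))) => x.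
by rewrite /= cohmap_comp /= gK.
Qed.

Lemma qis_compr (M N P : dgMod A) (f : dgHom M N) (g : dgHom N P) :
  qis (dgComp f g) -> qis f -> qis g.
Proof.
move=> qfg qf i; have [h fK hK] := qf i.
have hb : bijective h by exists (@cohmap _ _ _ f i).
apply: (eq_bij (bij_comp (qfg i) hb)) => x.
by rewrite /= cohmap_comp /= hK.
Qed.

Lemma qis_square (M N M' N' : dgMod A) (f : dgHom M N) (f' : dgHom M' N')
    (a : dgHom M M') (b : dgHom N N') :
  qis a -> qis b -> (forall m, b (f m) = f' (a m)) -> qis f <-> qis f'.
Proof.
move=> qa qb e; have e' : dgComp f b = dgComp a f' by apply: dgHom_eq.
split=> [qf|qf']; first by apply: (@qis_compr _ _ _ a) => //; rewrite -e'; exact: qis_comp.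
by apply: (@qis_compl _ _ _ f b) => //; rewrite e'; exact: qis_comp.
Qed.

Lemma qis_bij (M N : dgMod A) (f : dgHom M N) : bijective f -> qis f.
Proof.
case=> g fK gK; apply/qisP => i; split=> [z dz zz y e|w dw zw].
  by exists (g y); apply: (can_inj fK); rewrite dgh_diff gK.
exists (g w), 0; rewrite raddf0 addr0 gK; split=> //.
  by apply: (can_inj fK); rewrite dgh_gr gK.
by apply: (can_inj fK); rewrite dgh_diff gK zw raddf0.
Qed.

Lemma qis_id (M : dgMod A) : qis (dgId M).
Proof. by apply: qis_bij; exists id. Qed.

(** Weaker than a homotopy: the correction [y] may depend on the cocycle in any way. *)
Lemma qis_homologous (M N : dgMod A) (f g : dgHom M N) :
  (forall z, df M z = 0 -> exists y, f z = g z + df N y) -> qis g -> qis f.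
Proof.
move=> h /qisP qg; apply/qisP => i; have [gi gs] := qg i; split=> [z dz zz y e|w dw zw].
  have [u e'] := h z zz; apply: (gi z dz zz (y - u)).
  by rewrite raddfB /= -e e' addrK.
have [z [y [dz zz e]]] := gs w dw zw; have [u e'] := h z zz.
exists z, (y - u); split=> //; rewrite raddfB /= e e'.
by rewrite -!addrA; congr (_ + _); rewrite addrC subrK.
Qed.

Lemma qis_exact_at (M N : dgMod A) (f : dgHom M N) i : qis f ->
  exact_at i M <-> exact_at i N.
Proof.
move=> /qisP/(_ i)[fi fs]; split=> ex z dz zz.
  have [x [y [dx zx ->]]] := fs z dz zz; have [u ->] := ex x dx zx.
  by exists (f u + y); rewrite raddfD /= dgh_diff.
have [|y e] := ex (f z) (dgh_deg f dz); first by rewrite -dgh_diff zz raddf0.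
exact: fi e.
Qed.

Lemma qis_acyclic (M N : dgMod A) (f : dgHom M N) : qis f -> acyclic M <-> acyclic N.
Proof.
by move=> qf; rewrite !acyclicP; split=> h i; apply/(qis_exact_at i qf).
Qed.

Lemma acyclic_bnd (M : dgMod A) n : acyclic M -> bnd n M.
Proof. by move=> /acyclicP h i _; exact: h. Qed.

Lemma bnd_le (M : dgMod A) m n : (m <= n)%R -> bnd m M -> bnd n M.
Proof. by move=> mn h i ni; apply: h; lia. Qed.

Section RegHom.
Variables (M : dgMod A) (z : M).
Hypotheses (dz : deg (dgm M) 0 z) (zz : df M z = 0).

Let F (a : regMod A) : M := (a : A) *: z.

Lemma regHom_linear : linear F.
Proof. by move=> a x y; rewrite /F scalerDl scalerA. Qed.

Lemma regHom_gr i a : F (gr (dgm (regMod A)) i a) = gr (dgm M) i (F a).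
Proof.
rewrite /F /=; move: a; apply: (@hom_ext _ (cdg A) _ (fun a => gr (cdg A) i a *: z)
  (fun a => gr (dgm M) i (a *: z))) => [x y|x y|j a da].
- by rewrite raddfB scalerBl.
- by rewrite scalerBl raddfB.
rewrite (deg_gr i da); have := dgm_degZ da dz; rewrite addr0 => daz.
by rewrite (deg_gr i daz); case: ifP; rewrite ?scale0r.
Qed.

Lemma regHom_diff a : F (df (regMod A) a) = df M (F a).
Proof. by rewrite /F leibniz zz scaler0 addr0. Qed.

Definition regHom : dgHom (regMod A) M := DGHom regHom_linear regHom_gr regHom_diff.

Lemma regHomE (a : A) : regHom a = a *: z. Proof. by []. Qed.

End RegHom.

End Modules.

(** * Tensor products *)

Section TensorHom.
Variables (A B : cdgRing) (phi : cdgHom A B) (M : dgMod B) (N : dgMod A).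

Lemma df_tens (m : M) (n : N) : df (tensorMod phi M N) (tens phi m n) =
  tens phi (df M m) n + tens phi (tw (dgm M) m) (df N n).
Proof.
move: m; apply: (@hom_ext _ (dgm M) _
  (fun m => df (tensorMod phi M N) (tens phi m n))
  (fun m => tens phi (df M m) n + tens phi (tw (dgm M) m) (df N n))) => [x y|x y|i m dm].
- by rewrite tensBl' raddfB.
- by rewrite !raddfB /= !tensBl' opprD addrACA.
by rewrite /= (tens_diff_tens _ _ dm) (twE dm) tensMzl.
Qed.

Lemma gr_tens k i j (m : M) (n : N) : deg (dgm M) i m -> deg (dgm N) j n ->
  gr (dgm (tensorMod phi M N)) k (tens phi m n) = if k == i + j then tens phi m n else 0.
Proof. exact: tens_gr_tens. Qed.

Lemma deg_tens i j (m : M) (n : N) : deg (dgm M) i m -> deg (dgm N) j n ->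
  deg (dgm (tensorMod phi M N)) (i + j) (tens phi m n).
Proof. by move=> dm dn; rewrite /deg (gr_tens _ dm dn) eqxx. Qed.

Record dgbal (G : dgMod B) (b : M -> N -> G) : Prop := DGBal {
  dgbal_bal : balanced phi b;
  dgbal_lin : forall c m n, b (c *: m) n = c *: b m n;
  dgbal_deg : forall i j m n, deg (dgm M) i m -> deg (dgm N) j n ->
    deg (dgm G) (i + j) (b m n);
  dgbal_diff : forall i j m n, deg (dgm M) i m -> deg (dgm N) j n ->
    df G (b m n) = b (df M m) n + b m (df N n) *~ sg i }.

Section Hom.
Variables (G : dgMod B) (b : M -> N -> G).
Hypothesis bb : dgbal b.
Let bal := dgbal_bal bb.
Let F : tensorMod phi M N -> G := tens_lift b.
Let FB : zmod_morphism F. Proof. exact: tens_liftB bal. Qed.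
Let FE m n : F (tens phi m n) = b m n. Proof. exact: tens_lift_tens bal m n. Qed.

Lemma tens_hom_linear : linear F.
Proof.
move=> c x y; rewrite (zmorD FB); congr (_ + _).
move: x; apply: (@tensor_ext _ _ phi M N _ (fun x => F (c *: x)) (fun x => c *: F x)).
- by move=> x x'; rewrite scalerBr FB.
- by move=> x x'; rewrite FB scalerBr.
by move=> i j m n _ _; rewrite scale_tens !FE (dgbal_lin bb).
Qed.

Lemma tens_hom_gr i x : F (gr (dgm (tensorMod phi M N)) i x) = gr (dgm G) i (F x).
Proof.
move: x; apply: (@tensor_ext _ _ phi M N _ (fun x => F (gr (dgm (tensorMod phi M N)) i x))
  (fun x => gr (dgm G) i (F x))).
- by move=> x x'; rewrite raddfB FB.
- by move=> x x'; rewrite FB raddfB.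
move=> k l m n dm dn; rewrite (gr_tens _ dm dn) FE (deg_gr _ (dgbal_deg bb dm dn)).
by case: ifP => _; [rewrite FE | rewrite (zmor0 FB)].
Qed.

Lemma tens_hom_diff x : F (df (tensorMod phi M N) x) = df G (F x).
Proof.
move: x; apply: (@tensor_ext _ _ phi M N _ (fun x => F (df (tensorMod phi M N) x))
  (fun x => df G (F x))).
- by move=> x x'; rewrite raddfB FB.
- by move=> x x'; rewrite FB raddfB.
move=> k l m n dm dn; rewrite df_tens (twE dm) tensMzl (zmorD FB) (zmorMz FB) !FE.
by rewrite (dgbal_diff bb dm dn).
Qed.

Definition tens_hom : dgHom (tensorMod phi M N) G :=
  DGHom tens_hom_linear tens_hom_gr tens_hom_diff.

Lemma tens_homE m n : tens_hom (tens phi m n) = b m n. Proof. exact: FE. Qed.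

End Hom.

Lemma tens_hom_ext (G : dgMod B) (f g : dgHom (tensorMod phi M N) G) :
  (forall m n, f (tens phi m n) = g (tens phi m n)) -> f =1 g.
Proof.
by move=> e; apply: (@tensor_ext _ _ phi M N) => [x y|x y|i j m n _ _]; rewrite ?raddfB.
Qed.

End TensorHom.

Lemma dgCompE (A : cdgRing) (M N P : dgMod A) (f : dgHom M N) (g : dgHom N P) x :
  dgComp f g x = g (f x).
Proof. by []. Qed.

Section TensorMap.
Variables (A B : cdgRing) (phi : cdgHom A B) (M M' : dgMod B) (N N' : dgMod A).
Variables (f : dgHom M M') (g : dgHom N N').

Lemma tmap_dgbal :
  dgbal phi (G := tensorMod phi M' N') (fun (m : M) (n : N) => tens phi (f m) (g n)).
Proof.
split.
- split=> [n x y|m x y|i j a m n da dm].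
  + by rewrite raddfB tensBl'.
  + by rewrite !raddfB.
  by rewrite !linearZ /= (tensZ _ _ da (dgh_deg f dm)).
- by move=> c m n; rewrite linearZ scale_tens.
- by move=> i j m n dm dn; exact: deg_tens (dgh_deg f dm) (dgh_deg g dn).
move=> i j m n dm dn.
by rewrite df_tens (twE (dgh_deg f dm)) tensMzl -!dgh_diff.
Qed.

Definition tmap : dgHom (tensorMod phi M N) (tensorMod phi M' N') := tens_hom tmap_dgbal.

Lemma tmapE m n : tmap (tens phi m n) = tens phi (f m) (g n).
Proof. exact: tens_homE. Qed.

End TensorMap.

Lemma tmap_id (A B : cdgRing) (phi : cdgHom A B) (M : dgMod B) (N : dgMod A) :
  tmap phi (dgId M) (dgId N) = dgId (tensorMod phi M N).
Proof. by apply/dgHom_eq/tens_hom_ext => m n; rewrite tmapE. Qed.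

Lemma tmap_comp (A B : cdgRing) (phi : cdgHom A B) (M M' M'' : dgMod B)
    (N N' N'' : dgMod A) (f : dgHom M M') (f' : dgHom M' M'') (g : dgHom N N')
    (g' : dgHom N' N'') :
  tmap phi (dgComp f f') (dgComp g g') = dgComp (tmap phi f g) (tmap phi f' g').
Proof. by apply/dgHom_eq/tens_hom_ext => m n; rewrite dgCompE !tmapE. Qed.

Section Assoc.
Variables (A B C : cdgRing) (phi : cdgHom A B) (psi : cdgHom B C) (chi : cdgHom A C).
Hypothesis chiE : forall a, chi a = psi (phi a).
Variables (M : dgMod C) (N : dgMod B) (P : dgMod A).
Local Notation NP := (tensorMod phi N P).
Local Notation MN := (tensorMod psi M N).
Local Notation L := (tensorMod psi M NP).
Local Notation R := (tensorMod chi MN P).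

Let bi (m : M) (n : N) (p : P) : R := tens chi (tens psi m n : MN) p.

Lemma assoc_in m : balanced phi (bi m).
Proof.
split=> [p x y|n x y|i j a n p da dn]; first by rewrite /bi raddfB tensBl'.
  by rewrite /bi raddfB.
move: m; apply: (@hom_ext _ (dgm M) _ (fun m => bi m (phi a *: n) p *~ sg (i * j))
  (fun m => bi m n (a *: p))) => [x y|x y|k m dm].
- by rewrite /bi !tensBl' mulrzBl.
- by rewrite /bi !tensBl'.
rewrite /bi (tensZ _ _ da (deg_tens psi dm dn)) scale_tens chiE.
rewrite (tensZ _ _ (deg_phi phi da) dm) tensMzl -mulrzA -sgD.
by rewrite -mulrDr.
Qed.

Let b (m : M) (t : NP) : R := tens_lift (bi m) t.
Let bE m n p : b m (tens phi n p) = bi m n p.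
Proof. exact: tens_lift_tens (assoc_in m) n p. Qed.
Let bB m : zmod_morphism (b m). Proof. exact: tens_liftB (assoc_in m). Qed.
Let bBl t : zmod_morphism (b ^~ t).
Proof.
move=> x y; move: t; apply: (@tensor_ext _ _ phi N P _ (b (x - y)) (fun t => b x t - b y t)).
- exact: bB.
- by move=> t u; rewrite !bB !opprD addrACA.
by move=> i j n p _ _; rewrite !bE /bi !tensBl'.
Qed.

Lemma assoc_dgbal : dgbal psi (G := R) b.
Proof.
split.
- split=> [t|m|i j c m t dc dm]; [exact: bBl | exact: bB |].
  move: t; apply: (@tensor_ext _ _ phi N P _ (fun t => b (psi c *: m) t *~ sg (i * j))
    (fun t => b m (c *: t))) => [x y|x y|k l n p _ _].
  + by rewrite bB mulrzBl.
  + by rewrite scalerBr bB.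
  by rewrite scale_tens !bE /bi (tensZ _ _ dc dm) tensMzl.
- move=> c m t; move: t; apply: (@tensor_ext _ _ phi N P _ (fun t => b (c *: m) t)
    (fun t => c *: b m t)) => [x y|x y|k l n p _ _].
  + by rewrite bB.
  + by rewrite bB scalerBr.
  by rewrite !bE /bi scale_tens scale_tens.
- move=> i j m t dm dt; rewrite -dt; move: t {dt}.
  rewrite /deg; apply: (@tensor_ext _ _ phi N P _
    (fun t => gr (dgm R) (i + j) (b m (gr (dgm NP) j t)))
    (fun t => b m (gr (dgm NP) j t))) => [x y|x y|k l n p dn dp].
  + by rewrite !(raddfB, bB).
  + by rewrite !(raddfB, bB).
  rewrite (gr_tens _ _ dn dp); case: eqP => [->|_]; last by rewrite (zmor0 (bB m)) raddf0.
  by rewrite bE addrA; exact: deg_tens (deg_tens _ dm dn) dp.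
move=> i j m t dm _; move: t; apply: (@tensor_ext _ _ phi N P _ (fun t => df R (b m t))
    (fun t => b (df M m) t + b m (df NP t) *~ sg i)) => [x y|x y|k l n p dn dp].
- by rewrite bB raddfB.
- by rewrite raddfB /= !bB mulrzBl opprD addrACA.
rewrite df_tens (twE dn) tensMzl (zmorD (bB _)) (zmorMz (bB m)) !bE /bi.
rewrite df_tens df_tens (twE dm) (twE (deg_tens _ dm dn)) !tensMzl tensDl tensMzl.
by rewrite mulrzDl sgD mulrC mulrzA addrA.
Qed.

(** The composite is a separate map [chi], compared pointwise: with identities this is associativity
    over A, and with a base change on either side it moves tensor products through that base
    change. *)
Definition assoc : dgHom L R := tens_hom assoc_dgbal.

Lemma assocE m n p : assoc (tens psi m (tens phi n p : NP)) = tens chi (tens psi m n : MN) p.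
Proof. by rewrite tens_homE bE. Qed.

Let ci (p : P) (m : M) (n : N) : L := tens psi m (tens phi n p : NP).

Lemma assoc_inv_in p : balanced psi (ci p).
Proof.
split=> [n x y|m x y|i j c m n dc dm].
- by rewrite /ci tensBl'.
- by rewrite /ci tensBl' raddfB.
by rewrite /ci -(scale_tens phi) (tensZ _ _ dc dm).
Qed.

Let c (s : MN) (p : P) : L := tens_lift (ci p) s.
Let cE m n p : c (tens psi m n) p = ci p m n.
Proof. exact: tens_lift_tens (assoc_inv_in p) m n. Qed.
Let cB p : zmod_morphism (c^~ p). Proof. exact: tens_liftB (assoc_inv_in p). Qed.

Lemma assoc_inv_balanced : balanced chi c.
Proof.
split=> [p|s x y|i j a s p da ds]; first exact: cB.
  move: s; apply: (@tensor_ext _ _ psi M N _ (c ^~ (x - y)) (fun s => c s x - c s y)).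
  - exact: cB.
  - by move=> t u; rewrite !cB !opprD addrACA.
  by move=> i j m n _ _; rewrite !cE /ci !raddfB.
rewrite -ds; move: s {ds}; apply: (@tensor_ext _ _ psi M N _
    (fun s => c (chi a *: gr (dgm MN) j s) p *~ sg (i * j))
    (fun s => c (gr (dgm MN) j s) (a *: p))) => [x y|x y|k l m n dm dn].
- by rewrite raddfB scalerBr cB mulrzBl.
- by rewrite raddfB cB.
rewrite (gr_tens _ _ dm dn); case: eqP => [->|_].
  rewrite scale_tens !cE /ci chiE (tensZ _ _ da dn) raddfMz /= -(scale_tens phi).
  by rewrite (tensZ _ _ (deg_phi _ da) dm) -mulrzA -sgD mulrDr.
by rewrite scaler0 (zmor0 (cB _)) mul0rz (zmor0 (cB _)).
Qed.

Let c' (x : R) : L := tens_lift c x.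
Let c'E s p : c' (tens chi s p) = c s p.
Proof. exact: tens_lift_tens assoc_inv_balanced s p. Qed.
Let c'B : zmod_morphism c'. Proof. exact: tens_liftB assoc_inv_balanced. Qed.

Lemma assoc_bij : bijective assoc.
Proof.
exists c'.
  move=> x; move: x; apply: (@tensor_ext _ _ psi M NP _ (c' \o assoc) id) => //.
    by move=> x y; rewrite /comp raddfB c'B.
  move=> i j m t dm _; move: t; apply: (@tensor_ext _ _ phi N P _
    (fun t => c' (assoc (tens psi m (t : NP)))) (fun t => tens psi m (t : NP) : L)).
  - move=> x y; have -> : tens psi m (x - y : NP) = tens psi m (x : NP) - tens psi m (y : NP).
      exact: (@tensBr _ _ psi M NP).
    by rewrite raddfB c'B.
  - by move=> x y; exact: (@tensBr _ _ psi M NP).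
  by move=> k l n p _ _; rewrite assocE c'E cE.
move=> x; move: x; apply: (@tensor_ext _ _ chi MN P _ (assoc \o c') id) => //.
  by move=> x y; rewrite /comp c'B raddfB.
move=> i j s p _ _; move: s; apply: (@tensor_ext _ _ psi M N _
    (fun s => assoc (c' (tens chi (s : MN) p))) (fun s => tens chi (s : MN) p : R)).
- by move=> x y; rewrite !tensBl' c'B raddfB.
- by move=> x y; rewrite tensBl'.
by move=> k l m n _ _; rewrite c'E cE assocE.
Qed.

End Assoc.

Section Sym.
Variable A : cdgRing.
Local Notation iA := (cdgId A).

Section Def.
Variables (M N : dgMod A).
Let sgn i j (m : M) (n : N) : tensorMod iA N M := tens iA n m *~ sg (i * j).
Let sgnBr i j m : zmod_morphism (sgn i j m).
Proof. by move=> x y; rewrite /sgn tensBl' mulrzBl. Qed.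
Let sgnBl i j n : zmod_morphism (fun m => sgn i j m n).
Proof. by move=> x y; rewrite /sgn raddfB mulrzBl. Qed.
(** The sign of the symmetry depends on both degrees, so the map is summed over the components of
    both arguments. *)
Let b1 i m n : tensorMod iA N M := gsum (dgm N) (fun j => sgn i j m) n.
Let b m n : tensorMod iA N M := gsum (dgm M) (fun i m' => b1 i m' n) m.

Let b1B i n : zmod_morphism (fun m => b1 i m n).
Proof. by move=> x y; rewrite /b1 /gsum -sumrB; apply: eq_bigr => j _; rewrite sgnBl. Qed.
Let bBl n : zmod_morphism (b ^~ n).
Proof. by apply: gsum_additive => i; exact: b1B. Qed.
Let bBr m : zmod_morphism (b m).
Proof.
move=> x y; rewrite /b /gsum -sumrB; apply: eq_bigr => i _.
by apply: gsum_additive => j; exact: sgnBr.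
Qed.
Let bE i j m n : deg (dgm M) i m -> deg (dgm N) j n -> b m n = tens iA n m *~ sg (i * j).
Proof.
move=> dm dn; rewrite /b (gsum_deg _ dm) => [|k x y]; last exact: b1B.
by rewrite /b1 (gsum_deg _ dn) // => k; exact: sgnBr.
Qed.

Lemma tsym_dgbal : dgbal iA (G := tensorMod iA N M) b.
Proof.
split.
- split=> // i j a m n da dm; move: n.
  apply: (@hom_ext _ (dgm N) _ (fun n => b (iA a *: m) n *~ sg (i * j))
    (fun n => b m (a *: n))) => [x y|x y|k n dn].
  + by rewrite bBr mulrzBl.
  + by rewrite scalerBr bBr.
  rewrite (bE (dgm_degZ da dm) dn) (bE dm (dgm_degZ da dn)) (tensZ _ _ da dn).
  rewrite -!mulrzA -!sgD /=; congr (_ *~ _); apply: (@sg_eq (i * k)); ring.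
- move=> c m n; move: c; apply: (@hom_ext _ (cdg A) _ (fun c => b (c *: m) n)
    (fun c => c *: b m n)) => [x y|x y|k c dc].
  + by rewrite scalerBl bBl.
  + by rewrite scalerBl.
  move: m; apply: (@hom_ext _ (dgm M) _ (fun m => b (c *: m) n)
    (fun m => c *: b m n)) => [x y|x y|i m dm].
  + by rewrite scalerBr bBl.
  + by rewrite bBl scalerBr.
  move: n; apply: (@hom_ext _ (dgm N) _ (fun n => b (c *: m) n)
    (fun n => c *: b m n)) => [x y|x y|j n dn].
  + by rewrite bBr.
  + by rewrite bBr scalerBr.
  rewrite (bE (dgm_degZ dc dm) dn) (bE dm dn) (tensZ _ _ dc dn) -scalerMzr scale_tens /=.
  by rewrite -mulrzA -sgD; congr (_ *~ _); apply: (@sg_eq (k * j)); ring.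
- by move=> i j m n dm dn; rewrite (bE dm dn) [i + j]addrC; apply: degMz; exact: deg_tens.
move=> i j m n dm dn.
rewrite (bE dm dn) (bE (deg_diff dm) dn) (bE dm (deg_diff dn)).
rewrite (zmorMz (dfB _)) df_tens (twE dn) tensMzl mulrzDl addrC -!mulrzA -!sgD.
congr (_ *~ _ + _ *~ _); first by apply: (@sg_eq 0); ring.
by apply: (@sg_eq (- i)); ring.
Qed.

Definition tsym : dgHom (tensorMod iA M N) (tensorMod iA N M) := tens_hom tsym_dgbal.

Lemma tsymE i j m n : deg (dgm M) i m -> deg (dgm N) j n ->
  tsym (tens iA m n) = tens iA n m *~ sg (i * j).
Proof. by move=> dm dn; rewrite tens_homE (bE dm dn). Qed.

End Def.

Lemma tsymK (M N : dgMod A) : cancel (@tsym M N) (@tsym N M).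
Proof.
move=> x; move: x; apply: (@tensor_ext _ _ iA M N _ (tsym N M \o tsym M N) id) => //.
  by move=> x y; rewrite /comp !raddfB.
move=> i j m n dm dn; rewrite /comp (tsymE dm dn) dghMz (tsymE dn dm) mulrC.
by rewrite mulz_sgsg.
Qed.

Lemma tsym_bij (M N : dgMod A) : bijective (tsym M N).
Proof. by exists (tsym N M); exact: tsymK. Qed.

Lemma tsym_nat (M N M' N' : dgMod A) (f : dgHom M M') (g : dgHom N N') x :
  tsym M' N' (tmap iA f g x) = tmap iA g f (tsym M N x).
Proof.
move: x; apply: (@tensor_ext _ _ iA M N _ (tsym M' N' \o tmap iA f g)
  (tmap iA g f \o tsym M N)) => [x y|x y|i j m n dm dn]; rewrite /comp ?raddfB //.
rewrite tmapE (tsymE dm dn) (tsymE (dgh_deg f dm) (dgh_deg g dn)).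
by rewrite dghMz tmapE.
Qed.

Section Unit.
Variable M : dgMod A.

Let b (a : regMod A) (m : M) : M := (a : A) *: m.

Lemma lunit_dgbal : dgbal iA (G := M) b.
Proof.
split.
- split=> [m x y|a x y|i j c a m dc da]; rewrite /b.
  + by rewrite scalerBl.
  + by rewrite scalerBr.
  rewrite scalerA (cdg_comm dc da) -scalerMzl; congr (_ *~ _).
- by move=> c a m; rewrite /b scalerA.
- by move=> i j a m; exact: dgm_degZ.
by move=> i j a m da dm; rewrite /b (dgm_leibniz _ da).
Qed.

Definition lunit : dgHom (tensorMod iA (regMod A) M) M := tens_hom lunit_dgbal.

Lemma lunitE a m : lunit (tens iA a m) = (a : A) *: m.
Proof. exact: tens_homE. Qed.

Lemma lunit_can : cancel lunit (fun m => tens iA (1 : regMod A) m).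
Proof.
move=> x; move: x; apply: (@tensor_ext _ _ iA (regMod A) M _
  (fun x => tens iA (1 : regMod A) (lunit x)) id) => [x y|//|i j a m da dm].
  by rewrite !raddfB.
rewrite lunitE (tensZ iA (i := i) (j := 0)) //; last exact: cdg_deg1.
rewrite mulr0 mulr1z; congr (tens _ _ _); exact: mulr1.
Qed.

Lemma lunit_bij : bijective lunit.
Proof.
exists (fun m => tens iA (1 : regMod A) m) => [|m]; first exact: lunit_can.
by rewrite lunitE scale1r.
Qed.

End Unit.

Definition runit (M : dgMod A) : dgHom (tensorMod iA M (regMod A)) M :=
  dgComp (tsym M (regMod A)) (lunit M).

Lemma runit_bij (M : dgMod A) : bijective (runit M).
Proof. exact: bij_comp (lunit_bij M) (tsym_bij M _). Qed.

Lemma runit1 (M : dgMod A) (m : M) : runit M (tens iA m (1 : regMod A)) = m.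
Proof.
move: m; apply: (@hom_ext _ (dgm M) _ (fun m => runit M (tens iA m (1 : regMod A))) id).
- by move=> x y; rewrite tensBl' raddfB.
- by [].
move=> i m dm; have d1 : deg (dgm (regMod A)) 0 1 := cdg_deg1 A.
by rewrite dgCompE (tsymE dm d1) mulr0 mulr1z lunitE scale1r.
Qed.

End Sym.

(** * Restriction of scalars and fibers *)

Lemma gr_sum (M : zmodType) (D : dgGroup M) (t : seq int) x : uniq t ->
  (forall i, i \notin t -> gr D i x = 0) -> x = \sum_(i <- t) gr D i x.
Proof.
move=> ut xt; apply: (@gr_inj _ D) => j; rewrite raddf_sum.
have [jt|jt] := boolP (j \in t); last first.
  rewrite (xt j jt) big_seq big1 // => i it; rewrite /= gr_gr.
  by case: eqP => // ji; rewrite ji it in jt.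
rewrite (bigD1_seq j) //= gr_gr eqxx big1 ?addr0 // => i ij.
by rewrite /= gr_gr eq_sym (negPf ij).
Qed.

Lemma supp_out (M : zmodType) (D : dgGroup M) x i : i \notin supp D x -> gr D i x = 0.
Proof. exact: (gr_out (supp_uniq D x) (supp_sum D x)). Qed.

Section Restriction.
Variables (A B : cdgRing) (phi : cdgHom A B).

Lemma tw_phi (a : A) : tw (cdg B) (phi a) = phi (tw (cdg A) a).
Proof.
move: a; apply: (@hom_ext _ (cdg A)) => [x y|x y|i a da]; rewrite ?raddfB //.
by rewrite (twE da) (twE (deg_phi phi da)) raddfMz.
Qed.

Section Object.
Variable M : dgMod B.

(** [phi] is recorded in the type so that inference finds the scalar action through it. *)
Definition restr_type of cdgHom A B : Type := M.
Local Notation T := (restr_type phi).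
HB.instance Definition _ := GRing.Zmodule.on T.

Definition restr_scale (a : A) (m : T) : T := phi a *: (m : M).

Lemma restr_scaleA a b m : restr_scale a (restr_scale b m) = restr_scale (a * b) m.
Proof. by rewrite /restr_scale scalerA rmorphM. Qed.
Lemma restr_scale1 : left_id 1 restr_scale.
Proof. by move=> m; rewrite /restr_scale rmorph1 scale1r. Qed.
Lemma restr_scaleDr : right_distributive restr_scale +%R.
Proof. by move=> a x y; rewrite /restr_scale; exact: scalerDr. Qed.
Lemma restr_scaleDl m : {morph restr_scale^~ m : a b / a + b}.
Proof. by move=> a b; rewrite /restr_scale rmorphD scalerDl. Qed.
HB.instance Definition _ := GRing.Zmodule_isLmodule.Build A T
  restr_scaleA restr_scale1 restr_scaleDr restr_scaleDl.

Definition restr_dg : dgGroup T := dgm M.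

Lemma restr_degZ i j (a : A) (m : T) :
  deg (cdg A) i a -> deg restr_dg j m -> deg restr_dg (i + j) (a *: m).
Proof. by move=> da; exact: dgm_degZ (deg_phi phi da). Qed.

Lemma restr_leibniz i (a : A) (m : T) : deg (cdg A) i a ->
  diff restr_dg (a *: m) = diff (cdg A) a *: m + (a *: diff restr_dg m) *~ sg i.
Proof.
move=> da; rewrite /GRing.scale /= /restr_scale cdgh_diff.
exact: dgm_leibniz (deg_phi phi da).
Qed.

Definition restr : dgMod A := @DGMod A T restr_dg restr_degZ restr_leibniz.

End Object.

Section Hom.
Variables (M N : dgMod B) (f : dgHom M N).

Let F (m : restr M) : restr N := f m.

Lemma restrHom_linear : linear F.
Proof. by move=> a x y; exact: (dgh_linear f (phi a) x y). Qed.

Definition restrHom : dgHom (restr M) (restr N) :=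
  @DGHom A (restr M) (restr N) F restrHom_linear (dgh_gr f) (dgh_diff f).

End Hom.

Lemma restr_acyclic (M : dgMod B) : acyclic (restr M) <-> acyclic M.
Proof. by rewrite !acyclicP. Qed.

Lemma restr_qis (M N : dgMod B) (f : dgHom M N) : qis (restrHom f) <-> qis f.
Proof. by rewrite !qisP. Qed.

Section TensorRestr.
Variables (M : dgMod B) (P : dgMod A).

Let b (m : restr M) (p : P) : restr (tensorMod phi M P) := tens phi (m : M) p.

Lemma trestr_dgbal : dgbal (cdgId A) b.
Proof.
split.
- split=> [p x y|m x y|i j a m p da dm].
  + exact: tensBl'.
  + exact: (tensBr phi (m : M)).
  exact: (esym (tensZ phi p da (dm : deg (dgm M) j m))).
- by move=> a m p; exact: (esym (scale_tens phi (phi a) (m : M) p)).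
- by move=> i j m p; exact: (@deg_tens _ _ phi M).
move=> i j m p dm dp; have := @df_tens _ _ phi M P m p.
by rewrite (twE (dm : deg (dgm M) i m)) tensMzl.
Qed.

(** A tensor product over [phi] becomes one over A after restriction. K-flatness is tested on
    A-modules only, and this is how it applies to base change. *)
Definition trestr : dgHom (tensorMod (cdgId A) (restr M) P) (restr (tensorMod phi M P)) :=
  tens_hom trestr_dgbal.

Lemma trestrE m p : trestr (tens (cdgId A) (m : restr M) p) = tens phi (m : M) p.
Proof. exact: tens_homE. Qed.

Let c (m : M) (p : P) : tensorMod (cdgId A) (restr M) P :=
  tens (cdgId A) (m : restr M) p.

Lemma trestr_inv_balanced : balanced phi c.
Proof.
split=> [p x y|m x y|i j a m p da dm].
- exact: (tensBl' (cdgId A) (x : restr M)).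
- exact: (tensBr (cdgId A) (m : restr M)).
exact: (esym (tensZ (cdgId A) p da (dm : deg (dgm (restr M)) j m))).
Qed.

Lemma trestr_bij : bijective trestr.
Proof.
have cB := tens_liftB trestr_inv_balanced; have cE := tens_lift_tens trestr_inv_balanced.
exists (tens_lift c) => x; move: x.
  apply: (@tensor_ext _ _ (cdgId A) (restr M) P _ (tens_lift c \o trestr) id) => //.
    by move=> x y; rewrite /comp raddfB; exact: cB.
  by move=> i j m p _ _; rewrite /comp trestrE cE.
apply: (@tensor_ext _ _ phi M P _ (trestr \o tens_lift c) id) => //.
  by move=> x y; rewrite /comp cB raddfB.
by move=> i j m p _ _; rewrite /comp cE /c trestrE.
Qed.

End TensorRestr.

Lemma trestr_nat (M N : dgMod B) (P Q : dgMod A) (f : dgHom M N) (g : dgHom P Q) x :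
  restrHom (tmap phi f g) (trestr M P x) =
  trestr N Q (tmap (cdgId A) (restrHom f) g x).
Proof.
move: x; apply: (@tens_hom_ext _ _ (cdgId A) (restr M) P _
  (dgComp (trestr M P) (restrHom (tmap phi f g)))
  (dgComp (tmap (cdgId A) (restrHom f) g) (trestr N Q))) => m p.
by rewrite !dgCompE trestrE tmapE trestrE; exact: tmapE.
Qed.

End Restriction.

Section Fiber.
Variables (A : cdgRing) (M N : dgMod A) (f : dgHom M N).

(** The mapping cone shifted by -1: M together with N raised by one degree. A separate name for the
    product keeps its untwisted module structure from being inferred. *)
Definition fib_type of dgHom M N : Type := (N * M)%type.
Local Notation T := (fib_type f).
HB.instance Definition _ := GRing.Zmodule.on T.

(* the scalars act on the shifted factor N through the sign twist *)
Definition fib_scale (a : A) (x : T) : T := (tw (cdg A) a *: x.1, a *: x.2).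

Lemma fib_scaleA a b x : fib_scale a (fib_scale b x) = fib_scale (a * b) x.
Proof. by rewrite /fib_scale !scalerA twM. Qed.
Lemma fib_scale1 : left_id 1 fib_scale.
Proof. by case=> n m; rewrite /fib_scale tw1 !scale1r. Qed.
Lemma fib_scaleDr : right_distributive fib_scale +%R.
Proof. by move=> a x y; rewrite /fib_scale !scalerDr. Qed.
Lemma fib_scaleDl x : {morph fib_scale^~ x : a b / a + b}.
Proof. by move=> a b; rewrite /fib_scale raddfD !scalerDl. Qed.
HB.instance Definition _ := GRing.Zmodule_isLmodule.Build A T
  fib_scaleA fib_scale1 fib_scaleDr fib_scaleDl.

Definition fib_gr (i : int) (x : T) : T := (gr (dgm N) (i - 1) x.1, gr (dgm M) i x.2).
Definition fib_diff (x : T) : T := (f x.2 - df N x.1, df M x.2).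

Lemma fib_grB i : zmod_morphism (fib_gr i).
Proof. by move=> x y; rewrite /fib_gr !raddfB. Qed.

Lemma fib_gr_gr i j x : fib_gr i (fib_gr j x) = if i == j then fib_gr j x else 0.
Proof.
rewrite /fib_gr !gr_gr; have -> : (i - 1 == j - 1) = (i == j) by apply/eqP/eqP; lia.
by case: ifP.
Qed.

Lemma fib_gr_fin x : exists2 s : seq int, uniq s & x = \sum_(i <- s) fib_gr i x.
Proof.
pose s := undup ([seq i + 1 | i <- supp (dgm N) x.1] ++ supp (dgm M) x.2).
exists s; first exact: undup_uniq.
have us : uniq [seq i - 1 | i <- s] by rewrite map_inj_uniq ?undup_uniq // => i j; lia.
apply: injective_projections.
  rewrite (@zmorS T N fst) // -(big_map (fun i => i - 1) xpredT (gr (dgm N) ^~ x.1)) /=.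
  apply: gr_sum => // i is_; apply: supp_out; apply: contra is_ => ix.
  apply/mapP; exists (i + 1); last by lia.
  by rewrite mem_undup mem_cat; apply/orP; left; apply/mapP; exists i.
rewrite (@zmorS T M snd) //=.
apply: gr_sum => [|i is_]; first exact: undup_uniq.
by apply: supp_out; apply: contra is_ => ix; rewrite mem_undup mem_cat ix orbT.
Qed.

Lemma fib_diffB : zmod_morphism fib_diff.
Proof.
move=> x y; apply: injective_projections; rewrite /fib_diff /= !raddfB //=.
by rewrite addrACA.
Qed.

Lemma fib_diff_gr i x : fib_diff (fib_gr i x) = fib_gr (i + 1) (fib_diff x).
Proof.
by rewrite /fib_diff /fib_gr /= !diff_gr dgh_gr subrK addrK raddfB.
Qed.

Lemma fib_diff_diff x : fib_diff (fib_diff x) = 0.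
Proof.
by rewrite /fib_diff /= raddfB /= !diff_diff subr0 dgh_diff subrr.
Qed.

Definition fib_dg : dgGroup T := DGGroup fib_grB fib_gr_gr fib_gr_fin
  fib_diffB fib_diff_gr fib_diff_diff.

Lemma fib_degP i (x : T) : deg fib_dg i x <-> deg (dgm N) (i - 1) x.1 /\ deg (dgm M) i x.2.
Proof.
case: x => n m; rewrite /deg /= /fib_gr /=.
by split=> [[-> ->]|[-> ->]].
Qed.

Lemma fib_degZ i j (a : A) (x : T) :
  deg (cdg A) i a -> deg fib_dg j x -> deg fib_dg (i + j) (a *: x).
Proof.
move=> da /fib_degP[d1 d2]; apply/fib_degP; split => /=; last exact: dgm_degZ.
by rewrite -addrA; apply: dgm_degZ => //; exact: deg_tw.
Qed.

Lemma fib_leibniz i (a : A) (x : T) : deg (cdg A) i a ->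
  diff fib_dg (a *: x) = diff (cdg A) a *: x + (a *: diff fib_dg x) *~ sg i.
Proof.
move=> da; rewrite [(a *: _) *~ _]scalerMzl -(twE da).
apply: injective_projections; last exact: leibniz.
rewrite /= /fib_diff /= linearZ leibniz tw_tw diff_tw scaleNr scalerBr.
by rewrite opprD opprK addrCA.
Qed.

Definition fib : dgMod A := @DGMod A T fib_dg fib_degZ fib_leibniz.

(** The stretch H^{i-1}(M) -> H^{i-1}(N) -> H^i(fib) -> H^i(M) -> H^i(N) of the long exact
    sequence. *)
Lemma fib_exact_at i : exact_at i fib <-> inj_at i f /\ surj_at (i - 1) f.
Proof.
split=> [ex|[fi fs] [y z] /fib_degP[/= dy dz] [/eqP]].
  split=> [z dz zz y e|w dw zw].
    have [y' dy' e'] := deg_cobound (dgh_deg f dz) e.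
    have [||[u v]] := ex (y', z); first exact/fib_degP.
      by rewrite /= /fib_diff /= e' zz subrr.
    by case=> _ ->; exists v.
  have [||[u v]] := ex (w, 0); first by apply/fib_degP; split=> //; exact: deg0.
    by rewrite /= /fib_diff /= !raddf0 zw subr0.
  case=> e /esym zv.
  exists (gr (dgm M) (i - 1) v), (- gr (dgm N) (i - 1 - 1) u); split.
  - exact: gr_deg.
  - by rewrite diff_gr' -[i in LHS](subrK 1) zv raddf0.
  - by rewrite dgh_gr raddfN /= diff_gr' -raddfB /= -e dw.
rewrite subr_eq0 => /eqP e zz.
have [x ex] := fi z dz zz y e; have [x' dx' e'] := deg_cobound dz ex.
have [||v [u [dv zv e2]]] := fs (y - f x').
- by apply: degD => //; apply: degN; exact: dgh_deg.
- by rewrite raddfB /= -dgh_diff -e' e subrr.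
exists (- u, x' + v); rewrite /= /fib_diff /= !raddfD /= raddfN opprK zv addr0 -e'.
by rewrite -addrA -e2 addrC subrK.
Qed.

Lemma fib_acyclic : acyclic fib <-> qis f.
Proof.
rewrite acyclicP qisP; split=> h i; last first.
  by apply/fib_exact_at; split; [case: (h i) | case: (h (i - 1))].
split; first by case/fib_exact_at: (h i).
by have /fib_exact_at[_] := h (i + 1); rewrite addrK.
Qed.

End Fiber.

Section TensorFiber.
Variables (A B : cdgRing) (phi : cdgHom A B) (M N : dgMod B) (P : dgMod A).
Variable f : dgHom M N.
Local Notation Ff := (fib f).
Local Notation FT := (fib (tmap phi f (dgId P))).

Let b (x : Ff) (p : P) : FT := (tens phi (x.1 : N) p, tens phi (x.2 : M) p).

Lemma tfib_dgbal : dgbal phi b.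
Proof.
split.
- split=> [p x y|x p q|i j a x p da /fib_degP[d1 d2]].
  + by rewrite /b /= !tensBl'.
  + by rewrite /b !raddfB.
  rewrite /b (tensZ phi p da d1) (tensZ phi p da d2).
  rewrite [LHS](_ : _ = (tens phi (tw (cdg B) (phi a) *: x.1) p *~ sg (i * j),
    tens phi (phi a *: x.2) p *~ sg (i * j))); last first.
    apply: injective_projections.
    + exact: (@zmorMz FT (tensorMod phi N P) fst).
    + exact: (@zmorMz FT (tensorMod phi M P) snd).
  congr pair; rewrite (twE (deg_phi phi da)) -scalerMzl tensMzl -mulrzA -sgD.
  by congr (_ *~ _); apply: (@sg_eq i); ring.
- by move=> c x p; rewrite /b /GRing.scale /= /fib_scale /= -!(scale_tens phi).
- move=> i j x p /fib_degP[d1 d2] dp; apply/fib_degP; split; last exact: deg_tens.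
  by rewrite addrAC; exact: deg_tens.
move=> i j x p /fib_degP[d1 d2] dp.
rewrite [X in _ = _ + X](_ : _ = (tens phi (x.1 : N) (df P p) *~ sg i,
    tens phi (x.2 : M) (df P p) *~ sg i)); last first.
  apply: injective_projections.
  + exact: (@zmorMz FT (tensorMod phi N P) fst).
  + exact: (@zmorMz FT (tensorMod phi M P) snd).
transitivity ((tmap phi f (dgId P) (tens phi (x.2 : M) p)
    - df (tensorMod phi N P) (tens phi (x.1 : N) p),
  df (tensorMod phi M P) (tens phi (x.2 : M) p)) : FT); first by [].
rewrite tmapE !df_tens (twE d1) (twE d2) !tensMzl.
apply: injective_projections; last by [].
rewrite [LHS]/= [RHS]/= tensBl' sgD mulrN1 mulrNz.
by rewrite opprD opprK addrA.
Qed.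

Definition tfib : dgHom (tensorMod phi Ff P) FT := tens_hom tfib_dgbal.

Lemma tfibE x p : tfib (tens phi (x : Ff) p) = (tens phi (x.1 : N) p, tens phi (x.2 : M) p).
Proof. exact: tens_homE. Qed.

Let c1 (n : N) (p : P) : tensorMod phi Ff P := tens phi ((n, 0) : Ff) p.
Let c2 (m : M) (p : P) : tensorMod phi Ff P := tens phi ((0, m) : Ff) p.

Lemma tfib_inv1_balanced : balanced phi c1.
Proof.
split=> [p x y|n x y|i j a n p da dn]; rewrite /c1.
- rewrite -tensBl'; congr (tens phi _ p).
  by apply: injective_projections; rewrite //= subrr.
- exact: raddfB.
have d1 : deg (dgm Ff) (j + 1) ((n, 0) : Ff).
  by apply/fib_degP; rewrite addrK; split=> //; exact: deg0.
rewrite (tensZ phi p da d1).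
have -> : phi a *: ((n, 0) : Ff) = ((phi a *: n, 0) : Ff) *~ sg i.
  apply: injective_projections => /=.
    by rewrite (@zmorMz Ff N fst) //= (twE (deg_phi phi da)) scalerMzl.
  by rewrite (@zmorMz Ff M snd) //= scaler0 mul0rz.
rewrite tensMzl -mulrzA -sgD; congr (_ *~ _); apply: (@sg_eq (- i)); ring.
Qed.

Lemma tfib_inv2_balanced : balanced phi c2.
Proof.
split=> [p x y|n x y|i j a m p da dm]; rewrite /c2.
- rewrite -tensBl'; congr (tens phi _ p).
  by apply: injective_projections; rewrite //= subrr.
- exact: raddfB.
have d2 : deg (dgm Ff) j ((0, m) : Ff) by apply/fib_degP; split=> //; exact: deg0.
rewrite (tensZ phi p da d2); congr (tens phi _ _ *~ _).
by apply: injective_projections => //=; rewrite scaler0.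
Qed.

(** Tensoring commutes with fibers, so preserving acyclic modules amounts to preserving
    quasi-isomorphisms. *)
Lemma tfib_bij : bijective tfib.
Proof.
pose g1 : tensor phi N P -> _ := tens_lift c1.
pose g2 : tensor phi M P -> _ := tens_lift c2.
have B1 : zmod_morphism g1 := tens_liftB tfib_inv1_balanced.
have B2 : zmod_morphism g2 := tens_liftB tfib_inv2_balanced.
have E1 : forall n p, g1 (tens phi n p) = c1 n p := tens_lift_tens tfib_inv1_balanced.
have E2 : forall n p, g2 (tens phi n p) = c2 n p := tens_lift_tens tfib_inv2_balanced.
exists (fun x : FT => g1 x.1 + g2 x.2).
  move=> x; move: x; apply: (@tensor_ext _ _ phi Ff P _
    (fun x => g1 (tfib x).1 + g2 (tfib x).2) id) => //.
    move=> x y; rewrite (raddfB tfib) [(_ - _).1]/= [(_ - _).2]/=.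
    by rewrite B1 B2 opprD addrACA.
  move=> i j x p _ _; rewrite tfibE [(_, _).1]/= [(_, _).2]/= E1 E2 -tensDl.
  by congr (tens _ _ _); apply: injective_projections; rewrite /= ?addr0 ?add0r.
case=> s t; rewrite [(_, _).1]/= [(_, _).2]/= (zmorD (dgh_zmod tfib)).
have -> : tfib (g1 s) = (s, 0).
  move: s; apply: (@tensor_ext _ _ phi N P _ (tfib \o g1) (fun s => (s, 0) : FT)).
  - by move=> x y; rewrite /comp B1 raddfB.
  - by move=> x y; congr pair; rewrite subrr.
  by move=> i j n p _ _; rewrite /comp E1 tfibE [(_, _).1]/= [(_, _).2]/= tens0l.
have -> : tfib (g2 t) = (0, t).
  move: t; apply: (@tensor_ext _ _ phi M P _ (tfib \o g2) (fun t => (0, t) : FT)).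
  - by move=> x y; rewrite /comp B2 raddfB.
  - by move=> x y; congr pair; rewrite subrr.
  by move=> i j n p _ _; rewrite /comp E2 tfibE [(_, _).1]/= [(_, _).2]/= tens0l.
by apply: injective_projections; rewrite /= ?addr0 ?add0r.
Qed.

End TensorFiber.

(** * Tensoring with K-flat modules *)

Section Kflat.
Variables (A B : cdgRing) (phi : cdgHom A B).

Lemma Kflat_acyclic (P : dgMod A) (M : dgMod B) : Kflat P -> acyclic M ->
  acyclic (tensorMod phi M P).
Proof.
move=> kP aM; apply/(restr_acyclic phi)/(qis_acyclic (qis_bij (trestr_bij phi M P))).
by apply: kP; apply/restr_acyclic.
Qed.

Lemma Kflat_qis (P : dgMod A) (M N : dgMod B) (f : dgHom M N) : Kflat P -> qis f ->
  qis (tmap phi f (dgId P)).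
Proof.
move=> kP /fib_acyclic aF; apply/fib_acyclic.
by apply/(qis_acyclic (qis_bij (tfib_bij phi P f))); exact: Kflat_acyclic.
Qed.

End Kflat.

(** * Semifree modules *)

Section FiniteSupport.
Variables (X : choiceType) (A : pzRingType).

Definition fin_supp : {pred X -> A} :=
  fun f => `[< exists s : seq X, forall x, x \notin s -> f x = 0 >].

Lemma fin_supp_closed : zmod_closed fin_supp.
Proof.
split=> [|f g /asboolP[s fs] /asboolP[t gt]]; apply/asboolP; first by exists [::].
exists (s ++ t) => x; rewrite mem_cat negb_or => /andP[xs xt].
by change (f x - g x = 0); rewrite fs // gt // subrr.
Qed.
HB.instance Definition _ := GRing.isZmodClosed.Build (X -> A) fin_supp fin_supp_closed.

Record fsf := Fsf { fsf_fun :> X -> A; fsf_fin : fsf_fun \in fin_supp }.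
HB.instance Definition _ := [isSub for fsf_fun].
HB.instance Definition _ := [Choice of fsf by <:].
HB.instance Definition _ := [SubChoice_isSubZmodule of fsf by <:].

Lemma fsfP (f g : fsf) : f =1 g -> f = g.
Proof. by move=> /funext e; apply: val_inj. Qed.

Lemma fsf_scale_fin a (f : fsf) : (fun x => a * f x) \in fin_supp.
Proof.
have /asboolP[s fs] := fsf_fin f; apply/asboolP; exists s => x /fs ->.
by rewrite mulr0.
Qed.

Definition fsf_scale a f := Fsf (fsf_scale_fin a f).

Lemma fsf_scaleA a b f : fsf_scale a (fsf_scale b f) = fsf_scale (a * b) f.
Proof. by apply: fsfP => x /=; rewrite mulrA. Qed.
Lemma fsf_scale1 : left_id 1 fsf_scale.
Proof. by move=> f; apply: fsfP => x /=; rewrite mul1r. Qed.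
Lemma fsf_scaleDr : right_distributive fsf_scale +%R.
Proof. by move=> a f g; apply: fsfP => x; exact: mulrDr. Qed.
Lemma fsf_scaleDl f : {morph fsf_scale^~ f : a b / a + b}.
Proof. by move=> a b; apply: fsfP => x; exact: mulrDl. Qed.
HB.instance Definition _ := GRing.Zmodule_isLmodule.Build A fsf
  fsf_scaleA fsf_scale1 fsf_scaleDr fsf_scaleDl.

Lemma fsfB (f g : fsf) x : (f - g) x = f x - g x. Proof. by []. Qed.
Lemma fsfD (f g : fsf) x : (f + g) x = f x + g x. Proof. by []. Qed.
Lemma fsfZ a (f : fsf) x : (a *: f) x = a * f x. Proof. by []. Qed.
Lemma fsf0 x : (0 : fsf) x = 0. Proof. by []. Qed.
Lemma fsf_evalB x : zmod_morphism (fun f : fsf => f x). Proof. by []. Qed.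
Lemma fsf_sum (I : Type) (s : seq I) (F : I -> fsf) x :
  (\sum_(i <- s) F i) x = \sum_(i <- s) F i x.
Proof. exact: (zmorS (fsf_evalB x)). Qed.
Definition fsupp (f : fsf) : seq X := undup (projT1 (cid (asboolP _ (fsf_fin f)))).

Lemma fsupp_uniq f : uniq (fsupp f). Proof. exact: undup_uniq. Qed.

Lemma fsupp_out f x : x \notin fsupp f -> f x = 0.
Proof. by rewrite /fsupp mem_undup; case: cid => s /= h /h. Qed.

Lemma sing_fin x a : (fun y : X => if y == x then a else 0 : A) \in fin_supp.
Proof. by apply/asboolP; exists [:: x] => y; rewrite inE => /negPf ->. Qed.

Definition sing x a : fsf := Fsf (sing_fin x a).

Lemma singE x a y : sing x a y = if y == x then a else 0. Proof. by []. Qed.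

Lemma singB x : zmod_morphism (sing x).
Proof. by move=> a b; apply: fsfP => y; rewrite fsfB !singE; case: ifP; rewrite ?subrr. Qed.
HB.instance Definition _ x := GRing.isZmodMorphism.Build A fsf (sing x) (singB x).

Lemma singZ b x a : b *: sing x a = sing x (b * a).
Proof. by apply: fsfP => y; rewrite fsfZ !singE; case: ifP; rewrite ?mulr0. Qed.

Lemma fsf_sing (f : fsf) : f = \sum_(x <- fsupp f) sing x (f x).
Proof.
apply: fsfP => y; rewrite fsf_sum; have [ys|ys] := boolP (y \in fsupp f).
  rewrite (bigD1_seq y) ?fsupp_uniq //= eqxx big1 ?addr0 // => x xy.
  by rewrite eq_sym (negPf xy).
rewrite (fsupp_out ys) big_seq big1 // => x xs; rewrite singE.
by case: eqP => // yx; rewrite yx xs in ys.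
Qed.

Lemma fsf_ind (P : fsf -> Prop) : P 0 -> (forall f g, P f -> P g -> P (f + g)) ->
  (forall x a, P (sing x a)) -> forall f, P f.
Proof. by move=> P0 PD Ps f; rewrite (fsf_sing f); elim/big_ind: _. Qed.

Lemma fsf_ext (G : zmodType) (u v : fsf -> G) : zmod_morphism u -> zmod_morphism v ->
  (forall x a, u (sing x a) = v (sing x a)) -> u =1 v.
Proof.
move=> uB vB e f; move: f; apply: fsf_ind => [|f g ef eg|//].
  by rewrite (zmor0 uB) (zmor0 vB).
by rewrite (zmorD uB) (zmorD vB) ef eg.
Qed.

Section Extension.
Variables (G : zmodType) (F : X -> A -> G).
Hypothesis FB : forall x, zmod_morphism (F x).

(** [F] is additive, not linear, in the coefficient: this covers maps that are linear up to a sign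
    twist, such as differentials and homotopies. *)
Definition fext (f : fsf) : G := \sum_(x <- fsupp f) F x (f x).

Lemma fextE (s : seq X) (f : fsf) : uniq s -> (forall x, x \notin s -> f x = 0) ->
  fext f = \sum_(x <- s) F x (f x).
Proof.
move=> us fs; pose t := undup (s ++ fsupp f).
have ut : uniq t by exact: undup_uniq.
suff h (r : seq X) : uniq r -> {subset r <= t} -> (forall x, x \notin r -> f x = 0) ->
    \sum_(x <- t) F x (f x) = \sum_(x <- r) F x (f x).
  rewrite /fext -!h //; first by move=> x xs; rewrite mem_undup mem_cat xs.
  - exact: fsupp_uniq.
  - by move=> x xs; rewrite mem_undup mem_cat xs orbT.
  - by move=> x; exact: fsupp_out.
move=> ur rt fr; rewrite (bigID (mem r)) /= [X in _ + X]big1 => [|x xr]; last first.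
  by rewrite fr // (zmor0 (FB x)).
rewrite addr0 -big_filter; apply: perm_big; apply: uniq_perm => //.
  exact: filter_uniq.
by move=> x; rewrite mem_filter /=; case: (boolP (x \in r)) => //= /rt.
Qed.

Lemma fextB : zmod_morphism fext.
Proof.
move=> f g; pose t := undup (fsupp f ++ fsupp g).
have tf x : x \notin t -> f x = 0.
  by rewrite mem_undup mem_cat negb_or => /andP[/fsupp_out].
have tg x : x \notin t -> g x = 0.
  by rewrite mem_undup mem_cat negb_or => /andP[_ /fsupp_out].
rewrite !(@fextE t) ?undup_uniq // => [|x xt]; last by rewrite fsfB tf // tg // subrr.
by rewrite -sumrB; apply: eq_bigr => x _; rewrite fsfB FB.
Qed.

Lemma fext_sing x a : fext (sing x a) = F x a.
Proof.
rewrite (@fextE [:: x]) // => [|y]; first by rewrite big_seq1 singE eqxx.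
by rewrite inE singE => /negPf ->.
Qed.

End Extension.

Lemma fext_supp (G : zmodType) (F F' : X -> A -> G) (f : fsf) :
  (forall x, f x != 0 -> F x (f x) = F' x (f x)) ->
  (forall x, F x 0 = 0) -> (forall x, F' x 0 = 0) -> fext F f = fext F' f.
Proof.
move=> e F0 F0'; apply: eq_bigr => x _; case: (eqVneq (f x) 0) => [->|/e //].
by rewrite F0 F0'.
Qed.

End FiniteSupport.

Section GradedFree.
Variables (A : cdgRing) (X : choiceType) (dg : X -> int).
Local Notation F := (fsf X A).

Definition fgr (i : int) : F -> F := fext (fun x a => sing x (gr (cdg A) (i - dg x) a)).

Let fgr0B i x : zmod_morphism (fun a : A => sing x (gr (cdg A) (i - dg x) a)).
Proof. by move=> a b; rewrite !raddfB. Qed.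

Lemma fgrB i : zmod_morphism (fgr i). Proof. exact: fextB. Qed.

Lemma fgr_sing i x a : fgr i (sing x a) = sing x (gr (cdg A) (i - dg x) a).
Proof. exact: fext_sing. Qed.

Lemma fgrE i f x : fgr i f x = gr (cdg A) (i - dg x) (f x).
Proof.
move: f; apply: (@fsf_ext X A A (fun f => fgr i f x)
  (fun f => gr (cdg A) (i - dg x) (f x))) => [f g|f g|y a].
- by rewrite fgrB.
- by rewrite fsfB raddfB.
by rewrite fgr_sing !singE; case: eqP => [->|_]; rewrite ?raddf0.
Qed.

Lemma fgr_gr i j f : fgr i (fgr j f) = if i == j then fgr j f else 0.
Proof.
apply: fsfP => x; rewrite !fgrE gr_gr (inj_eq (addIr _)).
by case: ifP => _; rewrite ?fgrE.
Qed.

Lemma fgr_fin f : exists2 s : seq int, uniq s & f = \sum_(i <- s) fgr i f.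
Proof.
suff [s fs] : exists s : seq int, forall t, uniq t -> {subset s <= t} ->
    f = \sum_(i <- t) fgr i f.
  exists (undup s); first exact: undup_uniq.
  by apply: fs; [exact: undup_uniq | move=> i; rewrite mem_undup].
move: f; apply: fsf_ind => [|x y [s xs] [t yt]|x a].
- by exists [::] => t _ _; rewrite big1 // => i _; rewrite (zmor0 (fgrB i)).
- exists (s ++ t) => u uu su; under eq_bigr do rewrite (zmorD (fgrB _)).
  rewrite big_split /= -xs // -?yt // => i ii; apply: su;
    by rewrite mem_cat ii ?orbT.
exists [seq i + dg x | i <- supp (cdg A) a] => t ut st.
under eq_bigr do rewrite fgr_sing.
rewrite -(zmorS (singB x)); congr (sing _ _).
rewrite -(big_map (fun i => i - dg x) xpredT (fun i => gr (cdg A) i a)).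
apply: gr_sum => [|i it]; first by rewrite map_inj_uniq // => i j; lia.
apply: supp_out; apply: contra it => ia; apply/mapP; exists (i + dg x); last by lia.
by apply: st; apply/mapP; exists i.
Qed.

Definition fdeg i (f : F) := fgr i f = f.

Lemma fdegP i f : fdeg i f <-> forall x, deg (cdg A) (i - dg x) (f x).
Proof.
split=> [hf x|hf]; first by rewrite /deg -fgrE hf.
by apply: fsfP => x; rewrite fgrE hf.
Qed.

Lemma fdeg_sing i x a : deg (cdg A) i a -> fdeg (i + dg x) (sing x a).
Proof. by move=> da; rewrite /fdeg fgr_sing addrK da. Qed.

Section Differential.
Variable D : X -> F.
Hypothesis degD : forall x, fdeg (dg x + 1) (D x).

Definition fdiff : F -> F :=
  fext (fun x a => sing x (diff (cdg A) a) + tw (cdg A) a *: D x).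

Let fdiff0B x :
  zmod_morphism (fun a : A => sing x (diff (cdg A) a) + tw (cdg A) a *: D x).
Proof. by move=> a b; rewrite !raddfB /= scalerBl opprD addrACA. Qed.

Lemma fdiffB : zmod_morphism fdiff. Proof. exact: fextB. Qed.

Lemma fdiff_sing x a : fdiff (sing x a) = sing x (diff (cdg A) a) + tw (cdg A) a *: D x.
Proof. exact: fext_sing. Qed.

Lemma fdiff_e x : fdiff (sing x 1) = D x.
Proof. by rewrite fdiff_sing diff1 raddf0 add0r tw1 scale1r. Qed.

Lemma fdiffE f y : fdiff f y = diff (cdg A) (f y) + \sum_(x <- fsupp f) tw (cdg A) (f x) * D x y.
Proof.
have e : fdiff f = \sum_(x <- fsupp f) sing x (diff (cdg A) (f x))
    + \sum_(x <- fsupp f) tw (cdg A) (f x) *: D x.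
  by rewrite -big_split.
rewrite e fsfD !fsf_sum; congr (_ + _).
rewrite [in RHS](fsf_sing f) fsf_sum raddf_sum /=; apply: eq_bigr => x _.
by rewrite /=; case: ifP; rewrite ?raddf0.
Qed.

Lemma fdiffZ a f : fdiff (a *: f) = diff (cdg A) a *: f + tw (cdg A) a *: fdiff f.
Proof.
move: f; apply: (@fsf_ext X A _ (fun f => fdiff (a *: f))
  (fun f => diff (cdg A) a *: f + tw (cdg A) a *: fdiff f)) => [f g|f g|x b].
- by rewrite scalerBr fdiffB.
- by rewrite fdiffB !scalerBr opprD addrACA.
rewrite singZ !fdiff_sing leibnizM raddfD /= scalerDr !singZ twM scalerA.
by rewrite addrA.
Qed.

Lemma fdiff_gr i f : fdiff (fgr i f) = fgr (i + 1) (fdiff f).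
Proof.
move: f; apply: (@fsf_ext X A _ (fdiff \o fgr i) (fgr (i + 1) \o fdiff)) => [f g|f g|x a].
- by rewrite /= fgrB fdiffB.
- by rewrite /= fdiffB fgrB.
move: a; apply: (@hom_ext _ (cdg A) _ (fun a => fdiff (fgr i (sing x a)))
  (fun a => fgr (i + 1) (fdiff (sing x a)))) => [a b|a b|j a da].
- by rewrite singB fgrB fdiffB.
- by rewrite singB fdiffB fgrB.
have dd : fdeg (j + dg x + 1) (fdiff (sing x a)).
  rewrite fdiff_sing /fdeg (zmorD (fgrB _)); congr (_ + _).
    by rewrite addrAC; exact: fdeg_sing (deg_diff da).
  apply/fdegP => y; rewrite fsfZ.
  have -> : j + dg x + 1 - dg y = j + (dg x + 1 - dg y) by lia.
  by apply: cdg_degM (deg_tw da) _; move: (degD x) => /fdegP; apply.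
have gE k f : fdeg k f -> forall l, fgr l f = if l == k then f else 0.
  by move=> <- l; rewrite fgr_gr.
rewrite (gE _ _ dd) (gE _ _ (fdeg_sing x da)) (inj_eq (addIr _)).
by case: ifP => // _; rewrite (zmor0 fdiffB).
Qed.

(** The cross terms cancel because d anticommutes with the twist, so the square is linear even where
    it is nonzero. The curvature used for lifting rests on this. *)
Lemma fdiff_sqZ a f : fdiff (fdiff (a *: f)) = a *: fdiff (fdiff f).
Proof.
rewrite fdiffZ (zmorD fdiffB) !fdiffZ diff_diff scale0r add0r tw_tw addrA.
by rewrite diff_tw scaleNr addrN add0r.
Qed.

Lemma fdiff_sq : (forall x, fdiff (D x) = 0) -> forall f, fdiff (fdiff f) = 0.
Proof.
move=> DD; apply: (@fsf_ext X A _ (fdiff \o fdiff) (fun=> 0)) => [f g|f g|x a].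
- by rewrite /= !fdiffB.
- by rewrite subrr.
by rewrite /= -[a]mulr1 -singZ fdiff_sqZ fdiff_e DD scaler0.
Qed.

End Differential.

End GradedFree.

Record sfData (A : cdgRing) := SfData {
  sfX : choiceType;
  sfdg : sfX -> int;
  sfD : sfX -> fsf sfX A;
  sf_deg : forall x, fdeg sfdg (sfdg x + 1) (sfD x);
  sf_sq : forall x, fdiff sfD (sfD x) = 0 }.

Section Semifree.
Variables (A : cdgRing) (S : sfData A).
Local Notation X := (sfX S).
Local Notation F := (fsf X A).
Local Notation dg := (@sfdg _ S).
Local Notation D := (@sfD _ S).

Definition sf_dg : dgGroup F := DGGroup (fgrB dg) (fgr_gr dg) (fgr_fin dg)
  (fdiffB D) (fdiff_gr (@sf_deg _ S)) (fdiff_sq (@sf_sq _ S)).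

Lemma sf_degZ i j (a : A) (f : F) :
  deg (cdg A) i a -> deg sf_dg j f -> deg sf_dg (i + j) (a *: f).
Proof.
move=> da /fdegP hf; apply/fdegP => x; rewrite -addrA.
exact: cdg_degM da (hf x).
Qed.

Lemma sf_leibniz i (a : A) (f : F) : deg (cdg A) i a ->
  diff sf_dg (a *: f) = diff (cdg A) a *: f + (a *: diff sf_dg f) *~ sg i.
Proof. by move=> da; rewrite /= fdiffZ (twE da) scalerMzl. Qed.

Definition sfMod : dgMod A := @DGMod A F sf_dg sf_degZ sf_leibniz.

Definition bas (x : X) : sfMod := sing x 1.

Lemma df_bas x : df sfMod (bas x) = D x. Proof. exact: fdiff_e. Qed.

Lemma deg_bas x : deg (dgm sfMod) (dg x) (bas x).
Proof. by have := fdeg_sing dg x (cdg_deg1 A); rewrite add0r. Qed.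

Lemma scale_bas a x : a *: bas x = sing x a.
Proof. by rewrite /bas singZ mulr1. Qed.

Lemma sf_ind (P : sfMod -> Prop) : P 0 -> (forall f g, P f -> P g -> P (f + g)) ->
  (forall x i a, deg (cdg A) i a -> P (a *: bas x)) -> forall f, P f.
Proof.
move=> P0 PD Ps; apply: fsf_ind => // x a; move: a.
apply: (@hom_ind _ (cdg A) (fun a => P (sing x a))).
- by rewrite raddf0.
- by move=> a b Pa Pb; rewrite raddfD; exact: PD.
by move=> i a da; rewrite -scale_bas; exact: Ps da.
Qed.

Lemma sf_ext (G : zmodType) (u v : sfMod -> G) : zmod_morphism u -> zmod_morphism v ->
  (forall x i a, deg (cdg A) i a -> u (a *: bas x) = v (a *: bas x)) -> u =1 v.
Proof.
move=> uB vB e f; move: f; apply: sf_ind => [|f g ef eg|//].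
  by rewrite (zmor0 uB) (zmor0 vB).
by rewrite (zmorD uB) (zmorD vB) ef eg.
Qed.

End Semifree.

Section TwistPower.
Variables (M : zmodType) (D : dgGroup M) (k : int).

(** The sign of moving x past an element of degree k; [tw] is the case k = 1. *)
Definition twn (x : M) : M := gsum D (fun i y => y *~ sg (k * i)) x.

Lemma twnB : zmod_morphism twn.
Proof. by apply: gsum_additive => i x y; exact: mulrzBl. Qed.

Lemma twnE i x : deg D i x -> twn x = x *~ sg (k * i).
Proof. by move=> dx; rewrite /twn (gsum_deg _ dx) // => j y z; exact: mulrzBl. Qed.

Lemma tw_twn x : tw D (twn x) = gsum D (fun i y => y *~ sg ((k + 1) * i)) x.
Proof.
move: x; apply: (@hom_ext _ D) => [x y|x y|i x dx].
- by rewrite twnB raddfB.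
- by apply: gsum_additive => i u v; exact: mulrzBl.
rewrite (twnE dx) raddfMz /= (twE dx) (gsum_deg _ dx) => [|j u v]; last exact: mulrzBl.
by rewrite -mulrzA -sgD mulrDl mul1r addrC.
Qed.

Lemma twn_diff x : diff D (twn x) = twn (diff D x) *~ sg k.
Proof.
move: x; apply: (@hom_ext _ D _ (diff D \o twn) (fun x => twn (diff D x) *~ sg k))
  => [x y|x y|i x dx] /=.
- by rewrite twnB raddfB.
- by rewrite raddfB twnB mulrzBl.
rewrite (twnE dx) (twnE (deg_diff dx)) raddfMz /= -mulrzA -sgD.
by congr (_ *~ _); apply: (@sg_eq (- k)); ring.
Qed.

End TwistPower.

Lemma tw_twn1 (M : zmodType) (D : dgGroup M) k x : tw D (twn D (k - 1) x) = twn D k x.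
Proof. by rewrite tw_twn subrK. Qed.

Lemma twn_tw (M : zmodType) (D : dgGroup M) k x : twn D k (tw D x) = tw D (twn D k x).
Proof.
move: x; apply: (@hom_ext _ D) => [x y|x y|i x dx].
- by rewrite raddfB twnB.
- by rewrite twnB raddfB.
rewrite (twE dx) (zmorMz (twnB _ _)) (twnE k dx) -mulrzA mulrC mulrzA -(twE dx).
by rewrite raddfMz.
Qed.

Lemma twn0 (A : cdgRing) (a : A) : twn (cdg A) 0 a = a.
Proof.
move: a; apply: (@hom_ext _ (cdg A)) => [||i a da] //; first exact: twnB.
by rewrite (twnE 0 da) mul0r.
Qed.

Lemma twn_1 (A : cdgRing) k : twn (cdg A) k (1 : A) = 1.
Proof. by rewrite (twnE k (cdg_deg1 A)) mulr0. Qed.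

Lemma twnM (A : cdgRing) k (a b : A) : twn (cdg A) k (a * b) = twn (cdg A) k a * twn (cdg A) k b.
Proof.
have tB := twnB (cdg A) k.
move: a; apply: (@hom_ext _ (cdg A) _ (fun a => twn (cdg A) k (a * b))
  (fun a => twn (cdg A) k a * twn (cdg A) k b)) => [x y|x y|i a da].
- by rewrite mulrBl tB.
- by rewrite tB mulrBl.
move: b; apply: (@hom_ext _ (cdg A) _ (fun b => twn (cdg A) k (a * b))
  (fun b => twn (cdg A) k a * twn (cdg A) k b)) => [x y|x y|j b db].
- by rewrite mulrBr tB.
- by rewrite tB mulrBr.
rewrite (twnE k (cdg_degM da db)) (twnE k da) (twnE k db).
rewrite mulrzAl mulrzAr -mulrzA -sgD; congr (_ *~ _); apply: (@sg_eq 0); ring.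
Qed.

Section SemifreeTensor.
Variables (A : cdgRing) (S : sfData A) (Y : dgMod A).
Local Notation iA := (cdgId A).
Local Notation F := (sfMod S).
Local Notation T := (tensorMod iA F Y).
Local Notation dg := (@sfdg _ S).

Let kap0 (z : sfX S) (f : F) (y : Y) : Y := twn (cdg A) (dg z) (f z) *: y.

Lemma kap_balanced z : balanced iA (kap0 z).
Proof.
split=> [y f g|f x y|i j a f y da /fdegP hf]; rewrite /kap0.
- by rewrite fsfB twnB scalerBl.
- exact: scalerBr.
have dfz := hf z.
rewrite fsfZ /= (twnE _ (cdg_degM da dfz)) (twnE _ dfz) scalerA mulrzAl.
rewrite (cdg_comm da dfz) -!scalerMzl -!mulrzA -!sgD.
by congr (_ *~ _); apply: (@sg_eq (dg z * i)); ring.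
Qed.

(** The coefficient y in the expansion of a tensor as a sum of e_z (x) y; the twist in [kap0] is the
    sign of moving a scalar past e_z. *)
Definition kap (z : sfX S) (w : T) : Y := tens_lift (kap0 z) w.

Lemma kapB z : zmod_morphism (kap z). Proof. exact: tens_liftB (kap_balanced z). Qed.

Lemma kap_tens z f y : kap z (tens iA f y) = twn (cdg A) (dg z) (f z) *: y.
Proof. exact: tens_lift_tens (kap_balanced z) f y. Qed.

Lemma kap_bas z x y : kap z (tens iA (bas x) y) = if z == x then y else 0.
Proof.
rewrite kap_tens /bas singE; case: ifP => _; first by rewrite twn_1 scale1r.
by rewrite (zmor0 (twnB _ _)) scale0r.
Qed.

Lemma sf_tens_ind (P : T -> Prop) : P 0 -> (forall v w, P v -> P w -> P (v + w)) ->
  (forall x j y, deg (dgm Y) j y -> P (tens iA (bas x) y)) -> forall w, P w.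
Proof.
move=> P0 PD Pb; apply: tensor_ind => // i j f y _ dy; move: f {i}.
apply: sf_ind => [|f g Pf Pg|x i a da]; first by rewrite tens0l.
  by rewrite tensDl; exact: PD.
have e := tensZ iA y da (deg_bas x).
have -> : tens iA (a *: bas x) y = tens iA (bas x) ((a *: y) *~ sg (i * dg x)).
  by rewrite raddfMz /= e mulz_sgsg.
by apply: (Pb _ (i + j)); apply: degMz; exact: dgm_degZ.
Qed.

Lemma sf_tens_ext (G : zmodType) (u v : T -> G) : zmod_morphism u -> zmod_morphism v ->
  (forall x j y, deg (dgm Y) j y -> u (tens iA (bas x) y) = v (tens iA (bas x) y)) ->
  u =1 v.
Proof.
move=> uB vB e w; move: w; apply: sf_tens_ind => [|f g ef eg|//].
  by rewrite (zmor0 uB) (zmor0 vB).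
by rewrite (zmorD uB) (zmorD vB) ef eg.
Qed.

Lemma kap_gr i z w : kap z (gr (dgm T) i w) = gr (dgm Y) (i - dg z) (kap z w).
Proof.
move: w; apply: (@sf_tens_ext _ (fun w => kap z (gr (dgm T) i w))
  (fun w => gr (dgm Y) (i - dg z) (kap z w))) => [v w|v w|x j y dy].
- by rewrite raddfB kapB.
- by rewrite kapB raddfB.
rewrite (gr_tens _ _ (deg_bas x) dy) kap_bas; case: (eqVneq z x) => [->|zx].
  rewrite (deg_gr _ dy) subr_eq addrC.
  by case: ifP => _; rewrite ?kap_bas ?eqxx // (zmor0 (kapB _)).
by rewrite raddf0; case: ifP => _; rewrite ?kap_bas ?(negPf zx) // (zmor0 (kapB _)).
Qed.

Lemma kap_deg i z w : deg (dgm T) i w -> deg (dgm Y) (i - dg z) (kap z w).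
Proof. by move=> dw; rewrite /deg -kap_gr dw. Qed.

Lemma kap_decomp w : exists s, [/\ uniq s, forall x, x \notin s -> kap x w = 0
  & w = \sum_(x <- s) tens iA (bas x) (kap x w)].
Proof.
suff [s [hs he]] : exists s : seq (sfX S), (forall x, x \notin s -> kap x w = 0) /\
    forall t, uniq t -> {subset s <= t} -> w = \sum_(x <- t) tens iA (bas x) (kap x w).
  exists (undup s); split; first exact: undup_uniq.
    by move=> x; rewrite mem_undup; exact: hs.
  by apply: he; [exact: undup_uniq | move=> x; rewrite mem_undup].
move: w; apply: sf_tens_ind => [|v w [s [vs ve]] [t [wt we]]|x j y dy].
- exists [::]; split=> [x _|t _ _]; first exact: (zmor0 (kapB _)).
  by rewrite big1 // => x _; rewrite (zmor0 (kapB _)) raddf0.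
- exists (s ++ t); split=> [x|u uu su].
    by rewrite mem_cat negb_or (zmorD (kapB _)) => /andP[/vs-> /wt->]; rewrite addr0.
  under eq_bigr do rewrite (zmorD (kapB _)) raddfD.
  rewrite big_split /= -ve // -?we // => i ii; apply: su;
    by rewrite mem_cat ii ?orbT.
exists [:: x]; split=> [z|t ut xt]; first by rewrite inE kap_bas => /negPf ->.
rewrite (bigD1_seq x) ?xt ?mem_head //= kap_bas eqxx big1 ?addr0 // => z zx.
by rewrite kap_bas (negPf zx) raddf0.
Qed.

Lemma kap_inj v w : (forall x, kap x v = kap x w) -> v = w.
Proof.
move=> e; apply/eqP; rewrite -subr_eq0; apply/eqP.
have [s [_ _ ->]] := kap_decomp (v - w).
by rewrite big1 // => x _; rewrite kapB e subrr raddf0.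
Qed.

Lemma df_tens_bas x y : df T (tens iA (bas x) y) =
  tens iA (sfD x : F) y + tens iA (bas x) (df Y y) *~ sg (dg x).
Proof. by rewrite df_tens df_bas (twE (deg_bas x)) tensMzl. Qed.

End SemifreeTensor.

(** The exhaustive filtration that makes a free graded module with differential semifree. *)
Definition ranked (A : cdgRing) (S : sfData A) (rank : sfX S -> nat) : Prop :=
  forall x y, sfD x y != 0 -> (rank y < rank x)%N.

Section Filtration.
Variables (A : cdgRing) (S : sfData A) (rank : sfX S -> nat) (Y : dgMod A).
Hypothesis rk : ranked rank.
Local Notation iA := (cdgId A).
Local Notation F := (sfMod S).
Local Notation T := (tensorMod iA F Y).
Local Notation dg := (@sfdg _ S).

Lemma sfD_rank x y : (rank x <= rank y)%N -> sfD x y = 0.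
Proof. by move=> xy; apply/eqP; apply: contraLR xy => /rk; rewrite -ltnNge. Qed.

(* A cocycle is made zero on its generators of top rank, where its
   coefficients are cocycles of Y, by subtracting a coboundary. *)
Lemma sf_exact (Z : sfX S -> Prop) (i : int) (w : T) :
  (forall x y, Z x -> sfD x y != 0 -> Z y) ->
  (forall x, Z x -> exact_at (i - dg x) Y) ->
  (forall x, kap x w != 0 -> Z x) ->
  deg (dgm T) i w -> df T w = 0 -> exists v, w = df T v.
Proof.
move=> Zc Zex wZ.
have [s [_ hs _]] := kap_decomp w.
pose n := (\max_(x <- s) (rank x).+1)%N.
have wn x : kap x w != 0 -> (rank x < n)%N.
  move=> wx; have xs : x \in s by apply: contraNT wx => /hs ->.
  by rewrite /n (big_rem x xs) /= leq_max leqnn.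
clearbody n; clear s hs; elim: n w wZ wn => [|n IH] w wZ wn dw zw.
  exists 0; rewrite raddf0; apply: kap_inj => x; rewrite (zmor0 (kapB _)).
  by apply/eqP; apply: contraT => /wn.
have [s [us hs we]] := kap_decomp w.
(* No generator of rank at most n has x in its differential, so up to sign the coefficient of d w at
   x is d of the coefficient of w. *)
have topz x : rank x = n -> df Y (kap x w) = 0.
  move=> xn; have := congr1 (kap x) zw; rewrite (zmor0 (kapB _)).
  rewrite {1}we (zmorS (dfB _)) (zmorS (kapB _)).
  have e y : y \in s -> kap x (df T (tens iA (bas y) (kap y w)))
      = if x == y then df Y (kap x w) *~ sg (dg x) else 0.
    move=> ys; rewrite df_tens_bas (zmorD (kapB _)) (zmorMz (kapB _)) kap_bas kap_tens.
    have [wy0|/wn yn] := eqVneq (kap y w) 0.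
      rewrite wy0 scaler0 raddf0 if_same mul0rz addr0.
      by case: eqP => // ->; rewrite wy0 raddf0 mul0rz.
    rewrite sfD_rank ?xn // (zmor0 (twnB _ _)) scale0r add0r.
    by case: eqP => [->|_] //; rewrite mul0rz.
  rewrite (eq_big_seq _ e) => h.
  have [xs|xs] := boolP (x \in s); last by rewrite hs // raddf0.
  move: h; rewrite (bigD1_seq x) //= eqxx big1 => [|y yx]; last first.
    by rewrite eq_sym (negPf yx).
  by rewrite addr0 => h; rewrite -[LHS](mulz_sgsg _ (dg x)) h mul0rz.
have sol x : exists v : Y, rank x = n -> kap x w != 0 -> kap x w = df Y v.
  have [xn|xn] := eqVneq (rank x) n; last by exists 0 => /eqP; rewrite (negPf xn).
  have [->|wx] := eqVneq (kap x w) 0; first by exists 0.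
  have [v e] := Zex x (wZ x wx) _ (kap_deg x dw) (topz x xn).
  by exists v.
have [V hV] := choice sol.
pose t := [seq x <- s | (rank x == n) && (kap x w != 0)].
have ut : uniq t by exact: filter_uniq.
have tP x : x \in t -> [/\ rank x = n, kap x w != 0 & kap x w = df Y (V x)].
  rewrite mem_filter => /andP[/andP[/eqP xn wx] _].
  by split=> //; exact: hV.
pose u : T := \sum_(x <- t) tens iA (bas x) (V x) *~ sg (dg x).
(* The primitives [V x] need not be homogeneous; since w has degree i, projecting to degree i - 1
   keeps what has to be cancelled. *)
pose u' := gr (dgm T) (i - 1) u.
have du : df T u' = gr (dgm T) i (df T u) by rewrite /u' diff_gr'.
have kdu x : kap x (df T u) = (if x \in t then kap x w else 0) +
    \sum_(y <- t) (twn (cdg A) (dg x) (sfD y x) *: V y) *~ sg (dg y).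
  rewrite /u (zmorS (dfB _)) (zmorS (kapB _)).
  under eq_bigr do rewrite (zmorMz (dfB _)) df_tens_bas mulrzDl mulz_sgsg addrC
    (zmorD (kapB _)) (zmorMz (kapB _)) kap_bas kap_tens.
  rewrite big_split /=; congr (_ + _).
  have [xt|xt] := boolP (x \in t).
    rewrite (bigD1_seq x) //= eqxx big1 => [|y yx]; last by rewrite eq_sym (negPf yx).
    by rewrite addr0; case: (tP x xt) => _ _ <-.
  by rewrite big_seq big1 // => y yt; case: eqP => // xy; rewrite xy yt in xt.
have kdu' x : kap x (df T u') = (if x \in t then kap x w else 0) +
    gr (dgm Y) (i - dg x)
      (\sum_(y <- t) (twn (cdg A) (dg x) (sfD y x) *: V y) *~ sg (dg y)).
  rewrite du kap_gr kdu raddfD; congr (_ + _).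
  by case: ifP => _; [exact: kap_deg | exact: raddf0].
have zero x : (forall y, y \in t -> sfD y x = 0) ->
    gr (dgm Y) (i - dg x)
      (\sum_(y <- t) (twn (cdg A) (dg x) (sfD y x) *: V y) *~ sg (dg y)) = 0.
  move=> h; rewrite big_seq big1 ?raddf0 // => y /h ->.
  by rewrite (zmor0 (twnB _ _)) scale0r mul0rz.
(* Subtracting d u' cancels the top rank. Its other terms sit at generators in the differentials of
   those in t, which have smaller rank and stay in Z. *)
have [||||v ev] := IH (w - df T u').
- move=> x; rewrite kapB kdu'; have [//|nz] := pselect (Z x).
  rewrite zero => [|y yt]; last first.
    apply/eqP; apply: contraT => yx; case: nz; apply: (Zc y) => //.
    by apply: wZ; case: (tP y yt).
  by rewrite addr0; case: ifP => _; rewrite ?subrr ?eqxx // subr0 => /wZ.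
- move=> x; rewrite kapB kdu'.
  have [|nx] := ltnP (rank x) n; first by [].
  rewrite zero => [|y yt]; last by apply: sfD_rank; case: (tP y yt) => ->.
  rewrite addr0; have [xt|xt] := boolP (x \in t); first by rewrite subrr eqxx.
  rewrite subr0 => wx; case/negP: xt; rewrite mem_filter wx andbT.
  have xn := wn x wx; rewrite ltnS in xn; rewrite eqn_leq xn nx /=.
  by apply: contraNT wx => /hs ->.
- apply: degD => //; apply: degN; rewrite -[i](subrK 1); apply: deg_diff.
  exact: gr_deg.
- by rewrite (dfB (dgm T)) zw diff_diff subr0.
by exists (u' + v); rewrite (zmorD (dfB (dgm T))) -ev addrC subrK.
Qed.

Lemma sf_bnd m n : (forall x, dg x <= n) -> bnd m Y -> bnd (m + n) T.
Proof.
move=> hn bY i mi w dw zw; apply: (@sf_exact (fun=> True) i) => // x _.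
by apply: bY; have := hn x; lia.
Qed.

Lemma sf_acyclic : acyclic Y -> acyclic T.
Proof.
move=> /acyclicP aY; apply/acyclicP => i w dw zw.
exact: (@sf_exact (fun=> True) i).
Qed.

End Filtration.

Lemma sf_Kflat (A : cdgRing) (S : sfData A) rank : ranked (S := S) rank -> Kflat (sfMod S).
Proof.
move=> rk M aM; apply/(qis_acyclic (qis_bij (tsym_bij M (sfMod S)))).
exact: sf_acyclic rk aM.
Qed.

(** Recursion with fuel: [(rank x).+1] rounds determine the value at x, and the default [c] is only
    seen at arguments that [G x] ignores. *)
Lemma rank_rec (X C : Type) (rank : X -> nat) (G : X -> (X -> C) -> C) :
  (forall x u v, (forall y, (rank y < rank x)%N -> u y = v y) -> G x u = G x v) ->
  inhabited C -> exists u, forall x, u x = G x u.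
Proof.
move=> GE [c]; pose U := fix U n x := if n is m.+1 then G x (U m) else c.
have st n : forall m x, (rank x < n)%N -> (n <= m)%N -> U n x = U m x.
  elim: n => // n IH [|m] x //= xn nm; apply: GE => y yx; apply: IH => //.
  exact: leq_trans yx xn.
exists (fun x => U (rank x).+1 x) => x /=; apply: GE => y yx.
exact: (esym (st (rank y).+1 (rank x) y (leqnn _) yx)).
Qed.

Section Kprojective.
Variables (A : cdgRing) (S : sfData A) (rank : sfX S -> nat) (C : dgMod A).
Hypotheses (rk : ranked rank) (aC : acyclic C).
Local Notation F := (sfMod S).
Local Notation dg := (@sfdg _ S).

(** The homotopy is chosen generator by generator along the rank. The degree s is free because
    lifting a map uses s = 1, where the target is the shifted factor of a fiber, and comparing
    null-homotopies uses s = 0. *)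
Lemma Kproj_null_gen (s : int) (f : F -> C) : zmod_morphism f ->
  (forall a v, f (a *: v) = twn (cdg A) s a *: f v) ->
  (forall i v, deg (dgm F) i v -> deg (dgm C) (i + s) (f v)) ->
  (forall v, df C (f v) = f (df F v) *~ sg s) ->
  exists h : F -> C, [/\ zmod_morphism h,
    forall a v, h (a *: v) = twn (cdg A) (s - 1) a *: h v,
    forall i v, deg (dgm F) i v -> deg (dgm C) (i + s - 1) (h v)
    & forall v, f v = df C (h v) + h (df F v) *~ sg s].
Proof.
move=> fB fZ fdeg' fd.
pose ex (u : sfX S -> C) : F -> C := fext (fun x a => twn (cdg A) (s - 1) a *: u x).
have ex0B u x : zmod_morphism (fun a : A => twn (cdg A) (s - 1) a *: u x).
  by move=> a b; rewrite twnB scalerBl.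
have exB u : zmod_morphism (ex u) by exact: fextB.
have exE u x a : ex u (a *: bas x) = twn (cdg A) (s - 1) a *: u x.
  by rewrite scale_bas /ex fext_sing.
have exZ u a v : ex u (a *: v) = twn (cdg A) (s - 1) a *: ex u v.
  move: v; apply: (@sf_ext _ _ _ (fun v => ex u (a *: v))
    (fun v => twn (cdg A) (s - 1) a *: ex u v)) => [v w|v w|x i b _].
  - by rewrite scalerBr exB.
  - by rewrite exB scalerBr.
  by rewrite scalerA !exE scalerA twnM.
have solve (i : int) (z : C) : exists y, deg (dgm C) i z -> df C z = 0 ->
    deg (dgm C) (i - 1) y /\ z = df C y.
  have [[dz zz]|n] := pselect (deg (dgm C) i z /\ df C z = 0); last first.
    by exists 0 => dz zz; case: n.
  have [y0 e0] := (iffLR (acyclicP C) aC) i z dz zz.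
  by have [y dy e] := deg_cobound dz e0; exists y.
have [sol solP] := choice (fun p => solve p.1 p.2).
(* The homotopy equation at the generator x, solved for the value at x: a primitive of f(e_x) minus
   the homotopy on d e_x, up to sign. *)
pose G (x : sfX S) (u : sfX S -> C) := sol (dg x + s, f (bas x) - ex u (sfD x) *~ sg s).
have [|u uE] := @rank_rec _ _ rank G _ (inhabits (0 : C)).
  move=> x u v uv; rewrite /G; congr (sol (_, _ - _ *~ _)); apply: fext_supp => y.
  - by move=> /rk/uv ->.
  - by rewrite (zmor0 (twnB _ _)) scale0r.
  - by rewrite (zmor0 (twnB _ _)) scale0r.
have K1 x a : f (bas x) = df C (u x) + ex u (sfD x) *~ sg s ->
    f (a *: bas x) = df C (ex u (a *: bas x)) + ex u (df F (a *: bas x)) *~ sg s.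
  move=> e; rewrite fZ e exE !leibniz df_bas (zmorD (exB u)) !exZ -[bas x]scale1r exE.
  rewrite twn_1 scale1r twn_diff twn_tw tw_twn1 sgD mulrN1 mulrNz scaleNr scalerDr.
  rewrite mulrzDl -!scalerMzl -!scalerMzr.
  by rewrite [X in _ = X + _]addrC -[RHS]addrA addKr.
have K2 (v : fsf (sfX S) A) :
    (forall x, v x != 0 -> f (bas x) = df C (u x) + ex u (sfD x) *~ sg s) ->
    f v = df C (ex u v) + ex u (df F v) *~ sg s.
  move=> hv; have ve : v = \sum_(y <- fsupp v) v y *: bas y :> F.
    by rewrite {1}(fsf_sing v); apply: eq_bigr => y _; exact/esym/scale_bas.
  rewrite [X in f X]ve [X in ex u X]ve [X in df F X]ve.
  rewrite (zmorS fB) (zmorS (exB u)) !(zmorS (dfB _)) (zmorS (exB u)) mulrz_suml.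
  rewrite -(@big_split C 0 +%R); apply: eq_bigr => y _.
  have [->|/hv/K1 //] := eqVneq (v y) 0.
  rewrite scale0r (zmor0 (dfB (dgm F))) !(zmor0 (exB u)) (zmor0 fB).
  by rewrite (zmor0 (dfB (dgm C))) mul0rz /= addr0.
have exdeg (v : fsf (sfX S) A) i : (forall x, v x != 0 -> deg (dgm C) (dg x + s - 1) (u x)) ->
    deg (dgm F) i v -> deg (dgm C) (i + s - 1) (ex u v).
  move=> hv /fdegP dv; rewrite /ex /fext; elim/big_ind: _ => [|v' w|y _].
  - exact: deg0.
  - exact: degD.
  have [->|/hv dy] := eqVneq (v y) 0.
    by rewrite (zmor0 (twnB _ _)) scale0r; exact: deg0.
  have -> : i + s - 1 = i - dg y + (dg y + s - 1) by lia.
  by apply: dgm_degZ dy; rewrite (twnE _ (dv y)); apply: degMz.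
have key x : deg (dgm C) (dg x + s - 1) (u x) /\
    f (bas x) = df C (u x) + ex u (sfD x) *~ sg s.
  elim/ltn_ind: {x}(rank x) {-2}x (erefl (rank x)) => n IH x xn.
  have IHx y : sfD x y != 0 -> deg (dgm C) (dg y + s - 1) (u y) /\
      f (bas y) = df C (u y) + ex u (sfD y) *~ sg s.
    by move=> /rk yx; apply: (IH (rank y)); rewrite -?xn.
  (* The equation holds on d e_x by induction, and d d e_x = 0 removes its last term; hence the
     element whose primitive is sought is a cocycle. *)
  have fD : f (sfD x) = df C (ex u (sfD x)).
    rewrite K2 => [|y /IHx[] //].
    by rewrite [df F _]sf_sq (zmor0 (exB u)) mul0rz addr0.
  have [||d1 e1] := solP (dg x + s, f (bas x) - ex u (sfD x) *~ sg s).
  - apply: degD; first exact: fdeg' (deg_bas x).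
    apply: degN; apply: degMz.
    have := @exdeg (sfD x) (dg x + 1); rewrite addrAC addrK; apply; last exact: sf_deg.
    by move=> y /IHx[].
  - by rewrite /= raddfB raddfMz /= -fD fd df_bas subrr.
  by rewrite uE; split=> //; rewrite -[df C _]e1 subrK.
exists (ex u); split=> // [i v dv|v].
  by apply: exdeg => // x _; case: (key x).
by apply: K2 => x _; case: (key x).
Qed.

End Kprojective.

(** * K-projectivity and resolutions *)

Definition nullh (A : cdgRing) (M Y : dgMod A) (f : M -> Y) : Prop :=
  exists h : M -> Y, [/\ zmod_morphism h,
    forall a v, h (a *: v) = tw (cdg A) a *: h v,
    forall i v, deg (dgm M) i v -> deg (dgm Y) (i - 1) (h v)
    & forall v, f v = df Y (h v) + h (df M v)].

Lemma nullh_ext (A : cdgRing) (M Y : dgMod A) (f g : M -> Y) :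
  f =1 g -> nullh f -> nullh g.
Proof. by move=> e [h [hB hZ hd he]]; exists h; split=> // v; rewrite -e. Qed.

Lemma nullhD (A : cdgRing) (M Y : dgMod A) (f g : M -> Y) :
  nullh f -> nullh g -> nullh (fun v => f v + g v).
Proof.
case=> h [hB hZ hd he] [k [kB kZ kd ke]]; exists (fun v => h v + k v); split.
- by move=> v w; rewrite hB kB opprD addrACA.
- by move=> a v; rewrite hZ kZ scalerDr.
- by move=> i v dv; apply: degD; [exact: hd | exact: kd].
by move=> v; rewrite he ke raddfD /= addrACA.
Qed.

Lemma nullh_compl (A : cdgRing) (M Y Z : dgMod A) (g : dgHom Y Z) (f : M -> Y) :
  nullh f -> nullh (g \o f).
Proof.
case=> h [hB hZ hd he]; exists (g \o h); split=> /=.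
- by move=> v w; rewrite /= hB raddfB.
- by move=> a v; rewrite /= hZ linearZ.
- by move=> i v dv; apply: dgh_deg; exact: hd.
by move=> v; rewrite /= he (zmorD (dgh_zmod g)) dgh_diff.
Qed.

Lemma nullh_compr (A : cdgRing) (M N Y : dgMod A) (g : dgHom M N) (f : N -> Y) :
  nullh f -> nullh (f \o g).
Proof.
case=> h [hB hZ hd he]; exists (h \o g); split=> /=.
- by move=> v w; rewrite /= raddfB hB.
- by move=> a v; rewrite /= linearZ hZ.
- by move=> i v dv; apply: hd; exact: dgh_deg.
by move=> v; rewrite /= he dgh_diff.
Qed.

Lemma deg_gr_comm (M N : zmodType) (D : dgGroup M) (E : dgGroup N) (f : M -> N) :
  zmod_morphism f -> (forall i x, deg D i x -> deg E i (f x)) ->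
  forall i x, f (gr D i x) = gr E i (f x).
Proof.
move=> fB fd i; apply: (@hom_ext M D N (f \o gr D i) (gr E i \o f)).
- by move=> x y; rewrite /= raddfB fB.
- by move=> x y; rewrite /= fB raddfB.
move=> j x dx; rewrite /= (deg_gr i dx) (deg_gr i (fd j x dx)).
by case: ifP => _ //; exact: (zmor0 fB).
Qed.

Lemma twn1 (M : zmodType) (D : dgGroup M) x : twn D 1 x = tw D x.
Proof.
move: x; apply: (@hom_ext _ D) => [||i x dx]; [exact: twnB | exact: twB |].
by rewrite (twnE 1 dx) mul1r (twE dx).
Qed.

Section Kprojectivity.
Variables (A : cdgRing) (S : sfData A) (rank : sfX S -> nat).
Hypothesis rk : ranked rank.
Local Notation F := (sfMod S).
Variables (Y Z : dgMod A) (al : dgHom Y Z).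
Hypothesis qal : qis al.

(** The map v -> (be v, 0) into the acyclic fiber of [al] has degree 1. The second component of its
    null-homotopy is the lift, and minus the first one is the homotopy. *)
Lemma Kproj_lift (be : dgHom F Z) :
  exists ga : dgHom F Y, nullh (fun v => be v - al (ga v)).
Proof.
have aC : acyclic (fib al) by apply/fib_acyclic.
have [||||h [hB hZ hd he]] := @Kproj_null_gen _ S rank _ rk aC 1
    (fun v => (be v, 0) : fib al).
- by move=> v w; rewrite raddfB; apply: injective_projections; rewrite //= subrr.
- move=> a v; rewrite linearZ; apply: injective_projections => /=; last by rewrite scaler0.
  by rewrite twn1 tw_tw.
- by move=> i v dv; apply/fib_degP; rewrite addrK; split; [exact: dgh_deg | exact: deg0].
- move=> v; rewrite dgh_diff sg1 mulrNz mulr1z.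
  by apply: injective_projections; rewrite /= ?raddf0 ?sub0r ?oppr0.
have eh v : be v = al (h v).2 - df Z (h v).1 - (h (df F v)).1 /\
    df Y (h v).2 = (h (df F v)).2.
  have := he v; rewrite sg1 mulrNz mulr1z => -[e1 /esym/eqP].
  by rewrite subr_eq0 => /eqP.
have gB : zmod_morphism (fun v => (h v).2) by move=> v w; rewrite hB.
have glin : linear (fun v => (h v).2 : Y).
  by move=> a v w; rewrite (zmorD hB) hZ subrr twn0.
have ggr : forall i v, (h (gr (dgm F) i v)).2 = gr (dgm Y) i (h v).2.
  apply: (deg_gr_comm (f := fun v => (h v).2)) => // i v /hd/fib_degP[_].
  by rewrite addrK.
have gdf v : (h (df F v)).2 = df Y (h v).2 by case: (eh v).
exists (DGHom glin ggr gdf) => /=.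
exists (fun v => - (h v).1); split.
- by move=> v w; rewrite hB /= opprD.
- by move=> a v; rewrite hZ subrr twn0 /= scalerN.
- by move=> i v /hd/fib_degP[]; rewrite addrK => d1 _; exact: degN.
move=> v; case: (eh v) => -> _; rewrite raddfN /=.
by rewrite addrAC [al _ - _ - _]addrAC subrr add0r.
Qed.

(** A null-homotopy k of al o u makes v -> (k v, u v) a chain map into the acyclic fiber; the second
    component of a null-homotopy of this map is one for u. *)
Lemma Kproj_null (u : dgHom F Y) : nullh (al \o u) -> nullh u.
Proof.
have aC : acyclic (fib al) by apply/fib_acyclic.
case=> k [kB kZ kd ke].
have [||||h [hB hZ hd he]] := @Kproj_null_gen _ S rank _ rk aC 0
    (fun v => (k v, u v) : fib al).
- by move=> v w; rewrite raddfB kB.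
- by move=> a v; rewrite twn0 linearZ kZ.
- by move=> i v dv; apply/fib_degP; rewrite addr0; split; [exact: kd | exact: dgh_deg].
- move=> v; rewrite mulr1z dgh_diff; apply: injective_projections => //=.
  by have /= -> := ke v; rewrite addrC addKr.
exists (fun v => (h v).2); split.
- by move=> v w; rewrite hB.
- by move=> a v; rewrite hZ /= -[twn _ _ a](tw_tw (cdg A)) tw_twn1 twn0.
- by move=> i v /hd/fib_degP[_]; rewrite addr0.
by move=> v; have := congr1 snd (he v); rewrite mulr1z.
Qed.

End Kprojectivity.

Section SemifreeHom.
Variables (A : cdgRing) (S : sfData A) (M : dgMod A) (u : sfX S -> M).
Local Notation F := (sfMod S).
Let E : F -> M := fext (fun x a => a *: u x).
Hypothesis ud : forall x, deg (dgm M) (sfdg x) (u x).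
Hypothesis uD : forall x, df M (u x) = E (sfD x).

Let EB : zmod_morphism E. Proof. by apply: fextB => x a b; rewrite scalerBl. Qed.
Let Eb a x : E (a *: bas x) = a *: u x.
Proof. by rewrite scale_bas /E fext_sing // => y b c; rewrite scalerBl. Qed.

Lemma sfHom_linear : linear E.
Proof.
move=> c v w; rewrite (zmorD EB); congr (_ + _); move: v.
apply: (@sf_ext _ _ _ (fun v => E (c *: v)) (fun v => c *: E v)) => [v w'|v w'|x i a _].
- by rewrite scalerBr EB.
- by rewrite EB scalerBr.
by rewrite scalerA !Eb scalerA.
Qed.

Lemma sfHom_gr i v : E (gr (dgm F) i v) = gr (dgm M) i (E v).
Proof.
move: v; apply: (@sf_ext _ _ _ (fun v => E (gr (dgm F) i v))
  (fun v => gr (dgm M) i (E v))) => [v w|v w|x j a da].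
- by rewrite raddfB EB.
- by rewrite EB raddfB.
rewrite Eb (deg_gr i (dgm_degZ da (deg_bas x))) (deg_gr i (dgm_degZ da (ud x))).
by case: ifP => _; rewrite ?Eb ?(zmor0 EB).
Qed.

Lemma sfHom_diff v : E (df F v) = df M (E v).
Proof.
move: v; apply: (@sf_ext _ _ _ (fun v => E (df F v))
  (fun v => df M (E v))) => [v w|v w|x j a da].
- by rewrite raddfB EB.
- by rewrite EB raddfB.
rewrite Eb !leibniz (zmorD EB) Eb df_bas uD; congr (_ + _).
have := sfHom_linear (tw (cdg A) a) (sfD x) 0.
by rewrite !addr0 (zmor0 EB) addr0.
Qed.

Definition sfHom : dgHom F M := DGHom sfHom_linear sfHom_gr sfHom_diff.

Lemma sfHom_bas x : sfHom (bas x) = u x.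
Proof. by rewrite -[bas x]scale1r /sfHom /= Eb scale1r. Qed.

End SemifreeHom.

(* A tree Gen n a y m i stands for a generator e of degree i with
   d e = \sum_j a_j y_j that is mapped to m; it is discarded (mapped to 0,
   with d e = 0) unless these prescriptions are consistent. *)
Inductive tree (A : cdgRing) (M : dgMod A) : Type :=
  Gen (n : nat) of ('I_n -> A) & ('I_n -> tree M) & M & int.

HB.instance Definition _ (A : cdgRing) (M : dgMod A) := gen_eqMixin (tree M).
HB.instance Definition _ (A : cdgRing) (M : dgMod A) := gen_choiceMixin (tree M).

Section Resolution.
Variables (A : cdgRing) (M : dgMod A) (ok : pred int) (b0 : int).
Hypotheses (okb0 : ok b0) (okle : forall i j : int, i <= j -> ok j -> ok i).
Hypothesis okM : forall i, ~~ ok i -> exact_at i M.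
Local Notation X := (tree M).

(** Trees of a disallowed degree are moved to [b0], so that every generator has an allowed
    degree. *)
Definition tdg (t : X) : int := let: Gen n a y m i := t in if ok i then i else b0.

Fixpoint trank (t : X) : nat :=
  let: Gen n a y m i := t in (\max_(j < n) trank (y j)).+1.

(** The differential and the image of a generator. [dw] and [ew] are the differential and the image
    of [w] written out, because the recursion only sees values at subtrees; [tvalP] folds them
    back. *)
Fixpoint tval (t : X) : fsf X A * M :=
  let: Gen n a y m i := t in
  let w := \sum_(j < n) sing (y j) (a j) in
  let dw := \sum_(j < n) (sing (y j) (diff (cdg A) (a j)) + tw (cdg A) (a j) *: (tval (y j)).1) in
  let ew := \sum_(j < n) a j *: (tval (y j)).2 in
  if `[< [/\ ok i, fdeg tdg (i + 1) w, dw = 0, deg (dgm M) i m & df M m = ew] >]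
  then (w, m) else (0, 0).

Let D t := (tval t).1.
Let ep t := (tval t).2.
Let E : fsf X A -> M := fext (fun x a => a *: ep x).
Let EB : zmod_morphism E. Proof. by apply: fextB => x a b; rewrite scalerBl. Qed.
Let Es x a : E (sing x a) = a *: ep x.
Proof. by rewrite /E fext_sing // => y b c; rewrite scalerBl. Qed.

Lemma tvalP (t : X) : let: Gen n a y m i := t in
  let w := \sum_(j < n) sing (y j) (a j) in
  [\/ [/\ ok i, fdeg tdg (i + 1) w, fdiff D w = 0, deg (dgm M) i m & df M m = E w]
      /\ tval t = (w, m) | tval t = (0, 0)].
Proof.
case: t => n a y m i; cbv zeta; set w := \sum_(j < n) sing _ _.
have dE : fdiff D w = \sum_(j < n)
    (sing (y j) (diff (cdg A) (a j)) + tw (cdg A) (a j) *: (tval (y j)).1).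
  by rewrite /w (zmorS (fdiffB D)); apply: eq_bigr => j _; rewrite fdiff_sing.
have eE : E w = \sum_(j < n) a j *: (tval (y j)).2.
  by rewrite /w (zmorS EB); apply: eq_bigr => j _; rewrite Es.
rewrite /= -/w -dE -eE.
by case: asboolP => h; [left | right].
Qed.

Lemma tvalE n (a : 'I_n -> A) (y : 'I_n -> X) m i :
  let w := \sum_(j < n) sing (y j) (a j) in
  ok i -> fdeg tdg (i + 1) w -> fdiff D w = 0 -> deg (dgm M) i m -> df M m = E w ->
  tval (Gen a y m i) = (w, m).
Proof.
set w := \sum_(j < n) sing _ _ => /= h1 h2 h3 h4 h5.
have dE : fdiff D w = \sum_(j < n)
    (sing (y j) (diff (cdg A) (a j)) + tw (cdg A) (a j) *: (tval (y j)).1).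
  by rewrite /w (zmorS (fdiffB D)); apply: eq_bigr => j _; rewrite fdiff_sing.
have eE : E w = \sum_(j < n) a j *: (tval (y j)).2.
  by rewrite /w (zmorS EB); apply: eq_bigr => j _; rewrite Es.
by rewrite -/w -dE -eE; case: asboolP => // -[].
Qed.

Lemma tree_deg t : fdeg tdg (tdg t + 1) (D t).
Proof.
rewrite /D; case: t (tvalP t) => n a y m i.
by case=> [[[oki dw _ _ _] ->]|->]; [rewrite /= oki | exact: (zmor0 (fgrB _ _))].
Qed.

Lemma tree_sq t : fdiff D (D t) = 0.
Proof.
rewrite {2}/D; case: t (tvalP t) => n a y m i.
by case=> [[[_ _ dw _ _] ->]|->]; last exact: (zmor0 (fdiffB _)).
Qed.

Definition treeData : sfData A := SfData tree_deg tree_sq.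

Lemma tree_ranked : ranked (S := treeData) trank.
Proof.
rewrite /ranked /= /D => t x; case: t (tvalP t) => n a y m i.
case=> [[_ ->]|->]; last by rewrite eqxx.
rewrite [(_, _).1]/= fsf_sum => nz; rewrite ltnS.
have [[j ->]|no] := pselect (exists j, x = y j).
  exact: (@leq_bigmax _ (fun j => trank (y j))).
case/eqP: nz; rewrite big1 // => j _; rewrite singE; case: eqP => // xy.
by case: no; exists j.
Qed.

Lemma tree_ep_deg t : deg (dgm M) (tdg t) (ep t).
Proof.
rewrite /ep; case: t (tvalP t) => n a y m i.
by case=> [[[oki _ _ dm _] ->]|->]; [rewrite /= oki | exact: deg0].
Qed.

Lemma tree_ep_diff t : df M (ep t) = E (D t).
Proof.
rewrite /ep /D; case: t (tvalP t) => n a y m i.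
by case=> [[[_ _ _ _ e] ->]|->] //; rewrite raddf0 (zmor0 EB).
Qed.

Definition treeHom : dgHom (sfMod treeData) M :=
  @sfHom _ treeData M ep tree_ep_deg tree_ep_diff.

(** A cocycle of M is hit by a leaf, and a cocycle w of the free module whose image is bounded by m
    is killed by the tree with differential w and image m. Trees are closed under this second
    operation, so a single step replaces the usual iterated attachment of cells. *)
Lemma treeHom_qis : qis treeHom.
Proof.
apply/qisP => i; split=> [w dw zw m em|w dw zw]; last first.
  have [oki|/okM ex] := boolP (ok i); last first.
    have [y ->] := ex w dw zw; exists 0, y.
    by rewrite !raddf0 add0r; split=> //; exact: deg0.
  pose t : X := @Gen A M 0 (fun j => 0) (fun j => False_rect _ (notF (ltn_ord j))) w i.
  have tv : tval t = (0, w).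
    rewrite tvalE ?big_ord0 //; first exact: (zmor0 (fgrB _ _)).
      exact: (zmor0 (fdiffB _)).
    by rewrite (zmor0 EB).
  exists (bas (S := treeData) t), 0; split.
  - by have := deg_bas (S := treeData) t; rewrite /= oki.
  - by rewrite df_bas /= /D tv.
  by rewrite raddf0 addr0 sfHom_bas /ep tv.
have [m' dm' em'] := deg_cobound (dgh_deg treeHom dw) em.
(* All generators then have degree below i - 1, and A has no positive degrees, so w is zero. *)
have [oki|noki] := boolP (ok (i - 1)); last first.
  exists 0; rewrite raddf0; apply: fsfP => x; rewrite fsf0.
  apply: (cdg_npos (i := i - tdg x)); last by move: dw => /fdegP; apply.
  suff : ~~ (i - 1 <= tdg x) by lia.
  apply: contra noki => le; apply: okle le _.
  by case: x => n a y m0 j /=; case: ifP.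
have ws : w = \sum_(j < size (fsupp w))
    sing (tnth (in_tuple (fsupp w)) j) ((w : fsf X A) (tnth (in_tuple (fsupp w)) j)).
  rewrite {1}(fsf_sing w).
  by rewrite (big_tnth 0 _ (fsupp w) xpredT (fun x => sing x ((w : fsf X A) x))).
pose t : X := Gen (fun j => (w : fsf X A) (tnth (in_tuple (fsupp w)) j))
  (fun j => tnth (in_tuple (fsupp w)) j) m' (i - 1).
have tv : tval t = (w, m').
  by rewrite [X in _ = (X, _)]ws tvalE // -ws // subrK.
by exists (bas (S := treeData) t); rewrite df_bas /= /D tv.
Qed.

End Resolution.

Lemma semifree_resolution (A : cdgRing) (M : dgMod A) :
  exists (S : sfData A) (rank : sfX S -> nat) (f : dgHom (sfMod S) M),
    ranked rank /\ qis f.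
Proof.
exists (@treeData A M xpredT 0), (@trank A M), (@treeHom A M xpredT 0).
by split; [exact: tree_ranked | exact: treeHom_qis].
Qed.

Lemma semifree_resolution_bnd (A : cdgRing) (M : dgMod A) n : bnd n M ->
  exists (S : sfData A) (rank : sfX S -> nat) (f : dgHom (sfMod S) M),
    [/\ ranked rank, qis f & forall x, sfdg (s := S) x <= n].
Proof.
move=> bM; pose ok := [pred i : int | i <= n].
exists (@treeData A M ok n), (@trank A M), (@treeHom A M ok n); split.
- exact: tree_ranked.
- apply: treeHom_qis; rewrite /ok /=; [by lia | by move=> i j; lia | move=> i ni].
  by apply: bM; lia.
by case=> k a y m i /=; case: ifP.
Qed.

Lemma Kflat_resolution (A : cdgRing) (M : dgMod A) :
  exists (P : dgMod A) (f : dgHom P M), Kflat P /\ qis f.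
Proof.
have [S [rank [f [rk qf]]]] := semifree_resolution M.
by exists (sfMod S), f; split=> //; exact: sf_Kflat rk.
Qed.

(** * Isomorphisms in the derived category *)

Section TensorQis.
Variable A : cdgRing.
Local Notation iA := (cdgId A).

Lemma Kflat_qis_sym (P M N : dgMod A) (f : dgHom M N) : Kflat P -> qis f ->
  qis (tmap iA (dgId P) f).
Proof.
move=> kP qf; apply/(qis_square (qis_bij (tsym_bij P M)) (qis_bij (tsym_bij P N))
  (tsym_nat (dgId P) f)).
exact: Kflat_qis.
Qed.

(** M is arbitrary: against a K-flat resolution of its restriction the claim is clear, and
    K-flatness of P and Q carries it over to M. *)
Lemma Kflat_qis2 (B : cdgRing) (phi : cdgHom A B) (M : dgMod B) (P Q : dgMod A)
  (g : dgHom P Q) : Kflat P -> Kflat Q -> qis g -> qis (tmap phi (dgId M) g).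
Proof.
move=> kP kQ qg; apply/(restr_qis phi).
have [R [r [kR qr]]] := Kflat_resolution (restr phi M).
have sq x : tmap iA r (dgId Q) (tmap iA (dgId R) g x) =
    tmap iA (dgId (restr phi M)) g (tmap iA r (dgId P) x).
  rewrite -!dgCompE -!tmap_comp; congr (tmap _ _ _ x); exact: dgHom_eq.
have qM : qis (tmap iA (dgId (restr phi M)) g).
  by apply/(qis_square (Kflat_qis _ kP qr) (Kflat_qis _ kQ qr) sq)/Kflat_qis_sym.
apply/(qis_square (qis_bij (trestr_bij phi M P)) (qis_bij (trestr_bij phi M Q))
  (f := tmap iA (restrHom phi (dgId M)) g)) => [x|].
  by rewrite trestr_nat.
by have -> : restrHom phi (dgId M) = dgId (restr phi M) by exact: dgHom_eq.
Qed.

Lemma Kflat_tens (P Q : dgMod A) : Kflat P -> Kflat Q -> Kflat (tensorMod iA P Q).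
Proof.
move=> kP kQ M aM.
apply/(qis_acyclic (qis_bij (assoc_bij (phi := iA) (psi := iA) (chi := iA)
  (fun a => erefl) M P Q))).
by apply: kQ; exact: kP.
Qed.

Lemma Kflat_reg : Kflat (regMod A).
Proof. by move=> M aM; apply/(qis_acyclic (qis_bij (runit_bij M))). Qed.

Lemma dg_inverse (P Q : dgMod A) (f : dgHom P Q) : bijective f ->
  exists g : dgHom Q P, cancel f g /\ cancel g f.
Proof.
case=> g fK gK.
have gl : linear g by move=> a x y; apply: (can_inj fK); rewrite dgh_linear !gK.
have gg i m : g (gr (dgm Q) i m) = gr (dgm P) i (g m).
  by apply: (can_inj fK); rewrite dgh_gr !gK.
have gd m : g (df Q m) = df P (g m) by apply: (can_inj fK); rewrite dgh_diff !gK.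
by exists (DGHom gl gg gd).
Qed.

Lemma Kflat_bij (P Q : dgMod A) (f : dgHom P Q) : bijective f -> Kflat Q -> Kflat P.
Proof.
move=> bf kQ M aM; have [h [fK hK]] := dg_inverse bf.
have b : bijective (tmap iA (dgId M) f).
  have e1 : dgComp f h = dgId P by apply: dgHom_eq.
  have e2 : dgComp h f = dgId Q by apply: dgHom_eq.
  have e3 : dgComp (dgId M) (dgId M) = dgId M by apply: dgHom_eq.
  exists (tmap iA (dgId M) h) => x; rewrite -dgCompE -tmap_comp e3 ?e1 ?e2.
    by rewrite tmap_id.
  by rewrite tmap_id.
by apply/(qis_acyclic (qis_bij b)); exact: kQ.
Qed.

End TensorQis.

Lemma Kflat_bc (A B : cdgRing) (phi : cdgHom A B) (P : dgMod A) : Kflat P ->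
  Kflat (tensorMod phi (regMod B) P).
Proof.
move=> kP M aM.
apply/(qis_acyclic (qis_bij (assoc_bij (phi := phi) (psi := cdgId B) (chi := phi)
  (fun a => erefl) M (regMod B) P))).
by apply: Kflat_acyclic => //; apply/(qis_acyclic (qis_bij (runit_bij M))).
Qed.

Section IsoD.
Variable A : cdgRing.

Lemma isoD_refl (M : dgMod A) : isoD M M.
Proof. by exists (dmap (dgId M)), (dmap (dgId M)); split; exact: deq_idl. Qed.

Lemma isoD_sym (M N : dgMod A) : isoD M N -> isoD N M.
Proof. by case=> u [v [e f]]; exists v, u. Qed.

Lemma isoD_trans (M N P : dgMod A) : isoD M N -> isoD N P -> isoD M P.
Proof.
case=> u [v [e f]] [u' [v' [e' f']]]; exists (dcomp u u'), (dcomp v' v); split.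
  apply: deq_trans e; apply: deq_trans (deq_sym (deq_assoc _ _ _)) _.
  apply: deq_comp; first exact: deq_refl.
  apply: deq_trans (deq_assoc _ _ _) _; apply: deq_trans (deq_idl v).
  by apply: deq_comp => //; exact: deq_refl.
apply: deq_trans f'; apply: deq_trans (deq_sym (deq_assoc _ _ _)) _.
apply: deq_comp; first exact: deq_refl.
apply: deq_trans (deq_assoc _ _ _) _; apply: deq_trans (deq_idl u').
by apply: deq_comp => //; exact: deq_refl.
Qed.

Lemma isoD_qis (M N : dgMod A) (f : dgHom M N) : qis f -> isoD M N.
Proof.
by move=> qf; exists (dmap f), (dinv qf); split; [exact: deq_invr | exact: deq_invl].
Qed.

Lemma isoD_bij (M N : dgMod A) (f : dgHom M N) : bijective f -> isoD M N.
Proof. by move=> /qis_bij/isoD_qis. Qed.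

Lemma isoclass_eq (M N : dgMod A) : isoD M N -> isoclass M = isoclass N.
Proof.
move=> e; apply/funext => P; apply/propext; split=> h; first exact: isoD_trans e.
exact: isoD_trans (isoD_sym e).
Qed.

End IsoD.

Section Functor.
Variables (A B : cdgRing) (T : dgMod A -> dgMod B).
Variable Tm : forall M N, dgHom M N -> dgHom (T M) (T N).
Hypotheses (Tid : forall M, Tm (dgId M) = dgId (T M))
  (Tcomp : forall M N P (f : dgHom M N) (g : dgHom N P),
    Tm (dgComp f g) = dgComp (Tm f) (Tm g))
  (Tqis : forall M N (f : dgHom M N), qis f -> qis (Tm f)).

(** The universal property of the localization, by recursion on words. *)
Fixpoint dmorT M N (u : dmor M N) : dmor (T M) (T N) :=
  match u in dmor M N return dmor (T M) (T N) with
  | dmap _ _ f => dmap (Tm f)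
  | dinv _ _ s qs => dinv (Tqis qs)
  | dcomp _ _ _ u v => dcomp (dmorT u) (dmorT v)
  end.

Lemma deqT M N (u v : dmor M N) : deq u v -> deq (dmorT u) (dmorT v).
Proof.
elim=> {M N u v} /= [M N u|M N u v _ e|M N u v w _ e _ f|M N P u u' v v' _ e _ f
  |M N P Q u v w|M N u|M N u|M N P f g|M N s qs|M N s qs].
- exact: deq_refl.
- exact: deq_sym.
- exact: deq_trans f.
- exact: deq_comp.
- exact: deq_assoc.
- by rewrite Tid; exact: deq_idl.
- by rewrite Tid; exact: deq_idr.
- by rewrite Tcomp; exact: deq_map.
- by rewrite Tid; exact: deq_invr.
- by rewrite Tid; exact: deq_invl.
Qed.

Lemma isoD_functor M N : isoD M N -> isoD (T M) (T N).
Proof.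
case=> u [v [/deqT e /deqT f]]; exists (dmorT u), (dmorT v).
by move: e f; rewrite /= !Tid.
Qed.

End Functor.

(* The action of a morphism of the derived category on cohomology, as a
   relation between cocycles of degree i. *)
Section CohomologyRelation.
Variable A : cdgRing.
Implicit Types M N P : dgMod A.

Definition zc M (i : int) (z : M) : Prop := deg (dgm M) i z /\ df M z = 0.

Fixpoint crel (i : int) M N (u : dmor M N) : M -> N -> Prop :=
  match u in dmor M N return M -> N -> Prop with
  | dmap M N f => fun z w => exists y, w = f z + df N y
  | dinv M N s _ => fun w z => exists y, w = s z + df N y
  | dcomp M N P u v => fun z w => exists2 t, zc i t & crel i u z t /\ crel i v t w
  end.

Lemma zc0 M i : zc i (0 : M). Proof. by split; [exact: deg0 | exact: raddf0]. Qed.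

Lemma zcD M i (x y : M) : zc i x -> zc i y -> zc i (x + y).
Proof. by case=> dx zx [dy zy]; split; [exact: degD | rewrite raddfD /= zx zy addr0]. Qed.

Lemma crelD i M N (u : dmor M N) z z' w w' :
  crel i u z w -> crel i u z' w' -> crel i u (z + z') (w + w').
Proof.
elim: u z z' w w' => {M N} /= [M N f|M N s _|M N P u IHu v IHv] z z' w w'.
- by case=> y -> [y' ->]; exists (y + y'); rewrite !raddfD /= addrACA.
- by case=> y -> [y' ->]; exists (y + y'); rewrite !raddfD /= addrACA.
case=> t zt [c d] [t' zt' [c' d']]; exists (t + t'); first exact: zcD.
by split; [exact: IHu | exact: IHv].
Qed.

Lemma crel_cob i M N (u : dmor M N) x y : crel i u (df M x) (df N y).
Proof.
elim: u x y => {M N} /= [M N f|M N s _|M N P u IHu v IHv] x y.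
- by exists (y - f x); rewrite dgh_diff raddfB /= addrC subrK.
- by exists (x - s y); rewrite dgh_diff raddfB /= addrC subrK.
by exists 0; [exact: zc0 | rewrite -(raddf0 (df N)); split; [exact: IHu | exact: IHv]].
Qed.

Lemma crel_cobr i M N (u : dmor M N) x w : zc i w -> crel i u (df M x) w ->
  exists y, w = df N y.
Proof.
elim: u x w => {M N} /= [M N f|M N s qs|M N P u IHu v IHv] x w zw.
- by case=> y ->; exists (f x + y); rewrite raddfD /= dgh_diff.
- case=> y e; have [si _] := iffLR (qisP s) qs i; case: zw => dw zw.
  by apply: (si w dw zw (x - y)); rewrite raddfB /= e addrK.
by case=> t zt [/(IHu _ _ zt)[y ->] /(IHv _ _ zw)].
Qed.

Lemma crel_tot i M N (u : dmor M N) z : zc i z -> exists2 w, zc i w & crel i u z w.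
Proof.
elim: u z => {M N} /= [M N f|M N s qs|M N P u IHu v IHv] z zz.
- case: zz => dz zz; exists (f z); last by exists 0; rewrite raddf0 addr0.
  by split; [exact: dgh_deg | rewrite -dgh_diff zz raddf0].
- case: zz => dz zz; have [_ ss] := iffLR (qisP s) qs i.
  by have [w [y [dw zw e]]] := ss z dz zz; exists w => //; exists y.
have [t zt c] := IHu z zz; have [w zw d] := IHv t zt.
by exists w => //; exists t.
Qed.

Lemma crelZ i k M N (u : dmor M N) z w (a : A) : deg (cdg A) k a -> diff (cdg A) a = 0 ->
  crel i u z w -> crel (k + i) u (a *: z) (a *: w).
Proof.
move=> da za.
have aD (L : dgMod A) (y : L) : a *: df L y = df L (tw (cdg A) a *: y).
  by rewrite leibniz diff_tw za raddf0 oppr0 scale0r add0r tw_tw.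
elim: u z w => {M N} /= [M N f|M N s qs|M N P u IHu v IHv] z w.
- by case=> y ->; exists (tw (cdg A) a *: y); rewrite scalerDr aD linearZ.
- by case=> y ->; exists (tw (cdg A) a *: y); rewrite scalerDr aD linearZ.
case=> t [dt zt] [c d]; exists (a *: t); last by split; [exact: IHu | exact: IHv].
by split; [exact: dgm_degZ | rewrite leibniz za zt scale0r scaler0 addr0].
Qed.

(** It makes cohomology an invariant of D(A): the words of an isomorphism and of its inverse induce
    mutually inverse relations on cocycles modulo coboundaries. *)
Lemma crel_deq i M N (u v : dmor M N) : deq u v ->
  forall z w, zc i z -> zc i w -> crel i u z w <-> crel i v z w.
Proof.
elim=> {M N u v} /= [M N u|M N u v _ e|M N u v w _ e _ f|M N P u u' v v' _ e _ f
  |M N P Q u v t|M N u|M N u|M N P f g|M N s qs|M N s qs] z w' zz zw.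
- by [].
- by rewrite e.
- by rewrite e // f.
- by split=> -[t zt [c d]]; exists t => //; move: c d; rewrite e ?f.
- split=> [[x zx [c [y zy [d d']]]]|[y zy [[x zx [c d]] d']]].
    by exists y => //; split=> //; exists x.
  by exists x => //; split=> //; exists y.
- split=> [[t zt [[y ->] c]]|c]; last first.
    by exists z => //; split=> //; exists 0; rewrite raddf0 addr0.
  have := crelD c (crel_cob i u (- y) 0).
  by rewrite raddf0 addr0 raddfN addrK.
- split=> [[t zt [c [y e]]]|c]; last first.
    by exists w' => //; split=> //; exists 0; rewrite raddf0 addr0.
  have := crelD c (crel_cob i u 0 y).
  by rewrite raddf0 addr0 -e.
- split=> [[t zt [[y ->] [y' ->]]]|[y ->]].
    by exists (g y + y'); rewrite (zmorD (dgh_zmod g)) (zmorD (dfB _)) dgh_diff addrA.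
  have [dfz zfz] : zc i (f z).
    by case: zz => dz zz; split; [exact: dgh_deg | rewrite -dgh_diff zz raddf0].
  exists (f z) => //; split; first by exists 0; rewrite raddf0 addr0.
  by exists y.
- have [si _] := iffLR (qisP s) qs i.
  split=> [[t zt [[y ->] [y' e]]]|[y ->]].
    have [|||x ex] := si (w' - z) _ _ (y - y').
    + by apply: degD; [case: zw | apply: degN; case: zz].
    + by case: zw zz => _ zw [_ zz]; rewrite raddfB /= zw zz subrr.
    + by rewrite !raddfB /= -[s w'](addrK (df N y')) -e [s z + _]addrC addrAC addrK.
    by exists x; rewrite -ex addrC subrK.
  have [dfz zfz] : zc i (s z).
    by case: zz => dz zz; split; [exact: dgh_deg | rewrite -dgh_diff zz raddf0].
  exists (s z) => //; split; first by exists 0; rewrite raddf0 addr0.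
  by exists (- s y); rewrite raddfD /= dgh_diff raddfN addrK.
have [_ ss] := iffLR (qisP s) qs i.
split=> [[t zt [[y ->] [y' ->]]]|[y ->]].
  by exists (y' - y); rewrite raddfB /= -addrA; congr (_ + _); rewrite addrC subrK.
case: zz => dz zz; have [t [x [dt zt e]]] := ss z dz zz.
exists t => //; split; first by exists x.
by exists (x + y); rewrite e raddfD /= addrA.
Qed.

Lemma isoD_exact_at i M N : isoD M N -> exact_at i M -> exact_at i N.
Proof.
case=> u [v [_ e]] ex z dz zz.
have [w zw c] := crel_tot v (conj dz zz); have [y zy d] := crel_tot u zw.
have [x ew] : exists x, w = df M x by apply: ex; case: zw.
have d' := d; rewrite ew in d'; have [y' ey] := crel_cobr zy d'.
have /(crel_deq e (conj dz zz) zy)[x'] : crel i (dcomp v u) z y by exists w.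
by rewrite /= ey => e'; exists (y' - x'); rewrite raddfB /= e' addrK.
Qed.

Lemma isoD_bnd n M N : isoD M N -> bnd n M -> bnd n N.
Proof. by move=> e b i ni; apply: isoD_exact_at e _; exact: b. Qed.

Lemma isoD_acyclic M N : isoD M N -> acyclic M -> acyclic N.
Proof. by move=> e; rewrite !acyclicP => h i; exact: isoD_exact_at e _. Qed.

(* A comes to M through the image of 1 under the isomorphism on H^0. *)
Lemma isoD_reg M : isoD (regMod A) M -> exists f : dgHom (regMod A) M, qis f.
Proof.
case=> u [v [e1 e2]].
have z1 : zc 0 (1 : regMod A) by split; [exact: cdg_deg1 | exact: diff1].
have [w [dw zw] cw] := crel_tot u z1; exists (regHom dw zw).
have act i (a : regMod A) : zc i a -> zc i ((a : A) *: w) /\ crel i u a ((a : A) *: w).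
  case=> da za; split.
    split; first by rewrite -[i]addr0; exact: dgm_degZ.
    by rewrite leibniz zw scaler0 addr0 [diff _ _]za scale0r.
  by have := crelZ da za cw; rewrite addr0; congr crel; exact: mulr1.
apply/qisP => i; split=> [a da za y|w' dw' zw'].
  rewrite regHomE => ea; have [zaw ca] := act i a (conj da za).
  have [b zb cb] := crel_tot v zaw; rewrite ea in cb.
  have [x ex] := crel_cobr zb cb; rewrite -ea in cb.
  have /(crel_deq e1 (conj da za) zb)[x'] : crel i (dcomp u v) a b.
    by exists ((a : A) *: w).
  by rewrite /= ex => e'; exists (x - x'); rewrite raddfB /= [diff _ x]e' addrK.
have [a [da za] ca] := crel_tot v (conj dw' zw').
have [zaw cu] := act i a (conj da za).
have /(crel_deq e2 (conj dw' zw') zaw)[y e'] : crel i (dcomp v u) w' ((a : A) *: w).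
  by exists a.
exists a, (- y); split=> //.
by rewrite regHomE e' /= raddfN addrK.
Qed.

End CohomologyRelation.

(** * Inverse pairs and base change *)

Notation "M '⊗' N" := (tensorMod (cdgId _) M N) (at level 40, left associativity).

Section Calculus.
Variable A : cdgRing.
Implicit Types M N P : dgMod A.

Lemma isoD_tensl (B : cdgRing) (phi : cdgHom A B) (M N : dgMod B) P : Kflat P ->
  isoD M N -> isoD (tensorMod phi M P) (tensorMod phi N P).
Proof.
move=> kP e; refine (@isoD_functor _ _ (fun L => tensorMod phi L P)
  (fun L L' f => tmap phi f (dgId P)) _ _ _ M N e).
- by move=> L; exact: tmap_id.
- by move=> L L' L'' f g; rewrite -tmap_comp; congr tmap; exact: dgHom_eq.
by move=> L L' f; exact: Kflat_qis.
Qed.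

Lemma isoD_tsym M N : isoD (M ⊗ N) (N ⊗ M).
Proof. exact: isoD_bij (tsym_bij M N). Qed.

Lemma isoD_tensr M N P : Kflat P -> isoD M N -> isoD (P ⊗ M) (P ⊗ N).
Proof.
move=> kP e; apply: isoD_trans (isoD_tsym _ _) _.
by apply: isoD_trans (isoD_tsym _ _); exact: isoD_tensl.
Qed.

Lemma isoD_assoc M N P : isoD (M ⊗ (N ⊗ P)) (M ⊗ N ⊗ P).
Proof.
exact: isoD_bij (assoc_bij (phi := cdgId A) (psi := cdgId A) (chi := cdgId A)
  (fun a => erefl) M N P).
Qed.

Lemma isoD_lunit M : isoD (regMod A ⊗ M) M.
Proof. exact: isoD_bij (lunit_bij M). Qed.

Lemma isoD_runit M : isoD (M ⊗ regMod A) M.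
Proof. exact: isoD_bij (runit_bij M). Qed.

(** Both modules are K-flat, so that the plain tensor product represents the derived one. *)
Definition inverse_pair M N : Prop :=
  [/\ Kflat M, Kflat N & isoD (M ⊗ N) (regMod A)].

Lemma inverse_pair_sym M N : inverse_pair M N -> inverse_pair N M.
Proof. by case=> kM kN e; split=> //; exact: isoD_trans (isoD_tsym _ _) e. Qed.

Lemma inverse_pair_isoD M N M' : inverse_pair M N -> Kflat M' -> isoD M M' ->
  inverse_pair M' N.
Proof.
case=> kM kN e kM' f; split=> //; apply: isoD_trans e.
by apply: isoD_tensl => //; exact: isoD_sym.
Qed.

Lemma inverse_pair_tens M N M' N' : inverse_pair M N -> inverse_pair M' N' ->
  inverse_pair (M ⊗ M') (N ⊗ N').
Proof.
case=> kM kN e [kM' kN' e']; split; [exact: Kflat_tens | exact: Kflat_tens |].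
apply: isoD_trans (isoD_assoc _ _ _) _; apply: isoD_trans e'.
apply: isoD_tensl => //; apply: isoD_trans (isoD_tsym _ _) _.
apply: isoD_trans (isoD_assoc _ _ _) _.
apply: isoD_trans (isoD_lunit _); apply: isoD_tensl => //.
exact: isoD_trans (isoD_tsym _ _) e.
Qed.

Lemma tilting_inverse_pair P M : tilting P -> Kflat M -> isoD M P ->
  exists N, inverse_pair M N.
Proof.
case=> Q [N [f [kN _ e]]] kM eM; exists N; split=> //.
by apply: isoD_trans (isoD_sym e); exact: isoD_tensl.
Qed.

Lemma inverse_pair_tilting M N : inverse_pair M N -> tilting M.
Proof.
case=> kM kN e; exists N, N, (dgId N).
by split; [exact: kN | exact: qis_id | exact: isoD_sym].
Qed.

Lemma inverse_pair_qis M N : inverse_pair M N -> exists f : dgHom (regMod A) (M ⊗ N), qis f.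
Proof. by case=> _ _ /isoD_sym/isoD_reg. Qed.

(* This follows from a zigzag of quasi-isomorphisms between K-flat modules; a
   bare isomorphism in D(A) gives it directly only for K-flat L and B = A. *)
Definition tens_equiv M N : Prop :=
  forall (B : cdgRing) (phi : cdgHom A B) (L : dgMod B),
    isoD (tensorMod phi L M) (tensorMod phi L N).

Lemma tens_equiv_sym M N : tens_equiv M N -> tens_equiv N M.
Proof. by move=> e B phi L; exact: isoD_sym. Qed.

Lemma tens_equiv_trans M N P : tens_equiv M N -> tens_equiv N P -> tens_equiv M P.
Proof. by move=> e f B phi L; exact: isoD_trans (e _ _ _) (f _ _ _). Qed.

Lemma qis_tens_equiv M N (f : dgHom M N) : Kflat M -> Kflat N -> qis f -> tens_equiv M N.
Proof. by move=> kM kN qf B phi L; apply: isoD_qis; exact: (Kflat_qis2 phi L kM kN qf). Qed.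

Lemma bij_tens_equiv M N (f : dgHom M N) : Kflat N -> bijective f -> tens_equiv M N.
Proof.
by move=> kN bf; apply: (qis_tens_equiv _ kN (qis_bij bf)); exact: Kflat_bij bf kN.
Qed.

Lemma reg_tens_equiv M N P : Kflat P -> inverse_pair M N -> tens_equiv P (M ⊗ N ⊗ P).
Proof.
move=> kP ip; have [kM kN _] := ip; have [f qf] := inverse_pair_qis ip.
apply: (@tens_equiv_trans _ (regMod A ⊗ P)).
  by apply: tens_equiv_sym; apply: (bij_tens_equiv kP (lunit_bij P)).
apply: (qis_tens_equiv _ _ (Kflat_qis (cdgId A) kP qf)).
  by apply: Kflat_tens => //; exact: Kflat_reg.
by apply: Kflat_tens => //; exact: Kflat_tens.
Qed.

Lemma inverse_pair_tens_equiv M N M' : inverse_pair M N -> Kflat M' -> isoD M M' ->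
  tens_equiv M M'.
Proof.
move=> ip kM' e; have [kM kN _] := ip.
apply: tens_equiv_trans (tens_equiv_sym (reg_tens_equiv kM' ip)).
apply: tens_equiv_trans (reg_tens_equiv kM (inverse_pair_isoD ip kM' e)) _.
have kT := Kflat_tens (Kflat_tens kM kN) kM'.
have k1 := Kflat_tens kM (Kflat_tens kN kM').
have k2 := Kflat_tens kM (Kflat_tens kM' kN).
apply: (@tens_equiv_trans _ (M ⊗ (M' ⊗ N))).
  apply: (bij_tens_equiv _ (tsym_bij (M' ⊗ N) M)); exact: k2.
apply: (@tens_equiv_trans _ (M ⊗ (N ⊗ M'))).
  apply: (qis_tens_equiv k2 k1 (Kflat_qis_sym kM (qis_bij (tsym_bij M' N)))).
exact: (bij_tens_equiv kT (assoc_bij (phi := cdgId A) (psi := cdgId A) (chi := cdgId A)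
  (fun a => erefl) M N M')).
Qed.

(** It turns the relation [dtensor] into one class: every K-flat resolution of P is isomorphic to M
    in D(A), hence equivalent to it under tensoring with any L. *)
Lemma dtensor_isoclass (B : cdgRing) (phi : cdgHom A B) (L : dgMod B) P M N :
  inverse_pair M N -> isoD M P -> dtensor phi L P = isoclass (tensorMod phi L M).
Proof.
move=> ip e; apply/funext => T; apply/propext; split.
  case=> P' [f [kP' qf h]]; apply: isoD_trans h _.
  apply: isoD_sym; apply: (inverse_pair_tens_equiv ip kP').
  exact: isoD_trans e (isoD_sym (isoD_qis qf)).
move=> h; have [P' [f [kP' qf]]] := Kflat_resolution P.
exists P', f; split=> //; apply: isoD_trans h _.
apply: (inverse_pair_tens_equiv ip kP').
exact: isoD_trans e (isoD_sym (isoD_qis qf)).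
Qed.

End Calculus.

(** * Base change of inverse pairs *)

Section BaseChange.
Variables (A B : cdgRing) (phi : cdgHom A B).

Definition bc (M : dgMod A) : dgMod B := tensorMod phi (regMod B) M.

Let b (x : regMod B) (a : regMod A) : regMod B := (x : B) * phi a.

Lemma bc_reg_dgbal : dgbal phi b.
Proof.
split.
- split=> [a x y|x a c|i j a x c da dx]; rewrite /b.
  + exact: mulrBl.
  + by rewrite rmorphB; exact: mulrBr.
  rewrite [phi (a *: c)](rmorphM phi a c) mulrA (cdg_comm (deg_phi phi da) dx).
  by rewrite mulrzAl.
- by move=> c x a; rewrite /b /= -mulrA.
- by move=> i j x a dx da; exact: cdg_degM dx (deg_phi phi da).
by move=> i j x a dx da; rewrite /b /= (cdg_leibniz _ dx) -cdgh_diff.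
Qed.

Definition bc_reg_hom : dgHom (bc (regMod A)) (regMod B) := tens_hom bc_reg_dgbal.

Lemma bc_reg_homE x a : bc_reg_hom (tens phi (x : regMod B) (a : regMod A)) = (x : B) * phi a.
Proof. exact: tens_homE. Qed.

Lemma bc_reg_bij : bijective bc_reg_hom.
Proof.
exists (fun x => tens phi (x : regMod B) (1 : regMod A)) => x; last first.
  by rewrite bc_reg_homE rmorph1 mulr1.
move: x; apply: (@tensor_ext _ _ phi (regMod B) (regMod A) _
  (fun x => tens phi (bc_reg_hom x) (1 : regMod A)) id) => [x y|//|i j x a dx da].
  by rewrite raddfB tensBl'.
rewrite bc_reg_homE; have {2}-> : a = (a : A) *: (1 : regMod A) by exact/esym/mulr1.
rewrite (tensZ phi _ da dx) -tensMzl; congr (tens phi _ _).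
by rewrite /GRing.scale /= (cdg_comm dx (deg_phi phi da)) mulrC mulz_sgsg.
Qed.

Lemma isoD_bc_reg : isoD (bc (regMod A)) (regMod B).
Proof. exact: isoD_bij bc_reg_bij. Qed.

Lemma isoD_bc_tens (M N : dgMod A) : Kflat N -> isoD (bc M ⊗ bc N) (bc (M ⊗ N)).
Proof.
move=> kN; apply: isoD_trans (isoD_bij (assoc_bij (phi := phi) (psi := cdgId B)
  (chi := phi) (fun a => erefl) (bc M) (regMod B) N)) _.
apply: isoD_trans (isoD_tensl phi kN (isoD_runit (bc M))) _.
apply: isoD_sym; exact: (isoD_bij (assoc_bij (phi := cdgId A) (psi := phi)
  (chi := phi) (fun a => erefl) (regMod B) M N)).
Qed.

Lemma tens_equiv_bc (M N : dgMod A) : tens_equiv M N -> isoD (bc M) (bc N).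
Proof. by move=> e; exact: e. Qed.

Lemma inverse_pair_bc_reg (M N : dgMod A) : inverse_pair M N ->
  isoD (bc (M ⊗ N)) (regMod B).
Proof.
move=> ip; have [kM kN _] := ip; have [f qf] := inverse_pair_qis ip.
apply: isoD_trans isoD_bc_reg; apply: tens_equiv_bc; apply: tens_equiv_sym.
by apply: (qis_tens_equiv _ _ qf); [exact: Kflat_reg | exact: Kflat_tens].
Qed.

Lemma inverse_pair_bc (M N : dgMod A) : inverse_pair M N -> inverse_pair (bc M) (bc N).
Proof.
move=> ip; have [kM kN _] := ip; split; [exact: Kflat_bc | exact: Kflat_bc |].
by apply: isoD_trans (isoD_bc_tens M kN) _; exact: inverse_pair_bc_reg.
Qed.

End BaseChange.

(** * From inverse pairs to Picard groups *)

Section DPicAssembly.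
Variable A : cdgRing.

Lemma DPic_eq (x y : DPic A) : sval x = sval y -> x = y.
Proof. by case: x y => C hC [D hD] /= e; subst D; congr exist; exact: Prop_irrelevance. Qed.

Lemma DPic_rep (x : DPic A) : exists M N, inverse_pair M N /\ sval x = isoclass M.
Proof.
case: x => C /= [P tP ->]; have [M [f [kM qf]]] := Kflat_resolution P.
have [N ip] := tilting_inverse_pair tP kM (isoD_qis qf).
by exists M, N; split=> //; apply: isoclass_eq; apply: isoD_sym; exact: isoD_qis qf.
Qed.

Definition DPic_of (M N : dgMod A) (ip : inverse_pair M N) : DPic A :=
  exist _ (isoclass M) (ex_intro2 _ _ M (inverse_pair_tilting ip) erefl).

Lemma isoclass_inj (M N : dgMod A) : isoclass M = isoclass N -> isoD M N.
Proof. by move=> e; have := isoD_refl M; rewrite -/(isoclass M M) e. Qed.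

Lemma dpic_mul_of (x y : DPic A) (M N M' N' : dgMod A) (ip : inverse_pair M N)
    (ip' : inverse_pair M' N') : sval x = isoclass M -> sval y = isoclass M' ->
  dpic_mul x y (DPic_of (inverse_pair_tens ip ip')).
Proof.
move=> ex ey P Q; rewrite ex ey => hP hQ; have [kM' _ _] := ip'.
rewrite (dtensor_isoclass _ P ip' (isoD_sym hQ)); apply: isoclass_eq.
exact: isoD_tensl.
Qed.

End DPicAssembly.

Section Criterion.
Variables (A B : cdgRing) (phi : cdgHom A B).
Hypothesis bc_refl : forall M N : dgMod A, inverse_pair M N ->
  isoD (bc phi M) (regMod B) -> isoD M (regMod A).
Hypothesis bc_lift : forall M N : dgMod B, inverse_pair M N ->
  exists M' N' : dgMod A, inverse_pair M' N' /\ isoD (bc phi M') M.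

Lemma dpic_bijection : exists f : DPic A -> DPic B,
  [/\ forall x, dpic_map phi x (f x),
      forall x y, exists2 z, dpic_mul x y z & dpic_mul (f x) (f y) (f z)
    & bijective f].
Proof.
have ex (x : DPic A) : exists y : DPic B, forall M N, inverse_pair M N ->
    sval x = isoclass M -> sval y = isoclass (bc phi M).
  have [M [N [ip e]]] := DPic_rep x; exists (DPic_of (inverse_pair_bc phi ip)).
  (* B is not assumed K-flat over A, so an isomorphism in D(A) passes to base changes only through
     the zigzag behind [inverse_pair_tens_equiv]. *)
  move=> M' N' ip'; rewrite e => /isoclass_inj e'; apply: isoclass_eq.
  by apply: tens_equiv_bc; case: (ip') => kM' _ _; exact: (inverse_pair_tens_equiv ip kM').
have [f fP] := choice ex; exists f; split.
- move=> x P hP; have [M [N [ip e]]] := DPic_rep x.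
  rewrite (fP x M N ip e); apply: (dtensor_isoclass _ _ ip).
  by apply: isoD_sym; move: hP; rewrite e.
- move=> x y; have [M [N [ip e]]] := DPic_rep x; have [M' [N' [ip' e']]] := DPic_rep y.
  exists (DPic_of (inverse_pair_tens ip ip')); first exact: dpic_mul_of.
  move=> P Q hP hQ.
  have := dpic_mul_of (inverse_pair_bc phi ip) (inverse_pair_bc phi ip')
    (fP x M N ip e) (fP y M' N' ip' e') hP hQ.
  move=> ->; rewrite (fP (DPic_of (inverse_pair_tens ip ip')) _ _ (inverse_pair_tens ip ip') erefl).
  by apply: isoclass_eq; case: ip' => kM' _ _; exact: isoD_bc_tens.
have fI : injective f.
  move=> x y exy; have [M [N [ip e]]] := DPic_rep x; have [M' [N' [ip' e']]] := DPic_rep y.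
  have [kM kN _] := ip; have [kM' kN' i'] := ip'.
  have eb : isoD (bc phi M) (bc phi M').
    by apply: isoclass_inj; rewrite -(fP x M N ip e) -(fP y M' N' ip' e') exy.
  have ipN := inverse_pair_tens ip (inverse_pair_sym ip').
  have eN : isoD (M ⊗ N') (regMod A).
    apply: bc_refl ipN _.
    apply: isoD_trans (isoD_sym (isoD_bc_tens phi M kN')) _.
    apply: isoD_trans (isoD_tensl _ (Kflat_bc (phi := phi) kN') eb) _.
    by case: (inverse_pair_bc phi ip').
  apply: DPic_eq; rewrite e e'; apply: isoclass_eq.
  apply: isoD_trans (isoD_sym (isoD_runit M)) _.
  apply: isoD_trans (isoD_tensr kM (isoD_sym (isoD_trans (isoD_tsym _ _) i'))) _.
  apply: isoD_trans (isoD_assoc _ _ _) _.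
  exact: isoD_trans (isoD_tensl _ kM' eN) (isoD_lunit _).
have fS y : exists x, f x = y.
  have [M [N [ip e]]] := DPic_rep y; have [M' [N' [ip' e']]] := bc_lift ip.
  exists (DPic_of ip'); apply: DPic_eq; rewrite (fP (DPic_of ip') _ _ ip' erefl) e.
  exact: isoclass_eq.
have [g gK] := choice fS; exists g => // x.
by apply: fI; rewrite gK.
Qed.

End Criterion.

(** * Detecting A after reduction to its cohomology in degree 0 *)

(** T is exchanged for a semifree module with generators in degrees at most n, each of which
    contributes a shift of M. *)
Lemma tens_bnd (A : cdgRing) (M T : dgMod A) m n : Kflat T -> bnd n T -> bnd m M ->
  bnd (m + n) (M ⊗ T).
Proof.
move=> kT bT bM; have [S [rank [f [rk qf dg]]]] := semifree_resolution_bnd bT.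
apply: (isoD_bnd (isoD_qis (Kflat_qis2 (cdgId A) M (sf_Kflat rk) kT qf))).
apply: (isoD_bnd (isoD_tsym (sfMod S) M)). exact: (@sf_bnd _ S rank M rk m n dg bM).
Qed.

Lemma reg_bnd (A : cdgRing) : bnd 0 (regMod A).
Proof.
by move=> i i0 z dz _; exists 0; rewrite raddf0; exact: (cdg_npos (a := z) i0 dz).
Qed.

(** * Invertible modules are bounded above *)

Section InverseBounded.
Variables (A : cdgRing) (S : sfData A) (rank : sfX S -> nat).
Hypothesis rk : ranked rank.
Local Notation X := (sfX S).
Local Notation dg := (@sfdg _ S).

Let closed (Z : X -> Prop) := forall x y, Z x -> sfD x y != 0 -> Z y.
(** A bound on the degrees of all generators reachable from x through the differential. Finite rows
    and descending ranks give one for each x, hence for finitely many x, but no common bound for all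
    of them. *)
Let below n (x : X) : Prop := exists Z, [/\ closed Z, Z x & forall y, Z y -> dg y <= n].

Let below_le m n x : m <= n -> below m x -> below n x.
Proof.
by move=> mn [Z [cZ Zx h]]; exists Z; split=> // y /h; lia.
Qed.

Let below_closed n : closed (below n).
Proof. by move=> x y [Z [cZ Zx h]] xy; exists Z; split=> //; exact: cZ xy. Qed.

Let below_seq (s : seq X) : (forall x, x \in s -> exists n, below n x) ->
  exists n, forall x, x \in s -> below n x.
Proof.
elim: s => [|x s IH] h; first by exists 0.
have [|n hn] := IH; first by move=> y ys; apply: h; rewrite inE ys orbT.
have [m hm] := h x (mem_head _ _).
exists (n + `|m| + `|n|)%R => y; rewrite inE => /predU1P[->|/hn hy].
  by apply: below_le hm; lia.
by apply: below_le hy; lia.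
Qed.

Let below_ex x : exists n, below n x.
Proof.
elim/ltn_ind: {x}(rank x) {-2}x (erefl (rank x)) => k IH x xk.
have [|n hn] := @below_seq [seq y <- fsupp (sfD x) | sfD x y != 0].
  move=> y; rewrite mem_filter => /andP[/rk yx _].
  by apply: (IH (rank y)); rewrite -?xk.
exists (n + `|n| + `|dg x|), (fun y => y = x \/ below n y); split=> [y z|//|y].
- case=> [->|hy] yz; right; last exact: below_closed yz.
  apply: hn; rewrite mem_filter yz.
  by apply: contraNT yz => /fsupp_out ->.
- by left.
case=> [->|[Z [_ Zy /(_ y Zy)]]]; lia.
Qed.

(* z in S (x) Q is a finite sum, so for w in S the cocycle z (x) w of
   S (x) (Q (x) S) lives over finitely many generators of S. *)
Lemma inverse_pair_sf_bnd (Q : dgMod A) : inverse_pair (sfMod S) Q ->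
  exists n, bnd n (sfMod S).
Proof.
move=> ip; have [kS kQ eSQ] := ip; have [ze qz] := inverse_pair_qis ip.
set z := ze (1 : regMod A).
have dz : deg (dgm (sfMod S ⊗ Q)) 0 z by apply: dgh_deg; exact: cdg_deg1.
have [s [us hs es]] := kap_decomp z.
have [n hn] := @below_seq s (fun x _ => below_ex x).
exists n => i ni w dw zw.
pose Y := Q ⊗ sfMod S.
have bY : bnd 0 Y.
  apply: isoD_bnd (@reg_bnd A); apply: isoD_sym.
  exact: isoD_trans (isoD_tsym _ _) eSQ.
have qF := Kflat_qis (cdgId A) kS qz.
have [qi _] := iffLR (qisP _) qF i.
pose as_ := assoc (phi := cdgId A) (psi := cdgId A) (chi := cdgId A)
  (fun a => erefl) (sfMod S) Q (sfMod S).
have [ainv aK Ka] : bijective as_ by exact: assoc_bij.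
pose v : sfMod S ⊗ Y :=
  \sum_(x <- s) tens (cdgId A) (bas x) (tens (cdgId A) (kap x z) w : Y).
have av : as_ v = tens (cdgId A) z w.
  rewrite /v (zmorS (dgh_zmod as_)).
  rewrite [in RHS]es (zmorS (f := fun t : sfMod S ⊗ Q => tens (cdgId A) t w)); last first.
    by move=> t t'; exact: tensBl'.
  by apply: eq_bigr => x _; exact: assocE.
have dv : deg (dgm (sfMod S ⊗ Y)) i v.
  apply: (can_inj aK); rewrite dgh_gr av.
  by have := deg_tens (cdgId A) dz dw; rewrite add0r.
have zz : df (sfMod S ⊗ Q) z = 0 by rewrite -dgh_diff [diff _ _]diff1 raddf0.
have zv : df (sfMod S ⊗ Y) v = 0.
  by apply: (can_inj aK); rewrite dgh_diff av df_tens zz zw tens0l !raddf0 addr0.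
(* The coefficients at generators of degree at most n have positive degree i - dg x, where Y has no
   cohomology, being isomorphic to A. *)
have [|||||u eu] := @sf_exact A S rank Y rk (below n) i v.
- exact: below_closed.
- by move=> x [Z [_ Zx /(_ x Zx) h]]; apply: bY; lia.
- move=> x; rewrite /v (zmorS (kapB _)) => nz; apply: hn.
  apply: contraNT nz => xs; rewrite big_seq big1 // => y ys.
  by rewrite kap_bas; case: eqP => // xy; rewrite xy ys in xs.
- exact: dv.
- exact: zv.
have d1 : deg (dgm (regMod A)) 0 1 := cdg_deg1 A.
(* z (x) w is a coboundary and the image of 1 (x) w under a quasi-isomorphism, so 1 (x) w is a
   coboundary too. *)
have [|||x ex] := qi (tens (cdgId A) (1 : regMod A) w) _ _ (as_ u).
- by have := deg_tens (cdgId A) d1 dw; rewrite add0r.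
- by rewrite df_tens [diff _ _]diff1 zw tens0l raddf0 addr0.
- by rewrite tmapE -dgh_diff -eu av.
exists (lunit _ x); rewrite -dgh_diff -ex lunitE.
by rewrite scale1r.
Qed.

End InverseBounded.

Lemma inverse_pair_bnd (A : cdgRing) (M N : dgMod A) : inverse_pair M N ->
  exists n, bnd n M.
Proof.
move=> ip; have [S [rank [f [rk qf]]]] := semifree_resolution M.
have ipS := inverse_pair_isoD ip (sf_Kflat rk) (isoD_sym (isoD_qis qf)).
have [n bS] := inverse_pair_sf_bnd rk ipS.
by exists n; exact: isoD_bnd (isoD_qis qf) bS.
Qed.

Lemma acyclic_qis (A : cdgRing) (M N : dgMod A) (f : dgHom M N) :
  acyclic M -> acyclic N -> qis f.
Proof.
move=> /acyclicP aM /acyclicP aN; apply/qisP => i; split=> [z dz zz _ _|w dw zw].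
  exact: aM i z dz zz.
have [y ->] := aN i w dw zw; exists 0, y.
by rewrite !raddf0 add0r; split=> //; exact: deg0.
Qed.

Lemma Kflat_fib (A : cdgRing) (M N : dgMod A) (f : dgHom M N) :
  Kflat M -> Kflat N -> Kflat (fib f).
Proof.
move=> kM kN L aL; apply: (isoD_acyclic (isoD_tsym (fib f) L)).
apply/(qis_acyclic (qis_bij (tfib_bij (cdgId A) L f)))/fib_acyclic/acyclic_qis.
  by apply: (isoD_acyclic (isoD_tsym L M)); exact: kM.
by apply: (isoD_acyclic (isoD_tsym L N)); exact: kN.
Qed.

(** * Nakayama-type descent along A -> H^0(A) *)

Section Reduction.
Variable A : cdgRing.
Local Notation phi := (toH0 A).
Local Notation B := (H0 A).
Local Notation rB := (restr phi (regMod B)).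

Lemma h0_map_eq0 (a : A) : deg (cdg A) 0 a -> h0_map a = 0 ->
  exists2 y, deg (cdg A) (- 1) y & a = diff (cdg A) y.
Proof.
move=> da /eqP; rewrite -[X in _ == X](raddf0 (\pi_(coh (cdg A) 0))) /h0_map.
rewrite -Quotient.idealrBE subr0 => /asboolP[y dy e].
by exists y => //; rewrite -[LHS]da; exact: e.
Qed.

Lemma h0_map_surj (b : H0t A) : exists a, [/\ deg (cdg A) 0 a, diff (cdg A) a = 0
  & h0_map a = b].
Proof.
exists (val (repr b)); have [da za] := asboolP _ (valP (repr b)); split=> //.
rewrite -[RHS]reprK /h0_map; congr (\pi_(coh (cdg A) 0) _).
by apply: val_inj.
Qed.

Let pr (a : regMod A) : rB := phi a.

Lemma pr_linear : linear pr.
Proof. by move=> a x y; rewrite /pr rmorphD rmorphM. Qed.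

Definition h0_proj : dgHom (regMod A) rB :=
  @DGHom A (regMod A) rB pr pr_linear (cdgh_gr phi) (cdgh_diff phi).

Lemma h0_proj_inj_at i : 0 <= i -> inj_at i h0_proj.
Proof.
move=> i0 z dz zz y; rewrite /= /pr /conc_diff => e.
have [iz|nz] := eqVneq i 0; last first.
  by exists 0; rewrite raddf0; apply: (cdg_npos (i := i) (a := z)) => //; lia.
rewrite iz in dz; have [x _ ex] := h0_map_eq0 dz e.
by exists x.
Qed.

Lemma h0_proj_surj_at i : - 1 <= i -> surj_at i h0_proj.
Proof.
move=> i1 w dw _; case: (conc_deg dw) => [i0|->]; last first.
  by exists 0, 0; rewrite !raddf0 add0r; split=> //; exact: deg0.
have [a [da za e]] := h0_map_surj w; exists a, 0.
by rewrite raddf0 addr0 i0; split=> //; rewrite -e.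
Qed.

(** The critical degree is 0: there A -> H is injective on cohomology, and surjectivity in degree -1
    holds because H vanishes there. *)
Lemma h0_proj_bnd : bnd (- 1) (fib h0_proj).
Proof.
move=> i i1; apply/fib_exact_at; split; first by apply: h0_proj_inj_at; lia.
by apply: h0_proj_surj_at; lia.
Qed.

Lemma trestr_exact_at (T : dgMod A) i : exact_at i (bc phi T) <-> exact_at i (rB ⊗ T).
Proof.
by rewrite (qis_exact_at i (qis_bij (trestr_bij phi (regMod B) T))).
Qed.

Section Top.
Variables (T : dgMod A) (n : int).
Hypotheses (kT : Kflat T) (bT : bnd n T).
Let j := tmap (cdgId A) h0_proj (dgId T).

Lemma reduce_top i : n <= i -> inj_at i j /\ surj_at (i - 1) j.
Proof.
move=> ni; apply/fib_exact_at.
apply/(qis_exact_at i (qis_bij (tfib_bij (cdgId A) T h0_proj))).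
by apply: (tens_bnd kT bT h0_proj_bnd); lia.
Qed.

Lemma reduce_bnd : exact_at n (bc phi T) -> bnd (n - 1) T.
Proof.
move=> ex i ni; have [{}ni|ni'] := boolP (n < i); first exact: bT.
have -> : i = n by lia.
apply/(qis_exact_at n (qis_bij (lunit_bij T))) => z dz zz.
have /trestr_exact_at ex' := ex.
have [|y e] := ex' (j z) (dgh_deg j dz); first by rewrite -dgh_diff zz raddf0.
by have [ji _] := reduce_top (lexx n); exact: ji e.
Qed.

End Top.

Lemma reduce_bnd_iter (T : dgMod A) m n : Kflat T -> bnd n T -> bnd m (bc phi T) -> bnd m T.
Proof.
move=> kT bT bm.
have h (k : nat) : bnd (m + k%:Z) T -> bnd m T.
  elim: k => [|k IH] bk; first by rewrite addr0 in bk.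
  apply: IH; apply: bnd_le (reduce_bnd kT bk (bm _ _)); lia.
apply: (h `|n - m|%N); apply: bnd_le bT; lia.
Qed.

Lemma reduce_acyclic (T : dgMod A) n : Kflat T -> bnd n T -> acyclic (bc phi T) -> acyclic T.
Proof.
move=> kT bT aB; apply/acyclicP => i.
have : bnd (i - 1) T by apply: reduce_bnd_iter kT bT _; exact: acyclic_bnd.
by apply; lia.
Qed.

Lemma reduce_qis (M N : dgMod A) (g : dgHom M N) m n : Kflat M -> Kflat N ->
  bnd m M -> bnd n N -> qis (tmap phi (dgId (regMod B)) g) -> qis g.
Proof.
move=> kM kN bM bN qg; apply/fib_acyclic.
(* H^i of the fiber lies between H^{i-1}(N) and H^i(M), whence the extra 1; the absolute values give
   a common bound. *)
apply: (@reduce_acyclic _ (`|m| + `|n| + 1)); first exact: Kflat_fib.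
  move=> i ni; apply/fib_exact_at; split=> [z dz zz _ _|w dw zw].
    by apply: (bM i) => //; lia.
  have [|y ->] := bN (i - 1) _ w dw zw; first by lia.
  by exists 0, y; rewrite !raddf0 add0r; split=> //; exact: deg0.
apply/acyclicP => i; apply/trestr_exact_at; apply: (isoD_exact_at (isoD_tsym (fib g) rB)).
move: i; apply/acyclicP/(qis_acyclic (qis_bij (tfib_bij (cdgId A) rB g)))/fib_acyclic.
apply/(qis_square (qis_bij (tsym_bij _ _)) (qis_bij (tsym_bij _ _))
  (tsym_nat (dgId rB) g)).
have -> : dgId rB = restrHom phi (dgId (regMod B)) by exact: dgHom_eq.
apply/(qis_square (f' := restrHom phi (tmap phi (dgId (regMod B)) g))
  (qis_bij (trestr_bij phi _ _)) (qis_bij (trestr_bij phi _ _))) => [x|].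
  by rewrite trestr_nat.
exact/restr_qis.
Qed.

Lemma bc_reflects_reg (T : dgMod A) n : Kflat T -> bnd n T ->
  isoD (bc phi T) (regMod B) -> isoD T (regMod A).
Proof.
move=> kT bT e.
have b0 : bnd 0 T.
  by apply: (reduce_bnd_iter kT bT); apply: isoD_bnd (isoD_sym e) (@reg_bnd B).
have [f qf] := isoD_reg (isoD_sym e).
have [ainv aK Ka] := trestr_bij phi (regMod B) T.
set w := f (1 : regMod B).
have dw : deg (dgm (bc phi T)) 0 w by apply: dgh_deg; exact: cdg_deg1.
have zw : df (bc phi T) w = 0 by rewrite -dgh_diff [diff _ _]diff1 raddf0.
pose t := ainv (w : restr phi (bc phi T)).
have dt : deg (dgm (rB ⊗ T)) 0 t by apply: (can_inj aK); rewrite dgh_gr Ka; exact: dw.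
have zt : df (rB ⊗ T) t = 0 by apply: (can_inj aK); rewrite dgh_diff Ka raddf0; exact: zw.
(* Index 1 gives surjectivity in degree 0, so the generator of the reduction comes from a cocycle of
   A (x) T, that is, of T. *)
have [_ js] := @reduce_top T 0 kT b0 1 isT.
have [s [y [ds zs es]]] := js t dt zt.
pose p := lunit T s.
have dp : deg (dgm T) 0 p by exact: dgh_deg.
have zp : df T p = 0 by rewrite -dgh_diff zs raddf0.
have sE : s = tens (cdgId A) (1 : regMod A) p by exact/esym/lunit_can.
have [y' ew] : exists y', w = tens phi (1 : regMod B) p + df (bc phi T) y'.
  exists (trestr phi (regMod B) T y).
  rewrite -[LHS]Ka -/t es (zmorD (dgh_zmod _)) sE tmapE dgh_diff; congr (_ + _).
  rewrite trestrE; congr (tens phi _ _); exact: (rmorph1 phi).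
pose g := regHom dp zp.
have d11 : deg (dgm (bc phi (regMod A))) 0 (tens phi (1 : regMod B) (1 : regMod A)).
  by apply: (deg_tens phi (i := 0) (j := 0)); exact: cdg_deg1.
have z11 : df (bc phi (regMod A)) (tens phi (1 : regMod B) (1 : regMod A)) = 0.
  by rewrite df_tens [df (regMod B) _]diff1 [df (regMod A) _]diff1 tens0l raddf0 addr0.
pose be := regHom d11 z11.
have qbe : qis be.
  apply: (@qis_compl _ _ _ _ be (bc_reg_hom phi)); last exact: qis_bij (bc_reg_bij phi).
  have -> : dgComp be (bc_reg_hom phi) = dgId (regMod B); last exact: qis_id.
  apply: dgHom_eq => b; rewrite dgCompE regHomE dghZ bc_reg_homE rmorph1 mulr1.
  exact: mulr1.
(* On the free module H the reduction of g sends 1 to 1 (x) p, which differs from w = f 1 by the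
   coboundary of y'. For a cocycle b the difference at b is then the coboundary of b y' up to the
   twist. *)
have qg : qis (tmap phi (dgId (regMod B)) g).
  apply: (@qis_compr _ _ _ _ be) => //; apply: qis_homologous qf => b zb.
  exists (- (tw (cdg B) (b : B) *: y')); rewrite dgCompE regHomE dghZ tmapE.
  have -> : f b = (b : B) *: w.
    by rewrite -dghZ; congr (f _); exact: (esym (mulr1 (b : B))).
  rewrite ew scalerDr (zmorN (dfB (dgm (bc phi T)))) leibniz diff_tw.
  rewrite [diff _ b]zb raddf0 oppr0 scale0r add0r tw_tw addrK.
  by congr (_ *: tens phi _ _); rewrite regHomE scale1r.
apply: isoD_sym; apply: (@isoD_qis _ _ _ g).
exact: reduce_qis (@Kflat_reg A) kT (@reg_bnd A) b0 qg.
Qed.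

End Reduction.

Lemma bc_reflects_inverse_pair (A : cdgRing) (M N : dgMod A) : inverse_pair M N ->
  isoD (bc (toH0 A) M) (regMod (H0 A)) -> isoD M (regMod A).
Proof.
move=> ip; have [n bM] := inverse_pair_bnd ip; have [kM _ _] := ip.
exact: bc_reflects_reg kM bM.
Qed.

(** * Vanishing of the obstruction groups *)

Section ExtVanishing.
Variables (A : cdgRing) (S : sfData A) (rank : sfX S -> nat) (Q N : dgMod A).
Hypothesis rk : ranked rank.
Hypothesis ip : inverse_pair (sfMod S) Q.
Hypothesis N0 : exact_at 0 N.
Local Notation iA := (cdgId A).
Local Notation F := (sfMod S).

(** Tensoring on the left with an element of degree -1 is linear up to the twist, as a null-homotopy
    has to be. *)
Lemma tens_unit (L : dgMod A) (z : L) (a : A) (M : dgMod A) (v : M) : deg (dgm L) (- 1) z ->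
  tens iA z (a *: v) = tw (cdg A) a *: tens iA z v.
Proof.
move=> dz; move: a; apply: (@hom_ext _ (cdg A) _ (fun a => tens iA z (a *: v))
  (fun a => tw (cdg A) a *: tens iA z v)) => [x y|x y|i a da].
- by rewrite scalerBl raddfB.
- by rewrite raddfB /= scalerBl.
rewrite (tensZ iA v da dz) (twE da) -scalerMzl scale_tens.
by congr (_ *~ _); rewrite mulrN1 sgN.
Qed.

Lemma ext_exact : exact_at 0 (F ⊗ N ⊗ Q).
Proof.
have [kF kQ _] := ip; have [f qf] := inverse_pair_qis ip.
apply: isoD_exact_at N0; apply: isoD_sym.
apply: isoD_trans (isoD_tensl _ kQ (isoD_tsym _ _)) _.
apply: isoD_trans (isoD_sym (isoD_assoc _ _ _)) _.
apply: isoD_trans (isoD_runit N); apply: isoD_sym.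
exact: isoD_qis (Kflat_qis2 iA N (@Kflat_reg A) (Kflat_tens kF kQ) qf).
Qed.

(* Let z be the class of 1 in F (x) Q and z' its image in Q (x) F. The maps
   v |-> z (x) v and v |-> v (x) z' from F to F (x) Q (x) F are both
   quasi-isomorphisms, so the second one factors through the first one up to
   homotopy. Now u (x) Q (x) F sends z (x) v to a coboundary (x) v, because
   F (x) N (x) Q is isomorphic to N; hence u followed by the
   quasi-isomorphism w |-> w (x) z' is null-homotopic, and so is u. *)
Lemma ext_vanish (u : dgHom F (F ⊗ N)) : nullh u.
Proof.
have [kF kQ _] := ip; have [f qf] := inverse_pair_qis ip.
set z := f (1 : regMod A).
have dz : deg (dgm (F ⊗ Q)) 0 z by apply: dgh_deg; exact: cdg_deg1.
have zz : df (F ⊗ Q) z = 0 by rewrite -dgh_diff [diff _ _]diff1 raddf0.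
pose z' := tsym F Q z.
pose as_ (L : dgMod A) := assoc (phi := iA) (psi := iA) (chi := iA) (fun a => erefl) L Q F.
(* [L] ranges over all modules because it will also be F (x) N, with N arbitrary; K-flatness of A
   and of F (x) Q suffices. *)
have exb L : exists be : dgHom L (L ⊗ Q ⊗ F), qis be /\
    forall v, be v = as_ L (tens iA v z').
  have [r [rK Kr]] := dg_inverse (runit_bij L).
  exists (dgComp (dgComp (dgComp r (tmap iA (dgId L) f)) (tmap iA (dgId L) (tsym F Q))) (as_ L)).
  split; last first.
    move=> v; rewrite !dgCompE; congr (as_ L _).
    have -> : r v = tens iA v (1 : regMod A) by apply: (can_inj rK); rewrite Kr runit1.
    by rewrite !tmapE.
  apply: qis_comp; last by apply: qis_bij; exact: assoc_bij.
  apply: qis_comp; last first.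
    by apply: Kflat_qis2 (qis_bij (tsym_bij F Q)); exact: Kflat_tens.
  apply: qis_comp; first by apply: qis_bij; exists (runit L).
  by apply: Kflat_qis2 qf; [exact: Kflat_reg | exact: Kflat_tens].
have [be [qbe beE]] := exb F; have [be' [qbe' be'E]] := exb (F ⊗ N).
have [l [lK Kl]] := dg_inverse (lunit_bij F).
pose al := dgComp l (tmap iA f (dgId F)).
have alE v : al v = tens iA z v.
  rewrite /al dgCompE.
  have -> : l v = tens iA (1 : regMod A) v by apply: (can_inj lK); rewrite Kl lunitE scale1r.
  by rewrite tmapE.
have qal : qis al.
  by apply: qis_comp (Kflat_qis iA kF qf); apply: qis_bij; exists (lunit F).
pose U := tmap iA (tmap iA u (dgId Q)) (dgId F).
have nat0 t v : U (as_ F (tens iA v (t : Q ⊗ F))) = as_ (F ⊗ N) (tens iA (u v) t).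
  move: t; apply: (@tensor_ext _ _ iA Q F _
    (fun t => U (as_ F (tens iA v (t : Q ⊗ F))))
    (fun t => as_ (F ⊗ N) (tens iA (u v) (t : Q ⊗ F)))) => [x y|x y|i j q w _ _].
  - by rewrite (@tensBr _ _ iA F (Q ⊗ F)) !dgh_zmod.
  - by rewrite (@tensBr _ _ iA (F ⊗ N) (Q ⊗ F)) !dgh_zmod.
  by rewrite /as_ !assocE /U !tmapE.
have nat v : U (be v) = be' (u v) by rewrite beE be'E nat0.
have [ga nga] := Kproj_lift rk qal be.
have [||t et] := ext_exact (z := tmap iA u (dgId Q) z).
- exact: dgh_deg.
- by rewrite -dgh_diff zz raddf0.
have [t' dt' et'] := deg_cobound (dgh_deg (tmap iA u (dgId Q)) dz) et.
rewrite sub0r in dt'.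
have nUal : nullh (U \o al).
  exists (fun v => tens iA t' v); split.
  - by move=> x y; exact: raddfB.
  - by move=> a v; exact: tens_unit.
  - by move=> i v dv; rewrite addrC; exact: deg_tens.
  move=> v; rewrite /comp alE /U tmapE et' df_tens (twE dt') sgN sg1 mulrNz mulr1z.
  by rewrite tensNl subrK.
apply: (Kproj_null rk qbe').
apply: (@nullh_ext _ _ _ (fun v => U (be v - al (ga v)) + U (al (ga v)))).
  by move=> v; rewrite -(zmorD (dgh_zmod U)) subrK nat.
apply: nullhD; first exact: (nullh_compl U nga).
exact: (nullh_compr ga nUal).
Qed.

End ExtVanishing.

Section ConcentratedModule.
Variables (R : comPzRingType) (V : lmodType R) (e : int).

Definition cm_gr (i : int) (x : V) : V := if i == e then x else 0.
Definition cm_diff (x : V) : V := 0.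

Lemma cm_grB i : zmod_morphism (cm_gr i).
Proof. by move=> x y; rewrite /cm_gr; case: eqP => // _; rewrite subrr. Qed.

Lemma cm_gr_gr i j x : cm_gr i (cm_gr j x) = if i == j then cm_gr j x else 0.
Proof.
rewrite /cm_gr; case: (i =P j) => [->|ij]; first by case: (j == e).
case: (i =P e) => // ie; case: (j =P e) => // je; by case: ij; rewrite ie je.
Qed.

Lemma cm_gr_fin x : exists2 s : seq int, uniq s & x = \sum_(i <- s) cm_gr i x.
Proof. by exists [:: e] => //; rewrite big_seq1 /cm_gr eqxx. Qed.

Lemma cm_diffB : zmod_morphism cm_diff.
Proof. by move=> x y; rewrite /cm_diff subrr. Qed.

Lemma cm_diff_gr i x : cm_diff (cm_gr i x) = cm_gr (i + 1) (cm_diff x).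
Proof. by rewrite /cm_gr /cm_diff if_same. Qed.

Lemma cm_diff_diff x : cm_diff (cm_diff x) = 0. Proof. by []. Qed.

Definition cm_dg : dgGroup V := DGGroup cm_grB cm_gr_gr cm_gr_fin
  cm_diffB cm_diff_gr cm_diff_diff.

Lemma cm_deg i x : deg cm_dg i x -> i = e \/ x = 0.
Proof. by rewrite /deg /= /cm_gr; case: eqP => [|_]; [left | right]. Qed.

Lemma cm_degZ i j (a : concRing R) (x : V) :
  deg (cdg (concRing R)) i a -> deg cm_dg j x -> deg cm_dg (i + j) (a *: x).
Proof.
case/conc_deg=> [->|->]; last by rewrite scale0r /deg /= /cm_gr if_same.
by case/cm_deg=> [->|->]; rewrite ?scaler0 add0r /deg /= /cm_gr ?eqxx ?if_same.
Qed.

Lemma cm_leibniz i (a : concRing R) (x : V) : deg (cdg (concRing R)) i a ->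
  cm_diff (a *: x) = conc_diff a *: x + (a *: cm_diff x) *~ sg i.
Proof. by rewrite /cm_diff /conc_diff scale0r scaler0 mul0rz addr0. Qed.

Definition concMod : dgMod (concRing R) := @DGMod (concRing R) V cm_dg cm_degZ cm_leibniz.

End ConcentratedModule.

(** * Cohomology as a module over H^0(A) *)

Section CohomologyModule.
Variables (A : cdgRing) (M : dgMod A) (i : int).
Local Notation H := (coh (dgm M) i).
Local Notation piM := (\pi_(coh (dgm M) i)).

Lemma coh_scale_cocycle (a : Zgrp (cdg A) 0) (z : Zgrp (dgm M) i) :
  val a *: val z \in cocycle (dgm M) i.
Proof.
have [da za] := asboolP _ (valP a); have [dz zz] := asboolP _ (valP z).
apply/asboolP; split; first by have := dgm_degZ da dz; rewrite add0r.
by rewrite leibniz za zz scale0r scaler0 addr0.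
Qed.

Definition Zscale a z : Zgrp (dgm M) i := Zsub (coh_scale_cocycle a z).

Definition coh_scale (h : H0t A) (x : H) : H := piM (Zscale (repr h) (repr x)).

Lemma coh_scale_pi a z : coh_scale (\pi_(coh (cdg A) 0) a) (piM z) = piM (Zscale a z).
Proof.
rewrite /coh_scale.
have k1 (u v : Zgrp (cdg A) 0) w :
    \pi_(coh (cdg A) 0) u = \pi_(coh (cdg A) 0) v -> piM (Zscale u w) = piM (Zscale v w).
  move=> /pi0_eq/asboolP[b db e]; apply/eqP; rewrite -Quotient.idealrBE; apply/asboolP.
  have [dw zw] := asboolP _ (valP w); exists (b *: val w).
    by have := dgm_degZ db dw; rewrite sub0r addrC.
  by rewrite leibniz zw scaler0 addr0 -e /= scalerBl.
have k2 u v w : piM u = piM v -> piM (Zscale w u) = piM (Zscale w v).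
  move=> /eqP; rewrite -Quotient.idealrBE => /asboolP[y dy e].
  apply/eqP; rewrite -Quotient.idealrBE; apply/asboolP.
  have [dw zw] := asboolP _ (valP w); exists (val w *: y).
    by have := dgm_degZ dw dy; rewrite add0r.
  by rewrite leibniz zw scale0r add0r (twE dw) mulr1z -e /= scalerBr.
by rewrite (k1 _ a) ?reprK // (k2 _ z) ?reprK.
Qed.

Lemma coh_scaleA a b x : coh_scale a (coh_scale b x) = coh_scale (a * b) x.
Proof.
move: a b x; elim/quotW=> a; elim/quotW=> b; elim/quotW=> x.
have -> : (\pi_(coh (cdg A) 0) a : H0t A) * (\pi_(coh (cdg A) 0) b : H0t A)
    = \pi_(coh (cdg A) 0) (Zmul a b) by exact: h0_mul_pi.
rewrite (coh_scale_pi b x) (coh_scale_pi a) (coh_scale_pi (Zmul a b)).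
by congr piM; apply: val_inj; exact: scalerA.
Qed.

Lemma coh_scale1 : left_id 1 coh_scale.
Proof.
elim/quotW=> x; rewrite (coh_scale_pi (Zone A) x).
by congr piM; apply: val_inj; exact: scale1r.
Qed.

Lemma coh_scaleDr : right_distributive coh_scale +%R.
Proof.
elim/quotW=> a; elim/quotW=> x; elim/quotW=> y.
rewrite -raddfD (coh_scale_pi a x) (coh_scale_pi a y) (coh_scale_pi a (x + y)) -raddfD.
by congr piM; apply: val_inj; exact: scalerDr.
Qed.

Lemma coh_scaleDl x : {morph coh_scale^~ x : a b / a + b}.
Proof.
move: x; elim/quotW=> x; elim/quotW=> a; elim/quotW=> b.
have -> : (\pi_(coh (cdg A) 0) a : H0t A) + (\pi_(coh (cdg A) 0) b : H0t A)
    = \pi_(coh (cdg A) 0) (a + b) by exact/esym/pi0D.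
rewrite (coh_scale_pi a x) (coh_scale_pi b x) (coh_scale_pi (a + b) x) -raddfD.
by congr piM; apply: val_inj; exact: scalerDl.
Qed.

Definition cohH0 : Type := H.
HB.instance Definition _ := GRing.Zmodule.on (cohH0).
HB.instance Definition _ := GRing.Zmodule_isLmodule.Build (H0t A) (cohH0)
  coh_scaleA coh_scale1 coh_scaleDr coh_scaleDl.

(* 0 if z is not a cocycle of degree i *)
Definition cls (z : M) : cohH0 := if insub z is Some w then piM w else 0.

Lemma clsE (z : Zgrp (dgm M) i) : cls (val z) = piM z.
Proof. by rewrite /cls valK. Qed.

Lemma zc_lift (z : M) : zc i z -> exists w : Zgrp (dgm M) i, z = val w.
Proof. by move=> h; have zz : z \in cocycle (dgm M) i by [apply/asboolP]; exists (Zsub zz). Qed.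

Lemma cls0 : cls 0 = 0.
Proof. by rewrite -[X in cls X]/(val (0 : Zgrp (dgm M) i)) clsE raddf0. Qed.

Lemma clsD (x y : M) : zc i x -> zc i y -> cls (x + y) = cls x + cls y.
Proof.
move=> /zc_lift[v ->] /zc_lift[w ->].
by rewrite -[X in cls X]/(val (v + w)) !clsE raddfD.
Qed.

Lemma zcN (x : M) : zc i x -> zc i (- x).
Proof. by case=> dx zx; split; [exact: degN | rewrite raddfN /= zx oppr0]. Qed.

Lemma clsN (x : M) : zc i x -> cls (- x) = - cls x.
Proof.
move=> zx; apply/eqP; rewrite -addr_eq0 -clsD //; last exact: zcN.
by rewrite addNr cls0.
Qed.

Lemma cls_sg (x : M) k : zc i x -> cls (x *~ sg k) = cls x *~ sg k.
Proof.
move=> zx; have [->|->] : sg k = 1 \/ sg k = -1; last by rewrite !mulrNz !mulr1z clsN.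
  by have /eqP := sgsq k; rewrite -expr2 sqrf_eq1 => /orP[] /eqP ->; [left | right].
by rewrite !mulr1z.
Qed.

Lemma cls_sum (I : eqType) (s : seq I) (F : I -> M) : (forall x, x \in s -> zc i (F x)) ->
  zc i (\sum_(x <- s) F x) /\ cls (\sum_(x <- s) F x) = \sum_(x <- s) cls (F x).
Proof.
elim: s => [|x s IH] h; first by rewrite !big_nil cls0; split=> //; exact: zc0.
have [|zs es] := IH; first by move=> y ys; apply: h; rewrite inE ys orbT.
have zx := h x (mem_head _ _).
by rewrite !big_cons clsD // es; split=> //; exact: zcD.
Qed.

Lemma cls_eq0 (x : M) : zc i x -> cls x = 0 -> exists2 y, deg (dgm M) (i - 1) y & x = df M y.
Proof.
move=> /zc_lift[v ->]; rewrite clsE -(raddf0 piM) => /eqP.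
by rewrite -Quotient.idealrBE subr0 => /asboolP.
Qed.

Lemma cls_cob (y x : M) : zc i x -> x = df M y -> cls x = 0.
Proof.
case=> dx zx e; have [w ew] := zc_lift (conj dx zx).
rewrite ew clsE -(raddf0 piM); apply/eqP; rewrite -Quotient.idealrBE subr0.
by apply/asboolP; rewrite -ew; exact: deg_cobound e.
Qed.

Lemma cls_surj n : exists2 x, zc i x & cls x = n.
Proof.
exists (val (repr n)); last by rewrite clsE reprK.
by have /asboolP := valP (repr n).
Qed.

Lemma cls_scale (a : A) (x : M) : deg (cdg A) 0 a -> zc i x ->
  zc i (a *: x) /\ (h0_map a : H0t A) *: cls x = cls (a *: x).
Proof.
move=> da /zc_lift[w ->].
have e : a *: val w = val (Zscale (Zsub (gr0_cocycle a)) w) by rewrite /= da.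
rewrite e !clsE -coh_scale_pi; split=> //.
by have /asboolP := valP (Zscale (Zsub (gr0_cocycle a)) w).
Qed.

End CohomologyModule.

(** * Lifting differentials *)

Section ConcentratedTwist.
Variable R : comPzRingType.

Lemma twn_conc k (a : concRing R) : twn (cdg (concRing R)) k a = a.
Proof.
move: a; apply: (@hom_ext _ (cdg (concRing R))) => [||i a da] //; first exact: twnB.
rewrite (twnE k da); case: (conc_deg da) => [->|->]; first by rewrite mulr0.
by rewrite mul0rz.
Qed.

Lemma tw_conc (a : concRing R) : tw (cdg (concRing R)) a = a.
Proof. by rewrite -twn1 twn_conc. Qed.

Variables (S : sfData (concRing R)).
Local Notation F := (sfMod S).

Lemma sfD_conc (x y : sfX S) : sfD x y != 0 -> sfdg y = sfdg x + 1.
Proof.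
have /fdegP/(_ y) dxy := sf_deg x; case: (conc_deg dxy) => [|->]; last by rewrite eqxx.
by move=> e _; lia.
Qed.

Section Kappa.
Variables (V : lmodType R) (e : int).
Local Notation N := (concMod V e).

Lemma kapZ_conc z b (t : F ⊗ N) : kap z (b *: t) = b *: kap z t.
Proof.
move: t; apply: (@sf_tens_ext _ _ _ _ (fun t => kap z (b *: t)) (fun t => b *: kap z t)).
- by move=> v w; rewrite scalerBr kapB.
- by move=> v w; rewrite kapB scalerBr.
move=> x j n _; rewrite scale_tens kap_bas kap_tens twn_conc scale_bas singE.
by case: ifP => _; rewrite ?scale0r ?scaler0.
Qed.

(** N has zero differential and twists over H are trivial, so the differential of F (x) N is plain
    matrix multiplication. *)
Lemma kap_df_conc w (t : F ⊗ N) s : uniq s -> (forall x, x \notin s -> kap x t = 0) ->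
  kap w (df (F ⊗ N) t) = \sum_(y <- s) sfD y w *: kap y t.
Proof.
move=> us ts; have [r [ur rt et]] := kap_decomp t.
have -> : kap w (df (F ⊗ N) t) = \sum_(y <- r) sfD y w *: kap y t.
  rewrite {1}et (zmorS (dfB _)) (zmorS (kapB _)); apply: eq_bigr => y _.
  by rewrite df_tens_bas raddf0 mul0rz addr0 kap_tens twn_conc.
pose q := undup (s ++ r).
have h (s' : seq (sfX S)) : uniq s' -> {subset s' <= q} ->
    (forall x, x \notin s' -> kap x t = 0) ->
    \sum_(y <- q) sfD y w *: kap y t = \sum_(y <- s') sfD y w *: kap y t.
  move=> us' sq ts'; rewrite (bigID (mem s')) /= [X in _ + X]big1 => [|x xr].
    rewrite addr0 -big_filter; apply: perm_big; apply: uniq_perm => //.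
      by apply: filter_uniq; exact: undup_uniq.
    by move=> x; rewrite mem_filter /=; case: (boolP (x \in s')) => //= /sq.
  by rewrite ts' // scaler0.
rewrite -(h r) // ?(h s) // => x xs; by rewrite mem_undup mem_cat xs ?orbT.
Qed.

End Kappa.
End ConcentratedTwist.

(** * Connections on free graded modules and their curvature *)

Section Matrices.
Variables (A : cdgRing) (X : choiceType) (dg : X -> int).
Local Notation FA := (fsf X A).
Implicit Types th ep : X -> FA.

(** The matrix part of the connection d + th on the free module; rows are indexed by generators. *)
Definition mat th (f : FA) : FA := fext (fun z a => tw (cdg A) a *: th z) f.

Lemma matE th (f : FA) y : mat th f y = \sum_(z <- fsupp f) tw (cdg A) (f z) * th z y.
Proof. by rewrite /mat /fext fsf_sum. Qed.

Lemma matB th f g : mat th (f - g) = mat th f - mat th g.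
Proof. by apply: fextB => x a b; rewrite raddfB /= scalerBl. Qed.

Lemma matD th f g : mat th (f + g) = mat th f + mat th g.
Proof. exact: (zmorD (matB th)). Qed.

Lemma matDl th ep f : mat (fun x => th x + ep x) f = mat th f + mat ep f.
Proof.
rewrite /mat /fext -big_split; apply: eq_bigr => x _; exact: scalerDr.
Qed.

Lemma matBl th ep f : mat (fun x => th x - ep x) f = mat th f - mat ep f.
Proof.
rewrite /mat /fext -sumrB; apply: eq_bigr => x _; exact: scalerBr.
Qed.

Lemma mat_eq0 th (f : FA) y : (forall z, f z != 0 -> th z y != 0 -> False) -> mat th f y = 0.
Proof.
move=> h; rewrite matE big1 // => z _.
have [->|fz] := eqVneq (f z) 0; first by rewrite raddf0 mul0r.
by have [->|/h//] := eqVneq (th z y) 0; rewrite mulr0.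
Qed.

Lemma mat0l f : mat (fun=> 0) f = 0.
Proof. by rewrite /mat /fext big1 // => z _; rewrite scaler0. Qed.

Lemma fdiff_mat th (f : FA) y : fdiff th f y = diff (cdg A) (f y) + mat th f y.
Proof. by rewrite fdiffE matE. Qed.

(** A has no positive degrees, so an element of degree n only involves generators of degree at least
    n. The degree counts below all rest on this triangularity. *)
Lemma fdeg_ge n (f : FA) y : fdeg dg n f -> f y != 0 -> n <= dg y.
Proof.
move=> /fdegP/(_ y) d; apply: contraNle => ny; apply/eqP.
by apply: (cdg_npos (i := n - dg y)) d; lia.
Qed.

Definition mdeg th := forall x, fdeg dg (dg x + 1) (th x).

Definition curv th x := fdiff th (th x).

Lemma curv_deg th x : mdeg th -> fdeg dg (dg x + 2) (curv th x).
Proof.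
move=> md; rewrite /fdeg /curv; have -> : dg x + 2 = dg x + 1 + 1 by lia.
by rewrite -fdiff_gr // [fgr _ _ _]md.
Qed.

(* the Bianchi identity: the square of the operator given by th is linear *)
Lemma curv_bianchi th x w : diff (cdg A) (curv th x w) + mat th (curv th x) w =
  \sum_(z <- fsupp (th x)) th x z * curv th z w.
Proof.
rewrite -fdiff_mat /curv.
have -> : fdiff th (fdiff th (th x)) =
    \sum_(z <- fsupp (th x)) fdiff th (fdiff th (sing z (th x z))).
  have sB : zmod_morphism (fun f : FA => fdiff th (fdiff th f)).
    by move=> f g; rewrite !fdiffB.
  have := zmorS sB (fsupp (th x)) (fun z => sing z (th x z)).
  by rewrite -fsf_sing.
rewrite fsf_sum; apply: eq_bigr => z _.
by rewrite -[th x z in LHS]mulr1 -singZ fdiff_sqZ fdiff_e fsfZ.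
Qed.

(** The entry of the curvature at y has degree dg x + 2 - dg y, so what survives has degree at most
    -k. *)
Definition stage (k : int) th := forall x y, dg y < dg x + 2 + k -> curv th x y = 0.

Lemma stage_ge k th x y : stage k th -> curv th x y != 0 -> dg x + 2 + k <= dg y.
Proof. by move=> st; apply: contraNle => lt; rewrite st. Qed.

(** In the Bianchi identity every product would raise the degree of the generators by at least 3 + k
    instead of 2 + k, so only d of the entry is left. *)
Lemma stage_zc k th x y : mdeg th -> stage k th -> dg y = dg x + 2 + k ->
  zc (M := regMod A) (- k) (curv th x y).
Proof.
move=> md st e; split.
  have /fdegP/(_ y) := curv_deg x md; rewrite e.
  by have -> : dg x + 2 - (dg x + 2 + k) = - k by lia.
have := curv_bianchi th x y.
rewrite mat_eq0 => [|z /(stage_ge st) h1 /(fdeg_ge (md z)) h2]; last by lia.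
rewrite addr0 big1 => [e'|z _]; first exact: e'.
have [->|/(fdeg_ge (md x)) h1] := eqVneq (th x z) 0; first by rewrite mul0r.
by rewrite [curv th z y]st ?mulr0 //; lia.
Qed.

Section Products.
Variable k : int.
Local Notation Z := (zc (M := regMod A) (- k)).
Local Notation cl := (cls (M := regMod A) (- k)).

Lemma cls_mull (a c : A) : deg (cdg A) 0 a -> Z c ->
  Z (a * c) /\ cl (a * c) = (h0_map a : H0t A) *: cl c.
Proof.
by move=> da zcc; have [h1 h2] := cls_scale da zcc; split; [exact: h1 | exact: esym h2].
Qed.

Lemma cls_mulr (a c : A) : deg (cdg A) 0 a -> Z c ->
  Z (tw (cdg A) c * a) /\ cl (tw (cdg A) c * a) = ((h0_map a : H0t A) *: cl c) *~ sg k.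
Proof.
move=> da zcc; have [h1 h2] := cls_mull da zcc.
have -> : tw (cdg A) c * a = (a * c) *~ sg k.
  have [dc _] := zcc; rewrite (twE (D := cdg A) dc) sgN mulrzAl; congr (_ *~ _).
  by rewrite (cdg_comm da dc) mul0r mulr1z.
rewrite -h2; split; last exact: (cls_sg (M := regMod A)).
case: h1 => d1 z1; split; first exact: degMz.
by rewrite raddfMz /= [diff _ _]z1 mul0rz.
Qed.

Lemma cls_zero : Z 0 /\ cl 0 = 0.
Proof. by split; [exact: zc0 | exact: cls0]. Qed.

End Products.

(* th is changed by eta on coefficients of degree -k, and by xi in degree
   -(k+1), where xi bounds the remaining part of the curvature. *)
Lemma stage_step k th (eta : X -> FA) : 0 <= k -> mdeg th -> stage k th ->
  (forall x y, eta x y != 0 -> dg y = dg x + 1 + k) ->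
  (forall x y, zc (M := regMod A) (- k) (eta x y)) ->
  (k = 0 -> forall x, eta x = 0) ->
  (forall x w, dg w = dg x + 2 + k -> exists2 a, deg (cdg A) (- k - 1) a &
    curv th x w - mat th (eta x) w - mat eta (th x) w = diff (cdg A) a) ->
  exists ep : X -> FA, [/\ mdeg (fun x => th x - ep x), stage (k + 1) (fun x => th x - ep x),
    forall x y, ep x y != 0 -> dg x + 1 + k <= dg y
    & forall x y, h0_map (ep x y) = 0].
Proof.
move=> k0 md st hdg hz h00 hr.
pose r x := curv th x - mat th (eta x) - mat eta (th x).
(* Zero must go to zero, so that the rows of [xi] keep finite support. *)
have ex (v : A) : exists a : A, (v = 0 -> a = 0) /\
    ((exists2 a', deg (cdg A) (- k - 1) a' & v = diff (cdg A) a') ->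
      deg (cdg A) (- k - 1) a /\ v = diff (cdg A) a).
  have [->|v0] := eqVneq v 0.
    by exists 0; split=> // _; split; [exact: deg0 | rewrite raddf0].
  have [[a' da e]|n] := pselect (exists2 a', deg (cdg A) (- k - 1) a' & v = diff (cdg A) a').
    by exists a'; split=> // v0'; rewrite v0' eqxx in v0.
  by exists 0; split=> // /n.
have [sol solP] := choice ex.
have xi_fin x : (fun w => if dg w == dg x + 2 + k then sol (r x w) else 0) \in
    fin_supp (X := X) (A := A).
  apply/asboolP; exists (fsupp (r x)) => w /fsupp_out rw.
  by case: ifP => // _; case: (solP (r x w)) => -> // _; exact: rw.
pose xi x : FA := Fsf (xi_fin x).
have xiP x w : dg w = dg x + 2 + k ->
    deg (cdg A) (- k - 1) (xi x w) /\ r x w = diff (cdg A) (xi x w).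
  move=> e; rewrite /xi /= e eqxx; case: (solP (r x w)) => _; apply.
  exact: hr.
have xi_dg x w : xi x w != 0 -> dg w = dg x + 2 + k.
  by rewrite /xi /=; case: (eqVneq (dg w) (dg x + 2 + k)) => // _; rewrite eqxx.
pose ep x := eta x + xi x.
have ep_dg x y : ep x y != 0 -> dg x + 1 + k <= dg y.
  rewrite /ep fsfD; have [e0|/hdg e _] := eqVneq (eta x y) 0; last by lia.
  by rewrite e0 add0r => /xi_dg; lia.
have ep_deg x y : deg (cdg A) (dg x + 1 - dg y) (ep x y).
  rewrite /ep fsfD; apply: degD.
    have [->|/hdg e] := eqVneq (eta x y) 0; first exact: deg0.
    have -> : dg x + 1 - dg y = - k by lia.
    by case: (hz x y).
  have [->|/xi_dg e] := eqVneq (xi x y) 0; first exact: deg0.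
  have -> : dg x + 1 - dg y = - k - 1 by lia.
  by case: (xiP x y e).
have md' : mdeg (fun x => th x - ep x).
  move=> x; apply/fdegP => y; rewrite fsfB; apply: degD.
    by have /fdegP := md x; apply.
  by apply: degN; exact: ep_deg.
have hd x w : diff (cdg A) (ep x w) = diff (cdg A) (xi x w).
  by rewrite raddfD /=; case: (hz x w) => _; rewrite [X in X = 0 -> _]/= => ->; rewrite add0r.
exists ep; split=> //.
- move=> x w lt.
  have low z : th x z != 0 -> dg x + 1 <= dg z by move/(fdeg_ge (md x)).
  have low' z y : th z y != 0 -> dg z + 1 <= dg y by move/(fdeg_ge (md z)).
  have E : curv (fun x => th x - ep x) x w = curv th x w - diff (cdg A) (ep x w)
      - mat th (ep x) w - mat ep (th x) w + mat ep (ep x) w.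
    rewrite /curv fdiff_mat matBl !matB !fsfB raddfB /= fdiff_mat.
    rewrite opprB [_ + _ - diff _ _]addrAC -!addrA.
    by congr (_ + (_ + (_ + (_ + _)))); exact: addrC.
  rewrite E hd; have [e|ne] := eqVneq (dg w) (dg x + 2 + k); last first.
    have lt' : dg w < dg x + 2 + k by lia.
    rewrite (st x w lt') mat_eq0 => [|z /ep_dg h1 /low' h2]; last by lia.
    rewrite mat_eq0 => [|z /low h1 /ep_dg h2]; last by lia.
    rewrite mat_eq0 => [|z /ep_dg h1 /ep_dg h2]; last by lia.
    have -> : xi x w = 0 by rewrite /xi /= (negPf ne).
    by rewrite raddf0 !subr0 addr0.
  have [_ <-] := xiP x w e.
  (* Two entries of [ep] raise the degree by at least 2 + 2k, too much if k > 0. For k = 0 [eta] is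
     zero and each entry already raises it by 2. *)
  have -> : mat ep (ep x) w = 0.
    have [k00|kn] := eqVneq k 0.
      have e0 y : ep y = xi y by rewrite /ep h00 // add0r.
      by apply: mat_eq0 => z; rewrite !e0 => /xi_dg h1 /xi_dg h2; lia.
    by apply: mat_eq0 => z /ep_dg h1 /ep_dg h2; lia.
  have -> : mat th (ep x) w = mat th (eta x) w.
    rewrite matD fsfD [X in _ + X]mat_eq0 ?addr0 // => z /xi_dg h1 /low' h2.
    by lia.
  have -> : mat ep (th x) w = mat eta (th x) w.
    rewrite matDl fsfD [X in _ + X]mat_eq0 ?addr0 // => z /low h1 /xi_dg h2.
    by lia.
  have zid (u v t : A) : u - (u - v - t) - v - t = 0.
    rewrite -[u - v - t]addrA -opprD opprB [u + _]addrC subrK.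
    by rewrite [v + t - v]addrAC subrr add0r subrr.
  by rewrite addr0 /r !fsfB; exact: zid.
move=> x y; rewrite /ep fsfD (zmorD (@h0_mapB A)).
have [k00|kn] := eqVneq k 0.
  rewrite h00 // fsf0 raddf0 add0r.
  have [->|/xi_dg e] := eqVneq (xi x y) 0; first exact: raddf0.
  by case: (xiP x y e) => d _; apply: h0_map0 d; lia.
rewrite (h0_map0 (i := - k)) ?add0r; [|by lia|by case: (hz x y)].
have [->|/xi_dg e] := eqVneq (xi x y) 0; first exact: raddf0.
by case: (xiP x y e) => d _; apply: h0_map0 d; lia.
Qed.

End Matrices.

Section Obstruction.
Variables (A : cdgRing) (S : sfData (H0 A)) (rank : sfX S -> nat) (Q : dgMod (H0 A)).
Hypothesis rk : ranked rank.
Hypothesis ip : inverse_pair (sfMod S) Q.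
Local Notation X := (sfX S).
Local Notation dg := (@sfdg _ S).
Local Notation D0 := (@sfD _ S).
Local Notation phi := (toH0 A).

Definition lifts (th : X -> fsf X A) := forall x y, h0_map (th x y) = D0 x y.

Let D0_dg x y : D0 x y != 0 -> dg y = dg x + 1. Proof. exact: sfD_conc. Qed.

Lemma stage0 (th : X -> fsf X A) : mdeg dg th -> stage dg 0 th.
Proof.
move=> md x y lt; apply/eqP; apply: contraTT lt => nz.
by have := fdeg_ge (curv_deg x md) nz; lia.
Qed.

Lemma lift_exists : exists th : X -> fsf X A, mdeg dg th /\ lifts th.
Proof.
have [l lP] := choice (@h0_map_surj A).
(* Lifting 0 to 0 keeps the rows finite. *)
have fin x : (fun y => if D0 x y == 0 then 0 else l (D0 x y)) \in fin_supp (X := X) (A := A).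
  by apply/asboolP; exists (fsupp (D0 x)) => y /fsupp_out ->; rewrite eqxx.
exists (fun x => Fsf (fin x)); split=> [x|x y] /=; last first.
  by case: eqP => [->|_]; [exact: raddf0 | case: (lP (D0 x y))].
apply/fdegP => y /=; case: (eqVneq (D0 x y) 0) => [_|/D0_dg e]; first exact: deg0.
have -> : dg x + 1 - dg y = 0 by lia.
by case: (lP (D0 x y)).
Qed.

Lemma lifts_sum (V : lmodType (H0t A)) (th : X -> fsf X A) x (c : X -> V) : lifts th ->
  \sum_(z <- fsupp (th x)) (D0 x z : H0t A) *: c z =
  \sum_(z <- fsupp (D0 x)) (D0 x z : H0t A) *: c z.
Proof.
move=> lt; have FB z : zmod_morphism (fun b : H0 A => (b : H0t A) *: c z).
  by move=> a b; exact: scalerBl.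
rewrite -(fextE FB (fsupp_uniq (th x))) // => z /fsupp_out tz.
by rewrite -(lt x z) tz raddf0.
Qed.

(** The degree 0 part of the curvature reduces to the square of the differential of S, which is
    zero; so the first correction meets no obstruction. *)
Lemma stage_step0 (th : X -> fsf X A) : mdeg dg th -> lifts th -> forall x w, dg w = dg x + 2 ->
  exists2 a, deg (cdg A) (- 1) a & curv th x w = diff (cdg A) a.
Proof.
move=> md lt x w e; apply: h0_map_eq0.
  have /fdegP/(_ w) := curv_deg x md; rewrite e.
  by have -> : dg x + 2 - (dg x + 2) = 0 by lia.
rewrite /curv fdiffE (zmorD (@h0_mapB A)) (h0_map_diff (th x w)) [diff _ _]/= /conc_diff add0r.
rewrite (zmorS (@h0_mapB A)).
transitivity (\sum_(z <- fsupp (th x)) (D0 x z : H0t A) *: (D0 z w : (H0t A)^o)).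
  have [_ hM] := h0_mapM A.
  apply: eq_bigr => z _; rewrite hM lt; congr (_ * _).
  by rewrite -lt -[RHS](tw_conc (R := H0t A)); exact/esym/(tw_phi phi).
rewrite lifts_sum //; have := fdiffE D0 (D0 x) w; rewrite sf_sq fsf0 => /esym.
rewrite [diff _ _]/= /conc_diff add0r => e0; rewrite -[RHS]e0; apply: eq_bigr => z _.
by rewrite (tw_conc (R := H0t A)).
Qed.

Section Step.
Variables (k : int) (th : X -> fsf X A).
Hypotheses (k0 : 0 < k) (md : mdeg dg th) (lt : lifts th) (st : stage dg k th).
Local Notation H := (cohH0 (regMod A) (- k)).
Local Notation N := (concMod H (- (k + 2))).
Local Notation F := (sfMod S).
Local Notation Z := (zc (M := regMod A) (- k)).
Local Notation cl := (cls (M := regMod A) (- k)).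

Definition obs x w : H := if dg w == dg x + 2 + k then cl (curv th x w) else 0.

Let low x y : th x y != 0 -> dg x + 1 <= dg y.
Proof. exact: fdeg_ge (md x). Qed.

Let th0 x y : dg y = dg x + 1 -> deg (cdg A) 0 (th x y).
Proof.
move=> e; have /fdegP/(_ y) := md x; rewrite e.
by have -> : dg x + 1 - (dg x + 1) = 0 by lia.
Qed.

(** The Bianchi identity read in H^{-k}(A): its derivative term is a coboundary, and moving the
    curvature past [th] costs the sign (-1)^k. *)
Lemma obs_cocycle x w :
  \sum_(y <- fsupp (curv th x)) (D0 y w : H0t A) *: obs x y =
  (\sum_(z <- fsupp (D0 x)) (D0 x z : H0t A) *: obs z w) *~ sg k.
Proof.
have [ew|nw] := eqVneq (dg w) (dg x + 3 + k); last first.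
  rewrite big1 => [|y _]; last first.
    have [->|/D0_dg e] := eqVneq (D0 y w) 0; first exact: scale0r.
    by rewrite /obs; case: eqP => [e'|_]; [lia | rewrite scaler0].
  rewrite big1 ?mul0rz // => z _.
  have [->|/D0_dg e] := eqVneq (D0 x z) 0; first exact: scale0r.
  by rewrite /obs; case: eqP => [e'|_]; [lia | rewrite scaler0].
have T1 z : Z (th x z * curv th z w) /\
    cl (th x z * curv th z w) = (D0 x z : H0t A) *: obs z w.
  have [ez|nz] := eqVneq (dg z) (dg x + 1).
    have ew' : dg w = dg z + 2 + k by lia.
    have [h1 h2] := cls_mull (th0 ez) (stage_zc md st ew').
    by split=> //; rewrite h2 /obs ew' eqxx lt.
  have -> : D0 x z = 0 by apply/eqP; apply: contraNT nz => /D0_dg ->.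
  have -> : th x z * curv th z w = 0.
    have [->|/low h1] := eqVneq (th x z) 0; first exact: mul0r.
    by rewrite (st (x := z)) ?mulr0 //; lia.
  by rewrite scale0r; exact: cls_zero.
have T2 y : Z (tw (cdg A) (curv th x y) * th y w) /\
    cl (tw (cdg A) (curv th x y) * th y w) = ((D0 y w : H0t A) *: obs x y) *~ sg k.
  have [ey|ny] := eqVneq (dg y) (dg x + 2 + k).
    have ew' : dg w = dg y + 1 by lia.
    have [h1 h2] := cls_mulr (th0 ew') (stage_zc md st ey).
    by split=> //; rewrite h2 /obs ey eqxx lt.
  rewrite /obs (negPf ny) scaler0 mul0rz.
  have -> : tw (cdg A) (curv th x y) * th y w = 0.
    have [->|/(stage_ge st) h1] := eqVneq (curv th x y) 0; first by rewrite raddf0 mul0r.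
    have [->|/low h2] := eqVneq (th y w) 0; first exact: mulr0.
    by lia.
  exact: cls_zero.
have B := curv_bianchi th x w; rewrite matE in B.
have [zs1 cs1] := cls_sum (M := regMod A) (s := fsupp (th x)) (fun z _ => (T1 z).1).
have [zs2 cs2] := cls_sum (M := regMod A) (s := fsupp (curv th x)) (fun z _ => (T2 z).1).
have d0 : cl (diff (cdg A) (curv th x w)) = 0.
  apply: (cls_cob (M := regMod A) (y := curv th x w)) => //.
  have -> : diff (cdg A) (curv th x w) = \sum_(z <- fsupp (th x)) th x z * curv th z w
     - \sum_(y <- fsupp (curv th x)) tw (cdg A) (curv th x y) * th y w.
    by rewrite -B addrK.
  by apply: (zcD (M := regMod A)) zs1 _; exact: (zcN (M := regMod A)).
have e2 : \sum_(z <- fsupp (th x)) cl (th x z * curv th z w) =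
    \sum_(y <- fsupp (curv th x)) cl (tw (cdg A) (curv th x y) * th y w).
  rewrite -[LHS]cs1 -[RHS]cs2.
  have := congr1 cl B; rewrite (clsD (M := regMod A)) //.
    by rewrite d0 add0r => <-.
  have -> : diff (cdg A) (curv th x w) = \sum_(z <- fsupp (th x)) th x z * curv th z w
     - \sum_(y <- fsupp (curv th x)) tw (cdg A) (curv th x y) * th y w.
    by rewrite -B addrK.
  by apply: (zcD (M := regMod A)) zs1 _; exact: (zcN (M := regMod A)).
rewrite -(lifts_sum x (obs ^~ w) lt) -[LHS](mulz_sgsg _ k); congr (_ *~ _).
transitivity (\sum_(y <- fsupp (curv th x)) cl (tw (cdg A) (curv th x y) * th y w)).
  by rewrite mulrz_suml; apply: eq_bigr => y _; case: (T2 y).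
by rewrite -e2; apply: eq_bigr => z _; case: (T1 z).
Qed.

(** The chain map with matrix [obs]; the sign (-1)^(k dg x) absorbs the (-1)^k of [obs_cocycle],
    since dg z = dg x + 1 along the differential. *)
Let u0 (x : X) : F ⊗ N :=
  \sum_(y <- fsupp (curv th x)) tens (cdgId _) (bas y) (obs x y *~ sg (k * dg x) : N).

Let kap_u0 w x : kap w (u0 x) = obs x w *~ sg (k * dg x).
Proof.
rewrite /u0 (zmorS (kapB _)); under eq_bigr do rewrite kap_bas.
have [ws|ws] := boolP (w \in fsupp (curv th x)).
  rewrite (bigD1_seq w) ?fsupp_uniq //= eqxx big1 ?addr0 // => y yw.
  by rewrite eq_sym (negPf yw).
rewrite big_seq big1 => [|y ys]; last by case: eqP => // wy; rewrite wy ys in ws.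
rewrite /obs (fsupp_out ws); case: ifP => _; last by rewrite mul0rz.
by rewrite (cls_zero A k).2 mul0rz.
Qed.

Let u0_deg x : deg (dgm (F ⊗ N)) (dg x) (u0 x).
Proof.
rewrite /u0; elim/big_ind: _ => [|v w|y _]; [exact: deg0 | exact: degD |].
rewrite /obs; case: eqP => [e|_]; last by rewrite mul0rz raddf0; exact: deg0.
have -> : dg x = dg y + (- (k + 2)) by lia.
by apply: deg_tens (deg_bas y) _; rewrite /deg /= /cm_gr eqxx.
Qed.

Let u0_diff x : df (F ⊗ N) (u0 x) = fext (fun x (a : H0 A) => a *: u0 x) (D0 x).
Proof.
apply: kap_inj => w.
rewrite (kap_df_conc w (fsupp_uniq (curv th x))) => [|y /fsupp_out ey]; last first.
  by rewrite kap_u0 /obs ey (cls_zero A k).2 if_same mul0rz.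
rewrite /fext (zmorS (kapB _)).
under eq_bigr do rewrite kap_u0.
transitivity ((\sum_(y <- fsupp (curv th x)) (D0 y w : H0t A) *: obs x y) *~ sg (k * dg x)).
  by rewrite mulrz_suml; apply: eq_bigr => y _; exact: (esym (scalerMzr _ _ _)).
rewrite obs_cocycle -mulrzA mulrz_suml; apply: eq_bigr => z _.
rewrite kapZ_conc kap_u0; have [->|/D0_dg ->] := eqVneq (D0 x z) 0.
  by rewrite !scale0r mul0rz.
rewrite -scalerMzr -sgD; congr (_ *~ _); apply: (@sg_eq 0); ring.
Qed.

(** [g] is the matrix of a null-homotopy of the map given by [u0]. It exists by [ext_vanish],
    because N sits in degree -(k + 2) and so has no cohomology in degree 0. *)
Lemma obs_null : exists g : X -> X -> H,
  [/\ forall x y, g x y != 0 -> dg y = dg x + 1 + k,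
      forall x, exists s : seq X, forall y, y \notin s -> g x y = 0
    & forall x w s, uniq s -> (forall y, y \notin s -> g x y = 0) ->
      obs x w *~ sg (k * dg x) = \sum_(y <- s) (D0 y w : H0t A) *: g x y
        + \sum_(z <- fsupp (D0 x)) (D0 x z : H0t A) *: g z w].
Proof.
have N0 : exact_at 0 N.
  by move=> z dz _; exists 0; case: (cm_deg dz) => [|->]; [lia | rewrite raddf0].
have [h [hB hZ hd he]] := ext_vanish rk ip N0 (sfHom u0_deg u0_diff).
exists (fun x y => kap y (h (bas x))); split=> [x y|x|x w s us hs].
- have := kap_deg y (hd _ _ (deg_bas x)).
  by case/cm_deg => [e _|->]; [lia | rewrite eqxx].
- by have [s [_ hs _]] := kap_decomp (h (bas x)); exists s.
rewrite -kap_u0 -(sfHom_bas u0_deg u0_diff) he (zmorD (kapB _)); congr (_ + _).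
  exact: (kap_df_conc w us hs).
rewrite df_bas.
have -> : h (D0 x) = \sum_(z <- fsupp (D0 x)) D0 x z *: h (bas z).
  rewrite {1}(fsf_sing (D0 x)) (zmorS hB); apply: eq_bigr => z _.
  by rewrite -(scale_bas (S := S)) hZ (tw_conc (R := H0t A)).
rewrite (zmorS (kapB _)); apply: eq_bigr => z _; exact: kapZ_conc.
Qed.

(** Cocycles representing the entries of [g] form [eta]; the homotopy equation then says that the
    remaining curvature in degree -k is a coboundary. *)
Lemma stage_succ : exists ep : X -> fsf X A,
  [/\ mdeg dg (fun x => th x - ep x), stage dg (k + 1) (fun x => th x - ep x),
    forall x y, ep x y != 0 -> dg x + 1 + k <= dg y
    & forall x y, h0_map (ep x y) = 0].
Proof.
have [g [gdg gfin ge]] := obs_null.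
have ex (n : H) : exists a : A, [/\ Z a, cl a = n & n = 0 -> a = 0].
  have [->|n0] := eqVneq n 0.
    by exists 0; case: (cls_zero A k) => h1 h2; split.
  have [a za ea] := cls_surj (M := regMod A) (i := - k) n.
  by exists a; split=> // n00; rewrite n00 eqxx in n0.
have [r rP] := choice ex.
(* With this sign both terms of the homotopy equation appear with (-1)^(k dg x): the extra k cancels
   the twist of [cls_mulr] in one, and the shift dg z = dg x + 1 in the other. *)
pose c x y := g x y *~ sg (k * dg x + k).
have c0 x y : g x y = 0 -> c x y = 0 by rewrite /c => ->; rewrite mul0rz.
have fin x : (fun y => r (c x y)) \in fin_supp (X := X) (A := A).
  have [s hs] := gfin x; apply/asboolP; exists s => y /hs/c0 e.
  by case: (rP (c x y)) => _ _; apply.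
pose eta x : fsf X A := Fsf (fin x).
have etaE x y : eta x y = r (c x y) by [].
have eta_dg x y : eta x y != 0 -> dg y = dg x + 1 + k.
  move=> nz; apply: gdg; apply: contraNneq nz => /c0 e; rewrite etaE.
  by case: (rP (c x y)) => _ _ ->.
have eta_z x y : Z (eta x y) by rewrite etaE; case: (rP (c x y)).
have eta_cl x y : cl (eta x y) = c x y by rewrite etaE; case: (rP (c x y)).
have g_supp x y : eta x y = 0 -> g x y = 0.
  move=> e0; have := eta_cl x y; rewrite e0 (cls_zero A k).2 /c => e.
  by rewrite -[g x y](mulz_sgsg _ (k * dg x + k)) -e mul0rz.
apply: (stage_step (eta := eta)) => //; first by lia.
- by move=> kz; lia.
move=> x w ew.
have T1 y : Z (tw (cdg A) (eta x y) * th y w) /\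
    cl (tw (cdg A) (eta x y) * th y w) = ((D0 y w : H0t A) *: g x y) *~ sg (k * dg x).
  have [e0|/eta_dg ey] := eqVneq (eta x y) 0.
    by rewrite e0 raddf0 mul0r (g_supp _ _ e0) scaler0 mul0rz; exact: cls_zero.
  have ew' : dg w = dg y + 1 by lia.
  have [h1 h2] := cls_mulr (th0 ew') (eta_z x y); split=> //.
  rewrite h2 eta_cl lt /c -scalerMzr -mulrzA -sgD.
  by congr (_ *~ _); apply: (@sg_eq k); ring.
have T2 z : Z (tw (cdg A) (th x z) * eta z w) /\
    cl (tw (cdg A) (th x z) * eta z w) = ((D0 x z : H0t A) *: g z w) *~ sg (k * dg x).
  have [ez|nz] := eqVneq (dg z) (dg x + 1).
    have t0 := th0 ez; rewrite (twE t0) mulr1z.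
    have [h1 h2] := cls_mull t0 (eta_z z w); split=> //.
    rewrite h2 eta_cl lt /c -scalerMzr ez.
    by congr (_ *~ _); apply: (@sg_eq k); ring.
  have -> : D0 x z = 0 by apply/eqP; apply: contraNT nz => /D0_dg ->.
  have -> : tw (cdg A) (th x z) * eta z w = 0.
    have [->|/low h1] := eqVneq (th x z) 0; first by rewrite raddf0 mul0r.
    have [->|/eta_dg h2] := eqVneq (eta z w) 0; first by rewrite mulr0.
    by lia.
  by rewrite scale0r mul0rz; exact: cls_zero.
rewrite !matE.
have [zs1 cs1] := cls_sum (M := regMod A) (s := fsupp (eta x)) (fun z _ => (T1 z).1).
have [zs2 cs2] := cls_sum (M := regMod A) (s := fsupp (th x)) (fun z _ => (T2 z).1).
have zc0' := stage_zc md st ew.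
have zn1 := zcN (M := regMod A) zs1; have zn2 := zcN (M := regMod A) zs2.
have z12 := zcD (M := regMod A) zc0' zn1.
apply: (cls_eq0 (M := regMod A) (i := - k)); first exact: (zcD (M := regMod A) z12 zn2).
rewrite (clsD (M := regMod A)) // (clsD (M := regMod A)) //.
rewrite !(clsN (M := regMod A)) // [cl (\sum_(z <- fsupp (eta x)) _)]cs1.
rewrite [cl (\sum_(z <- fsupp (th x)) _)]cs2 -addrA -opprD; apply/eqP; rewrite subr_eq0.
have eo : obs x w = cl (curv th x w) by rewrite /obs ew eqxx.
rewrite -eo -[obs x w](mulz_sgsg _ (k * dg x)).
rewrite (ge x w (fsupp (eta x)) (fsupp_uniq _)) => [|y /fsupp_out/g_supp //].
rewrite mulrzDl -(lifts_sum x (g ^~ w) lt) !mulrz_suml; apply/eqP; congr (_ + _).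
  by apply: eq_bigr => y _; case: (T1 y).
by apply: eq_bigr => y _; case: (T2 y).
Qed.

End Step.
End Obstruction.

Section Limit.
Variables (A : cdgRing) (S : sfData (H0 A)) (rank : sfX S -> nat) (Q : dgMod (H0 A)).
Hypothesis rk : ranked rank.
Hypothesis ip : inverse_pair (sfMod S) Q.
Variable b : int.
Local Notation X := (sfX S).
Local Notation dg := (@sfdg _ S).
Hypothesis dgb : forall x : X, dg x <= b.

(* Degrees are bounded above, so each row is changed only finitely often. *)
Lemma lift_flat : exists th : X -> fsf X A,
  [/\ mdeg dg th, lifts th & forall x, curv th x = 0].
Proof.
pose P (n : nat) (th : X -> fsf X A) := [/\ mdeg dg th, lifts th & stage dg n%:Z th].
have step (p : nat * (X -> fsf X A)) : exists th', P p.1 p.2 -> P p.1.+1 th' /\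
    forall x y, dg y < dg x + 1 + p.1%:Z -> th' x y = p.2 x y.
  case: p => n th; have [[md lt st]|np] := pselect (P n th); last by exists th => /np.
  have [ep [md' st' hep h0]] : exists ep : X -> fsf X A,
      [/\ mdeg dg (fun x => th x - ep x), stage dg (n%:Z + 1) (fun x => th x - ep x),
        forall x y, ep x y != 0 -> dg x + 1 + n%:Z <= dg y
      & forall x y, h0_map (ep x y) = 0].
    (* Stage 0 is separate: the curvature there is already a coboundary, so [eta] is zero, as
       [stage_step] demands for k = 0. *)
    case: n st => [|n] st; last first.
      by apply: (stage_succ rk ip _ md lt st).
    apply: (stage_step (eta := fun=> 0)) => //.
    - by move=> x y; rewrite fsf0 eqxx.
    - by move=> x y; exact: (zc0 (regMod A)).
    move=> x w e; rewrite mat0l (zmor0 (matB th)) !subr0.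
    by have [|a da ea] := stage_step0 md lt (x := x) (w := w); [rewrite e addr0 | exists a].
  exists (fun x => th x - ep x) => _; split=> [|x y lty].
    split=> // [x y|]; last by rewrite -[n.+1]addn1 PoszD.
    by rewrite fsfB (h0_mapB (th x y)) h0 subr0.
  rewrite fsfB; have [->|/hep] := eqVneq (ep x y) 0; first exact: subr0.
  by rewrite /= in lty; lia.
have [stp stpP] := choice step.
have [th0 [md0 lt0]] := lift_exists S.
pose T := fix T n := if n is m.+1 then stp (m, T m) else th0.
have PT n : P n (T n).
  by elim: n => [|n IH]; [split=> //; exact: stage0 | case: (stpP (n, T n) IH)].
have TS n x y : dg y < dg x + 1 + n%:Z -> T n.+1 x y = T n x y.
  by case: (stpP (n, T n) (PT n)) => _; apply.
(* From stage b - dg x on, row x could change only at generators of degree above b, and there are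
   none. *)
pose K x := `|b - dg x|%N.
have stab n m x : (K x <= n)%N -> (n <= m)%N -> T m x = T n x.
  move=> Kn; elim: m => [|m IH]; first by rewrite leqn0 => /eqP ->.
  rewrite leq_eqVlt => /predU1P[->//|nm]; rewrite -(IH nm).
  by apply: fsfP => y; apply: TS; have := dgb x; have := dgb y; rewrite /K in Kn; lia.
pose th x := T (K x) x.
have md : mdeg dg th by move=> x; case: (PT (K x)) => + _ _; apply.
exists th; split=> // [x y|x]; first by case: (PT (K x)) => _ + _; apply.
(* The curvature of row x involves only rows z with dg z > dg x; these are stable no later than row
   x. At that stage the curvature could survive only in degrees above b. *)
have -> : curv th x = curv (T (K x)) x.
  rewrite /curv; apply: fext_supp => [z|z|z]; last 2 first.
  - by rewrite !raddf0 scale0r addr0.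
  - by rewrite !raddf0 scale0r addr0.
  rewrite -/(th x) => /(fdeg_ge (md x)) h; congr (_ + _ *: _).
  apply/esym/stab; first exact: leqnn.
  by rewrite /K; have := dgb z; have := dgb x; lia.
apply: fsfP => y; case: (PT (K x)) => _ _; apply.
by have := dgb x; have := dgb y; rewrite /K; lia.
Qed.

End Limit.

Section BaseChangeLift.
Variables (A : cdgRing) (S : sfData (H0 A)).
Local Notation X := (sfX S).
Local Notation dg := (@sfdg _ S).
Local Notation phi := (toH0 A).
Variable th : X -> fsf X A.
Hypotheses (md : mdeg dg th) (lt : lifts th) (cv : forall x, curv th x = 0).

Definition liftData : sfData A := @SfData A X dg th md cv.

(** The lifted differential strictly raises the degrees of generators, so the distance to b is a
    rank. The rank of S need not serve, since the corrections may add entries. *)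
Lemma lift_ranked (b : int) : (forall x, dg x <= b) ->
  ranked (S := liftData) (fun x => `|b - dg x|%N).
Proof.
move=> hb x y /(fdeg_ge (md x)); rewrite /=; have := hb x; have := hb y; lia.
Qed.

Local Notation F := (sfMod liftData).
Local Notation G := (sfMod S).

Let p_fin (v : fsf X A) : (fun y => phi (v y)) \in fin_supp (X := X) (A := H0 A).
Proof. by apply/asboolP; exists (fsupp v) => y /fsupp_out ->; exact: raddf0. Qed.

Let p (v : F) : G := Fsf (p_fin v).

Let pB : zmod_morphism p.
Proof. by move=> v w; apply: fsfP => y; exact: (h0_mapB (v y)). Qed.

Let pZ a v : p (a *: v) = phi a *: p v.
Proof. by apply: fsfP => y; exact: (rmorphM phi). Qed.

Let p_bas (x : X) : p (bas (S := liftData) x) = bas (S := S) x.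
Proof.
by apply: fsfP => y /=; case: ifP => _; [exact: (rmorph1 phi) | exact: raddf0].
Qed.

Let p_diff v : p (df F v) = df G (p v).
Proof.
move: v; apply: (@sf_ext _ liftData _ (fun v => p (df F v)) (fun v => df G (p v)))
  => [v w|v w|x i a _].
- by rewrite raddfB pB.
- by rewrite pB raddfB.
rewrite pZ p_bas !leibniz !df_bas (zmorD pB) !pZ p_bas -cdgh_diff -tw_phi.
by congr (_ + _ *: _); apply: fsfP => y; exact: lt.
Qed.

Let b (c : regMod (H0 A)) (v : F) : G := (c : H0 A) *: p v.

(* H0 A is concentrated in degree 0, so no sign appears *)
Let b_bal i j (a : A) (c : regMod (H0 A)) : deg (dgm (regMod (H0 A))) j c ->
  (phi a *: c) *~ sg (i * j) = (c : H0 A) * phi a :> H0 A.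
Proof.
case/conc_deg=> [->|->]; last by rewrite scaler0 mul0rz mul0r.
by rewrite mulr0 mulr1z; exact: (mulrC (phi a : H0t A)).
Qed.

Lemma bc_lift_dgbal : dgbal phi b.
Proof.
split.
- split=> [v x y|c x y|i j a c v da dc]; rewrite /b.
  + exact: scalerBl.
  + by rewrite pB scalerBr.
  by rewrite pZ scalerA -(b_bal i _ dc); exact: scalerMzl.
- by move=> x c v; rewrite /b scalerA.
- move=> i j c v dc /fdegP dv; apply: dgm_degZ dc _.
  by apply/fdegP => y; exact: deg_phi (dv y).
by move=> i j c v dc dv; rewrite /b (dgm_leibniz (d := G) _ dc) p_diff.
Qed.

Definition bc_lift_hom : dgHom (bc phi F) G := tens_hom bc_lift_dgbal.

Lemma bc_lift_bij : bijective bc_lift_hom.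
Proof.
have hE c v : bc_lift_hom (tens phi (c : regMod (H0 A)) v) = (c : H0 A) *: p v.
  exact: tens_homE.
pose Q x (c : H0 A) : bc phi F := tens phi (c : regMod (H0 A)) (bas (S := liftData) x).
have QB x : zmod_morphism (Q x) by move=> c c'; exact: tensBl'.
pose q (f : G) : bc phi F := fext Q f.
have qB : zmod_morphism q by exact: fextB.
have qE x c : q (c *: bas x) = Q x c by rewrite scale_bas; exact: fext_sing.
exists q => f; move: f.
  apply: (@tensor_ext _ _ phi (regMod (H0 A)) F _ (fun t => q (bc_lift_hom t)) id) => //.
    by move=> t u; rewrite dgh_zmod qB.
  move=> i j c v dc _; move: v; apply: (@sf_ext _ liftData _
    (fun v => q (bc_lift_hom (tens phi (c : regMod (H0 A)) v)))
    (fun v => tens phi (c : regMod (H0 A)) v : bc phi F)) => [v w|v w|x k a da].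
  - by rewrite raddfB dgh_zmod qB.
  - exact: raddfB.
  rewrite hE pZ p_bas scalerA qE /Q (tensZ phi _ da dc) -tensMzl.
  by congr (tens phi _ _); exact/esym/b_bal.
apply: (@sf_ext _ S _ (fun f => bc_lift_hom (q f)) id) => [f g|//|x i c _].
  by rewrite qB dgh_zmod.
by rewrite qE hE p_bas.
Qed.

End BaseChangeLift.

Lemma sf_dg_bnd (A : cdgRing) (S : sfData A) n : (forall x : sfX S, sfdg x <= n) ->
  bnd n (sfMod S).
Proof.
move=> hn i ni z /fdegP dz _; exists 0; rewrite raddf0; apply: fsfP => x.
by apply: cdg_npos (dz x); have := hn x; lia.
Qed.

Lemma semifree_lift (A : cdgRing) (S : sfData (H0 A)) rank (Q : dgMod (H0 A)) b :
  ranked (S := S) rank -> inverse_pair (sfMod S) Q -> (forall x : sfX S, sfdg x <= b) ->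
  exists M : dgMod A, [/\ Kflat M, bnd b M & isoD (bc (toH0 A) M) (sfMod S)].
Proof.
move=> rk ip dgb; have [th [md lt cv]] := lift_flat rk ip dgb.
exists (sfMod (liftData md cv)); split.
- exact: sf_Kflat (lift_ranked (cv := cv) dgb).
- exact: sf_dg_bnd.
exact: isoD_bij (bc_lift_bij md lt cv).
Qed.

(** M and its inverse are lifted independently. The product of the lifts reduces to H, so
    [bc_reflects_reg], stated for bounded K-flat modules rather than invertible ones, shows that the
    lifts are inverse to each other. *)
Lemma inverse_pair_lift (A : cdgRing) (M N : dgMod (H0 A)) : inverse_pair M N ->
  exists M' N' : dgMod A, inverse_pair M' N' /\ isoD (bc (toH0 A) M') M.
Proof.
move=> ip; have [m bM] := inverse_pair_bnd ip.
have [n bN] := inverse_pair_bnd (inverse_pair_sym ip).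
have [S [rS [f [kS qf dS]]]] := semifree_resolution_bnd bM.
have [S' [rS' [f' [kS' qf' dS']]]] := semifree_resolution_bnd bN.
have ipS := inverse_pair_isoD ip (sf_Kflat kS) (isoD_sym (isoD_qis qf)).
have ipS' := inverse_pair_isoD (inverse_pair_sym ipS) (sf_Kflat kS') (isoD_sym (isoD_qis qf')).
have [L [kL bL eL]] := semifree_lift kS ipS dS.
have [L' [kL' bL' eL']] := semifree_lift kS' ipS' dS'.
exists L, L'; split; last exact: isoD_trans eL (isoD_qis qf).
split=> //; apply: bc_reflects_reg (Kflat_tens kL kL') (tens_bnd kL' bL' bL) _.
apply: isoD_trans (isoD_sym (isoD_bc_tens _ L kL')) _.
apply: isoD_trans (isoD_tensl _ (Kflat_bc (phi := toH0 A) kL') eL) _.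
case: (inverse_pair_sym ipS') => k1 k2 e; apply: isoD_trans e.
exact: isoD_tensr.
Qed.

Theorem theorem0p4 (A : cdgRing) :
  exists f : DPic A -> DPic (H0 A),
    [/\ forall x, dpic_map (toH0 A) x (f x),
        forall x y, exists2 z, dpic_mul x y z & dpic_mul (f x) (f y) (f z)
      & bijective f].
Proof.
apply: dpic_bijection => M N; first exact: bc_reflects_inverse_pair.
exact: inverse_pair_lift.
Qed.
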